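(* On any ideal Liouville domain $(F,\omega)$, ideal Liouville forms constitute an affine space. Given a function $u \colon F \to \mathbb{R}_{\ge 0}$ with regular level set $\partial F = \{u=0\}$, the underlying vector space can be described as consisting of all closed $1$-forms $\kappa$ on $\operatorname{Int} F$ satisfying the following equivalent conditions: (i) The form $u\kappa$ extends to a smooth form on $F$. (ii) The vector field $\vec\kappa/u$ extends to a smooth vector field on $F$ (which is automatically tangent to $K := \partial F$). (iii) There exists a function $f \colon F \to \mathbb{R}$ such that $\kappa - d(f \log u)$ is the restriction of a closed $1$-form on $F$.
   Context: All objects are smooth. A domain is a compact manifold with boundary. An ideal Liouville domain $(F,\omega)$ is a domain $F$ endowed with an exact symplectic form $\omega$ on $\operatorname{Int} F$ admitting a primitive $\lambda$ such that for some (and then any) function $u \colon F \to \mathbb{R}_{\ge 0}$ with regular level set $\partial F = \{u=0\}$, the product $u\lambda$ extends to a smooth $1$-form on $F$ which induces a contact form on $\partial F$. Such a primitive $\lambda$ is called an ideal Liouville form. For a $1$-form $\kappa$ on $\operatorname{Int} F$, the dual vector field $\vec\kappa$ is defined by $\iota_{\vec\kappa}\omega = \kappa$ (interior product).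
   Formalization: In (iii) the function f is additionally required to be locally constant near K = ∂F; for arbitrary smooth f, (iii) does not imply (i): f = u, κ = d(u log u) satisfies (iii), but uκ = (u + u log u) du does not extend smoothly. *)

(* Defs.v *)
(* MathComp-Analysis. *)
From HB Require Import structures.
From mathcomp Require Import all_boot all_order all_algebra.
From mathcomp Require Import all_classical all_reals all_analysis.

Set Implicit Arguments.
Unset Strict Implicit.
Unset Printing Implicit Defensive.

Import Order.TTheory GRing.Theory Num.Theory numFieldNormedType.Exports.

Local Open Scope classical_set_scope.
Local Open Scope ring_scope.

Section Euclidean.
Context {R : realType} {d : nat}.
Implicit Types (U V : set 'rV[R]_d) (g : 'rV[R]_d -> R).

(* { x_0 >= 0 } in R^d; it is all of R^0 when d = 0. *)
Definition halfspace : set 'rV[R]_d :=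
  [set x | forall a : 'I_d, a = 0%N :> nat -> 0 <= x 0 a].

(* Meaningful for V open. *)
Fixpoint Ck (k : nat) V g : Prop :=
  (forall x, V x -> {for x, continuous g}) /\
  match k with
  | 0 => True
  | k'.+1 => forall a : 'I_d,
      (forall x, V x -> derivable g x (delta_mx 0 a)) /\
      Ck k' V (fun x => 'D_(delta_mx 0 a) g x)
  end.

(* U is any subset of R^d: smoothness means having local smooth extensions
   to open sets of R^d.  The values of g outside U play no role. *)
Definition smooth_on U g : Prop :=
  forall x, U x -> exists V h,
    [/\ open V, V x, forall k, Ck k V h & forall y, V y -> U y -> h y = g y].

(* The increments are kept inside the half-space, so that for a function which
   is smooth near x in the half-space this is the partial derivative at x of any
   smooth extension, including when x is on the boundary hyperplane (where it
   is one-sided in the direction 0). *)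
Definition pderiv (a : 'I_d) g (x : 'rV[R]_d) : R :=
  lim ((fun h : R => h^-1 * (g (x + h *: delta_mx 0 a) - g x))
         @ within [set h | halfspace (x + h *: delta_mx 0 a)] 0^').

End Euclidean.

(* A compact smooth d-manifold with boundary, given by a smooth atlas (not
   required to be maximal) of charts chart_map i with values in the half-space.
   chart_inv i matters only on the image of chart i.  Second countability
   follows from compactness. *)
Record domain (R : realType) (d : nat) := Domain {
  carrier :> topologicalType;
  chart : Type;
  chart_dom : chart -> set carrier;
  chart_map : chart -> carrier -> 'rV[R]_d;
  chart_inv : chart -> 'rV[R]_d -> carrier;
  domain_hausdorff : hausdorff_space carrier;
  domain_compact : compact [set: carrier];
  chart_cover : forall p, exists i, chart_dom i p;
  chart_dom_open : forall i, open (chart_dom i);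
  chart_mapK : forall i p, chart_dom i p -> chart_inv i (chart_map i p) = p;
  chart_img_open : forall i, exists2 O : set 'rV[R]_d,
    open O & chart_map i @` chart_dom i = O `&` halfspace;
  chart_map_continuous : forall i, {within chart_dom i, continuous (chart_map i)};
  chart_inv_continuous : forall i,
    {within chart_map i @` chart_dom i, continuous (chart_inv i)};
  chart_smooth : forall i j (a : 'I_d),
    smooth_on (chart_map i @` (chart_dom i `&` chart_dom j))
              (fun x => chart_map j (chart_inv i x) 0 a)
}.

Section Calculus.
Context {R : realType} {d : nat} (F : domain R d).

Definition boundary : set F := [set p | exists (i : chart F) (a : 'I_d),
  [/\ chart_dom i p, a = 0%N :> nat & chart_map i p 0 a = 0]].

Definition Int : set F := ~` boundary.

Definition smooth_in_chart (i : chart F) (A : set F) (g : F -> R) : Prop :=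
  smooth_on (chart_map i @` (chart_dom i `&` A)) (g \o chart_inv i).

Definition smooth_fun (g : F -> R) : Prop :=
  forall i, smooth_in_chart i [set: F] g.

(* The partial derivative at p of g with respect to coordinate a of chart i. *)
Definition partial (i : chart F) (a : 'I_d) (g : F -> R) (p : F) : R :=
  pderiv a (g \o chart_inv i) (chart_map i p).

(* Jacobian of the coordinates of chart j with respect to those of chart i. *)
Definition jacobian (i j : chart F) (p : F) : 'M[R]_d :=
  \matrix_(a, b) partial i a (fun q => chart_map j q 0 b) p.

(* Forms and vector fields are given by their components in each chart: a row
   for a 1-form or a vector field, a d x d matrix for a 2-form, with
   om(v, w) = v *m om *m w^T.  A tensor on A has components 0 at (i, p) unless p
   is in A and in the domain of chart i, so that equality of functions is
   equality of tensors and the tensors on A form a linear subspace. *)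
Definition tensor (m : nat) := chart F -> F -> 'M[R]_(m, d).

(* law J x y relates the components x in chart i and y in chart j, where J is
   jacobian i j.  A is an open subset of F. *)
Definition smooth_tensor m (law : 'M[R]_d -> 'M[R]_(m, d) -> 'M[R]_(m, d) -> Prop)
    (A : set F) (s : tensor m) : Prop :=
  [/\ forall i p, ~ (chart_dom i p /\ A p) -> s i p = 0,
      forall i j p, A p -> chart_dom i p -> chart_dom j p ->
        law (jacobian i j p) (s i p) (s j p)
    & forall i a b, smooth_in_chart i A (fun p => s i p a b)].

Definition smooth_vector_field : set F -> tensor 1 -> Prop :=
  smooth_tensor (fun J x y => y = x *m J).

Definition smooth_form1 : set F -> tensor 1 -> Prop :=
  smooth_tensor (fun J x y => x = y *m J^T).

Definition smooth_form2 (A : set F) (s : tensor d) : Prop :=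
  smooth_tensor (fun J x y => x = J *m y *m J^T) A s /\
  forall i p, (s i p)^T = - s i p.

Definition d0 (g : F -> R) : tensor 1 := fun i p => \row_a partial i a g p.

Definition d1 (s : tensor 1) : tensor d := fun i p => \matrix_(a, b)
  (partial i a (fun q => s i q 0 b) p - partial i b (fun q => s i q 0 a) p).

Definition d2 (s : tensor d) (i : chart F) (p : F) (a b c : 'I_d) : R :=
  partial i a (fun q => s i q b c) p + partial i b (fun q => s i q c a) p
  + partial i c (fun q => s i q a b) p.

Definition closed_form1 (A : set F) (s : tensor 1) : Prop :=
  smooth_form1 A s /\ forall i p, A p -> chart_dom i p -> d1 s i p = 0.

Definition agree_on m (A : set F) (s t : tensor m) : Prop :=
  forall i p, A p -> chart_dom i p -> s i p = t i p.

Definition fscale m (g : F -> R) (s : tensor m) : tensor m :=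
  fun i p => g p *: s i p.

Definition form1_extension (s t : tensor 1) : Prop :=
  smooth_form1 [set: F] t /\ agree_on Int t s.

Definition vector_field_extension (s t : tensor 1) : Prop :=
  smooth_vector_field [set: F] t /\ agree_on Int t s.

(* v belongs to T_p(boundary), in the coordinates of a chart at a boundary
   point p. *)
Definition boundary_tangent (v : 'rV[R]_d) : Prop :=
  forall a : 'I_d, a = 0%N :> nat -> v 0 a = 0.

Definition tangent_to_boundary (X : tensor 1) : Prop :=
  forall i p, chart_dom i p -> boundary p -> boundary_tangent (X i p).

(* The pullback al of s to the boundary is a contact form: al has no zero and
   d(al) is nondegenerate on the hyperplane field ker al. *)
Definition induces_contact_form (s : tensor 1) : Prop :=
  forall i p, chart_dom i p -> boundary p ->
    (exists2 v : 'rV[R]_d, boundary_tangent v & s i p *m v^T != 0) /\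
    (forall v : 'rV[R]_d, boundary_tangent v -> s i p *m v^T = 0 ->
       (forall w : 'rV[R]_d, boundary_tangent w -> s i p *m w^T = 0 ->
          v *m d1 s i p *m w^T = 0) ->
       v = 0).

Definition boundary_defining (u : F -> R) : Prop :=
  [/\ smooth_fun u, forall p, 0 <= u p, forall p, u p = 0 <-> boundary p
    & forall i p, boundary p -> chart_dom i p -> d0 u i p != 0].

Definition symplectic_form (om : tensor d) : Prop :=
  [/\ smooth_form2 Int om,
      forall i p, Int p -> chart_dom i p -> om i p \in unitmx
    & forall i p, Int p -> chart_dom i p -> forall a b c, d2 om i p a b c = 0].

Definition ideal_Liouville_form (om : tensor d) : set (tensor 1) :=
  [set la | [/\ smooth_form1 Int la, agree_on Int (d1 la) om
    & exists2 u, boundary_defining u &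
        exists2 be, form1_extension (fscale u la) be & induces_contact_form be]].

Definition ideal_Liouville_domain (om : tensor d) : Prop :=
  symplectic_form om /\ exists la, ideal_Liouville_form om la.

(* The vector field v on Int with (interior product of v and om) = ka, i.e.
   v *m om i p = ka i p. *)
Definition dual_vector_field (om : tensor d) (ka : tensor 1) : tensor 1 :=
  fun i p => ka i p *m invmx (om i p).

Lemma dual_vector_fieldP om ka : symplectic_form om ->
  agree_on Int (fun i p => dual_vector_field om ka i p *m om i p) ka.
Proof. by case=> _ om_unit _ i p Ip ip; rewrite /= mulmxKV // om_unit. Qed.

Definition form_extends (u : F -> R) (ka : tensor 1) : Prop :=
  exists t, form1_extension (fscale u ka) t.

Definition dual_quotient (om : tensor d) (u : F -> R) (ka : tensor 1) : tensor 1 :=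
  fscale (fun p => (u p)^-1) (dual_vector_field om ka).

Definition dual_extends (om : tensor d) (u : F -> R) (ka : tensor 1) : Prop :=
  exists X, vector_field_extension (dual_quotient om u ka) X.

(* f is locally constant near the boundary.  Some such requirement is needed for
   u *: ka to extend smoothly: d(u log u) = (1 + log u) du is closed on Int, but
   u (1 + log u) du does not extend smoothly. *)
Definition log_extends (u : F -> R) (ka : tensor 1) : Prop :=
  exists f, [/\ smooth_fun f,
    forall p, boundary p -> \forall q \near p, f q = f p
  & exists2 t, closed_form1 [set: F] t &
      forall i p, Int p -> chart_dom i p ->
        ka i p - d0 (fun q => f q * ln (u q)) i p = t i p].

(* A is an affine subspace, with underlying vector space V, of the space of
   1-forms. *)
Definition affine_space_over (V A : set (chart F -> F -> 'rV[R]_d)) : Prop :=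
  [/\ GRing.submod_closed (mem V), exists x, A x
    & forall x y, A x -> (A y <-> V (y - x))].

End Calculus.

(* Main.v *)
From HB Require Import structures.
Require Import Defs.
From mathcomp Require Import all_boot all_order all_algebra.
From mathcomp Require Import all_classical all_reals all_analysis.
From mathcomp Require Import ring lra.

Set Implicit Arguments.
Unset Strict Implicit.
Unset Printing Implicit Defensive.

Import Order.TTheory GRing.Theory Num.Theory numFieldNormedType.Exports.

Local Open Scope classical_set_scope.
Local Open Scope ring_scope.

(** Fix a function u defining the boundary. Two facts carry the proof.

    The first is division: a smooth function that vanishes on the boundary is u
    times a smooth function ([divide_by_u], from Hadamard's lemma
    [smooth_hquot]). In particular two defining functions differ by a nowhere
    zero factor.

    The second concerns a primitive la of om such that u la extends to be. From
    om = d(be/u) one gets u^2 om = u d(be) - du /\ be, an expression that is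
    smooth up to the boundary but degenerate there. Bordering d(be) by du and be
    removes the degeneracy: the matrix [contact_mx] has determinant
    u^(d+2) det om in the interior ([det_contact_mx]), and at a boundary point
    it is invertible exactly when be induces a contact structure
    ([contact_atP]). Up to a power of the ratio of two defining functions, the
    determinant depends on om only. Hence the contact condition holds for every
    primitive of om that extends after multiplication by u, and for every u, as
    soon as it holds for one ([contact_transfer]). The affine structure follows:
    adding to la a closed form ka such that u ka extends gives again an ideal
    Liouville form ([affine_Liouville]).

    Now let ka be closed on the interior and X the extension of its dual vector
    field divided by u, when it exists.

    (ii) => (i): by definition of the dual, u ka is the contraction of X with
    u^2 om, and the latter is smooth.

    (i) => (ii): let et extend u ka. That ka is closed reads
    u d(et) = du /\ et, so that et is a multiple f du of du along the boundary,
    and et = f du + u mu by division. The linear system given by the bordered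
    matrix, with right-hand side (mu, 0, f), has a smooth solution, the first
    component of which contracts u^2 om to et ([solve_dual]): it is X.

    Along the boundary, contracting X with u^2 om = - du /\ be gives
    et = be(X) du - du(X) be. As et is a multiple of du and be is not,
    du(X) = 0: X is tangent to the boundary, and et = g du for the globally
    defined function g = be(X) ([dual_boundary]).

    (i), (ii) => (iii): writing et = g du + u mu, closedness of ka becomes
    dg /\ du + u d(mu) = 0, so that g is locally constant on the boundary
    ([coefficient_locally_constant]). By compactness it takes finitely many
    values there, and composing it with a function of one variable that is
    constant near each of them yields a function f, locally constant near the
    boundary, with the same boundary values ([flatten_near_boundary]). Dividing
    again, et - f du = u mu', and ka - d(f log u) = mu' - log u df, where df
    vanishes near the boundary ([form_extends_log]).

    (iii) => (i): if t is the closed form, u ka = u t + f du + u log u df.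

    Smoothness up to the boundary is handled through local extensions to open
    subsets of the Euclidean space. All identities between tensors are proved in
    the interior, where u is invertible, and reach the boundary by density
    ([eq_by_density]); this includes the compatibility of the components in
    different charts ([extend_tensor]). *)

(** * Functions of class C^k *)

Section Smooth.
Context {R : realType} {d : nat}.
Implicit Types (U V : set 'rV[R]_d) (f g h : 'rV[R]_d -> R) (x y v : 'rV[R]_d).

Definition smooth V g := forall k, Ck k V g.

Lemma line_derivable g x v t : derivable g (x + t *: v) v ->
  is_derive t 1 (fun s => g (x + s *: v)) ('D_v g (x + t *: v)).
Proof.
have E : (fun h : R => h^-1 *: (((fun s => g (x + s *: v)) \o shift t) (h *: 1) - g (x + t *: v)))
    = (fun h : R => h^-1 *: ((g \o shift (x + t *: v)) (h *: v) - g (x + t *: v))).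
  apply/funext => h /=; do 3 f_equal.
  by rewrite [h *: (1 : R)]mulr1 scalerDl addrCA.
by move=> dg; apply: DeriveDef; rewrite ?/derivable ?/derive E.
Qed.

Lemma continuous_near_eq (T : topologicalType) (g h : T -> R) (x : T) :
  (\forall y \near x, g y = h y) -> {for x, continuous g} -> {for x, continuous h}.
Proof.
move=> gh cg; rewrite /prop_for /continuous_at -(nbhs_singleton gh).
apply: cvg_trans cg; apply: near_eq_cvg.
by near=> y; rewrite (near gh y).
Unshelve. all: by end_near. Qed.

Lemma Ck_ext k V g h : open V -> (forall x, V x -> g x = h x) -> Ck k V g -> Ck k V h.
Proof.
move=> oV; elim: k g h => [|k IH] g h gh /= [cg dg].
all: have nV x : V x -> \forall y \near x, g y = h y
  by move=> Vx; near=> y; apply: gh; near: y; exact: open_nbhs_nbhs.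
all: split; first by move=> x Vx; exact: continuous_near_eq (nV x Vx) (cg x Vx).
  by [].
move=> a; have [dag Cg] := dg a; split.
  by move=> x Vx; apply: near_eq_derivable (nV x Vx) (dag x Vx).
by apply: IH Cg => x Vx; apply: near_eq_derive; exact: nV.
Unshelve. all: by end_near. Qed.

Lemma Ck_sub k U V g : U `<=` V -> Ck k V g -> Ck k U g.
Proof.
move=> UV; elim: k g => [|k IH] g /= [cg dg]; split; try by move=> x /UV; exact: cg.
  by [].
by move=> a; have [dag Cg] := dg a; split; [move=> x /UV; exact: dag|exact: IH].
Qed.

Lemma Ck_pred k V g : Ck k.+1 V g -> Ck k V g.
Proof.
elim: k g => [|k IH] g [cg dg]; split=> // a; have [dag Cg] := dg a; split=> //.
exact: IH.
Qed.

Lemma Ck_cst k V (c : R) : Ck k V (cst c).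
Proof.
elim: k c => [|k IH] c; split=> //; try by move=> x _; exact: cst_continuous.
move=> a; split=> [x _|]; first exact: derivable_cst.
have -> : (fun x => 'D_(delta_mx 0 a) (cst c) x) = cst 0 :> ('rV[R]_d -> R).
  by apply/funext => x; rewrite derive_cst.
exact: IH.
Qed.

Lemma Ck_add k V f g : open V -> Ck k V f -> Ck k V g -> Ck k V (fun x => f x + g x).
Proof.
move=> oV; elim: k f g => [|k IH] f g /= [cf df] [cg dg].
all: split; try by move=> x Vx; apply: continuousD; [exact: cf|exact: cg].
  by [].
move=> a; have [daf Cf] := df a; have [dag Cg] := dg a; split.
  by move=> x Vx; apply: derivableD; [exact: daf|exact: dag].
apply: Ck_ext (IH _ _ Cf Cg) => // x Vx.
by rewrite deriveD //; [exact: daf|exact: dag].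
Qed.

Lemma Ck_mul k V f g : open V -> Ck k V f -> Ck k V g -> Ck k V (fun x => f x * g x).
Proof.
move=> oV; elim: k f g => [|k IH] f g Hf Hg; have [/= cf df] := Hf; have [/= cg dg] := Hg.
all: split; try by move=> x Vx; apply: continuousM; [exact: cf|exact: cg].
  by [].
move=> a; have [daf Cf] := df a; have [dag Cg] := dg a; split.
  by move=> x Vx; apply: derivableM; [exact: daf|exact: dag].
apply: Ck_ext (Ck_add oV (IH _ _ (Ck_pred Hf) Cg) (IH _ _ (Ck_pred Hg) Cf)) => // x Vx.
by rewrite deriveM //; [exact: daf|exact: dag].
Qed.

(** Smoothness by coinduction: a family of functions that is stable under partial
    derivatives consists of smooth functions. Quotients are treated in this way,
    as their higher derivatives have no simple closed form. *)
Lemma Ck_coind V (P : ('rV[R]_d -> R) -> Prop) : open V ->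
  (forall g, P g -> (forall x, V x -> {for x, continuous g}) /\
    forall a : 'I_d, (forall x, V x -> derivable g x (delta_mx 0 a)) /\
      exists2 g', P g' & forall x, V x -> 'D_(delta_mx 0 a) g x = g' x) ->
  forall g, P g -> smooth V g.
Proof.
move=> oV H g Pg k; elim: k g Pg => [|k IH] g /H[cg dg]; split=> // a.
have [dag [g' Pg' E]] := dg a; split=> //.
by apply: Ck_ext (IH _ Pg') => // x Vx; rewrite E.
Qed.

Lemma smooth_cont V g : smooth V g -> forall x, V x -> {for x, continuous g}.
Proof. by move=> /(_ 0%N)[]. Qed.

Lemma smooth_derivable V g a : smooth V g -> forall x, V x -> derivable g x (delta_mx 0 a).
Proof. by move=> /(_ 1%N)[_ /(_ a)[]]. Qed.

Lemma smooth_D V g (a : 'I_d) : smooth V g -> smooth V (fun x => 'D_(delta_mx 0 a) g x).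
Proof. by move=> H k; have [_ /(_ a)[]] := H k.+1. Qed.

Lemma derive_coord (x : 'rV[R]_d) (a b : 'I_d) :
  is_derive x (delta_mx 0 a : 'rV[R]_d) (fun x => x 0 b) ((a == b)%:R).
Proof.
have df := differentiable_coord x 0 b.
apply: DeriveDef; first exact: diff_derivable.
apply: cvg_lim => //.
apply: (@cvg_near_cst _ _ _ _ (dnbhs 0)); near=> h => /=.
rewrite !mxE addrK [LHS]mulrA mulVf ?mul1r //= ?[b == a]eq_sym //.
by near: h; exact: nbhs_dnbhs_neq.
Unshelve. all: by end_near. Qed.

Lemma smooth_coord V (b : 'I_d) : open V -> smooth V (fun x => x 0 b).
Proof.
move=> oV [|k]; split=> //; try by move=> x _; exact: coord_continuous.
move=> a; split=> [y _|]; first by have [] := derive_coord y a b.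
apply: (Ck_ext oV _ (Ck_cst k V ((a == b)%:R))) => y _.
by have [_ ->] := derive_coord y a b.
Qed.

Lemma is_derive_comp1 g x v (s : R -> R) (c : R) : derivable g x v ->
  is_derive (g x) 1 s c -> is_derive x v (fun x => s (g x)) (c * 'D_v g x).
Proof.
move=> dg ds; have E0 : x = x + 0 *: v by rewrite scale0r addr0.
have dl : is_derive (0:R) 1 (fun t => g (x + t *: v)) ('D_v g x).
  by rewrite [X in 'D__ g X]E0; apply: line_derivable; rewrite -E0.
have ds' : is_derive (g (x + 0 *: v)) 1 s c by rewrite -E0.
have [d1 d2] := @is_derive1_comp _ s (fun t => g (x + t *: v)) 0 _ _ ds' dl.
have EE : (fun h : R => h^-1 *: (((fun x => s (g x)) \o shift x) (h *: v) - s (g x)))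
  = (fun h : R => h^-1 *: (((s \o (fun t => g (x + t *: v))) \o shift 0) (h *: (1:R))
       - (s \o (fun t => g (x + t *: v))) 0)).
  apply/funext => h /=; rewrite -E0 addr0 [h *: (1:R)]mulr1; do 3 f_equal.
  by rewrite addrC.
by apply: DeriveDef; rewrite ?/derivable ?/derive EE.
Qed.

(** S is a set of functions of one variable that is stable under differentiation
    on D, so that the derivatives of s o g are sums of products of functions of
    the form s' o g with derivatives of g. *)
Lemma Ck_comp1 (D : set R) (S : (R -> R) -> Prop) k V g (s : R -> R) : open V ->
  (forall s, S s -> exists2 s', S s' & forall t, D t -> is_derive t 1 s (s' t)) ->
  S s -> (forall x, V x -> D (g x)) -> Ck k V g -> Ck k V (fun x => s (g x)).
Proof.
move=> oV HS + gD; elim: k s => [|k IH] s Ss Hg; have [/= cg dg] := Hg;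
  have [s' Ss' ds] := HS _ Ss.
all: have cs x : V x -> {for x, continuous (fun x => s (g x))}.
1,3: move=> Vx; apply: (@continuous_comp _ _ _ g s); first exact: cg.
1,2: by apply/differentiable_continuous/derivable1_diffP; have [] := ds _ (gD _ Vx).
all: split=> // a.
have [dag Cg] := dg a.
have Dsg x : V x -> is_derive x (delta_mx 0 a) (fun x => s (g x))
    (s' (g x) * 'D_(delta_mx 0 a) g x).
  by move=> Vx; apply: is_derive_comp1; [exact: dag|apply: ds; exact: gD].
split=> [x Vx|]; first by have [] := Dsg _ Vx.
apply: (Ck_ext oV _ (Ck_mul oV (IH _ Ss' (Ck_pred Hg)) Cg)) => x Vx.
by have [_ ->] := Dsg _ Vx.
Qed.

End Smooth.

(** * Mean values and symmetry of second derivatives *)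

Section MVT.
Context {R : realType} {d : nat}.
Implicit Types (U V : set 'rV[R]_d) (f g : 'rV[R]_d -> R) (x y v : 'rV[R]_d).

Lemma mean_value_pos (phi dphi : R -> R) (s : R) : 0 < s ->
  (forall t, 0 <= t <= s -> is_derive t 1 phi (dphi t)) ->
  exists2 c, 0 < c < s & phi s - phi 0 = dphi c * s.
Proof.
move=> s0 H.
have [||c] := @MVT R phi dphi 0 s s0.
- by move=> t /itvP ts; apply: H; rewrite !ltW // ts.
- apply: derivable_within_continuous => t /itvP ts.
  by have [] := H t; rewrite ?ts.
- by move=> c0 E; exists c; [rewrite !(itvP c0)|rewrite E subr0].
Qed.

(** Stated with absolute values, because s may be negative. *)
Lemma mean_value_line g x v (s : R) :
  (forall t, `|t| <= `|s| -> derivable g (x + t *: v) v) ->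
  exists2 c, `|c| <= `|s| & g (x + s *: v) - g x = s * 'D_v g (x + c *: v).
Proof.
have [->|s0] := eqVneq s 0.
  by move=> _; exists 0 => //; rewrite scale0r addr0 subrr mul0r.
move=> H; pose sg := Num.sg s.
have sg0 : `|sg| = 1 by rewrite normr_sg s0.
have [|t|c /andP[c0 cs] E] := @mean_value_pos (fun t => g (x + t *: (sg *: v)))
    (fun t => sg * 'D_v g (x + (t * sg) *: v)) `|s|.
- by rewrite normr_gt0.
- move=> /andP[t0 ts]; have dg : derivable g (x + (t * sg) *: v) v.
    by apply: H; rewrite normrM sg0 mulr1 ger0_norm.
  have D1 := line_derivable dg.
  have D2 : is_derive t 1 (fun t : R => t * sg) sg.
    have := @is_deriveM R R id (cst sg) t 1 1 0 (is_derive_id _ _) (is_derive_cst _ _ _).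
    by rewrite scaler0 add0r [_ *: _]mulr1.
  have := @is_derive1_comp _ (fun t => g (x + t *: v)) (fun t => t * sg) t _ _ D1 D2.
  rewrite mulrC; congr (is_derive _ _ _ _).
  by apply/funext => u /=; rewrite scalerA.
- exists (c * sg); first by rewrite normrM sg0 mulr1 gtr0_norm // ltW.
  move: E; rewrite scale0r addr0 scalerA [`|s| * _]mulrC -numEsg => ->.
  by rewrite mulrAC -numEsg.
Qed.

Lemma nbhs_parallelogram (W : set 'rV[R]_d) x v w : nbhs x W ->
  exists2 s : R, 0 < s & forall p q : R, `|p| <= s -> `|q| <= s -> W (x + p *: v + q *: w).
Proof.
move=> /nbhs_ballP[e /= e0 eW].
exists (e / (2 * (1 + `|v| + `|w|))).
  by rewrite divr_gt0 ?mulr_gt0 ?ltr_wpDr ?addr_ge0.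
set s := _ / _ => p q ps qs; apply: eW; rewrite -ball_normE /ball_ /=.
rewrite -addrA opprD addNKr normrN.
have Hs : s * (2 * (1 + `|v| + `|w|)) = e.
  by rewrite divfK // mulf_neq0 // gt_eqF // !ltr_wpDr.
have s0 : 0 < s by rewrite divr_gt0 ?mulr_gt0 ?ltr_wpDr ?addr_ge0.
rewrite (le_lt_trans (ler_normD _ _)) // !normrZ.
have h1 := ler_wpM2r (normr_ge0 v) ps.
have h2 := ler_wpM2r (normr_ge0 w) qs.
have h3 := mulr_ge0 (ltW s0) (normr_ge0 v).
have h4 := mulr_ge0 (ltW s0) (normr_ge0 w).
rewrite -Hs; nra.
Qed.

Lemma nbhs_line (W : set 'rV[R]_d) x v : nbhs x W ->
  exists2 s : R, 0 < s & forall p : R, `|p| <= s -> W (x + p *: v).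
Proof.
move=> /(@nbhs_parallelogram _ x v 0)[s s0 H]; exists s => // p ps.
by have := H p 0 ps; rewrite scale0r addr0 normr0; apply; rewrite ltW.
Qed.

(** The mean value theorem in each of the two directions. The left-hand side is
    symmetric in a and b, whence [Schwarz]. *)
Lemma second_difference V g x (a b : 'I_d) (s : R) :
  let va := delta_mx 0 a in let vb := delta_mx 0 b in
  0 < s -> smooth V g ->
  (forall p q : R, `|p| <= s -> `|q| <= s -> V (x + p *: va + q *: vb)) ->
  exists p q : R, [/\ `|p| <= s, `|q| <= s &
    g (x + s *: va + s *: vb) - g (x + s *: va) - g (x + s *: vb) + g x
    = s * s * 'D_vb (fun y => 'D_va g y) (x + p *: va + q *: vb)].
Proof.
move=> va vb s0 sg H.
have [t /andP[t0 ts]|p /andP[p0 ps] Ep] := @mean_value_pos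
   (fun t => g ((x + s *: vb) + t *: va) - g (x + t *: va))
   (fun t => 'D_va g ((x + s *: vb) + t *: va) - 'D_va g (x + t *: va)) s s0.
- have t' : `|t| <= s by rewrite ger0_norm.
  apply: is_deriveB; apply: line_derivable; apply: smooth_derivable sg _ _.
    by rewrite addrAC; apply: H => //; rewrite gtr0_norm.
  by have := H t 0 t'; rewrite scale0r addr0; apply; rewrite normr0 ltW.
have p' : `|p| <= s by rewrite gtr0_norm // ltW.
have [t ts|q qs Eq] := @mean_value_line (fun y => 'D_va g y) (x + p *: va) vb s.
  apply: smooth_derivable (smooth_D _ sg) _ _.
  by apply: H => //; rewrite (le_trans ts) // gtr0_norm.
exists p, q; split=> //; first by rewrite (le_trans qs) // gtr0_norm.
rewrite -mulrA -Eq; move: Ep; rewrite scale0r !addr0.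
rewrite ![x + s *: vb + _]addrAC => E.
by rewrite [RHS]mulrC -E; ring.
Qed.

Lemma Schwarz V g x (a b : 'I_d) : open V -> smooth V g -> V x ->
  'D_(delta_mx 0 b) (fun y => 'D_(delta_mx 0 a) g y) x
  = 'D_(delta_mx 0 a) (fun y => 'D_(delta_mx 0 b) g y) x.
Proof.
set va := delta_mx 0 a; set vb := delta_mx 0 b => oV sg Vx.
set A := (fun y => 'D_vb (fun y => 'D_va g y) y).
set B := (fun y => 'D_va (fun y => 'D_vb g y) y).
have cA : {for x, continuous A}.
  by apply: smooth_cont Vx; exact: smooth_D (smooth_D _ sg).
have cB : {for x, continuous B}.
  by apply: smooth_cont Vx; exact: smooth_D (smooth_D _ sg).
rewrite -/(A x) -/(B x).
apply/eqP; rewrite -subr_eq0 -normr_le0; apply/ler_addgt0Pl => e e0.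
rewrite addr0.
have e2 : 0 < e / 2 by rewrite divr_gt0.
have nA : \forall y \near x, `|A x - A y| < e / 2 by move/cvgrPdist_lt: cA; apply.
have nB : \forall y \near x, `|B x - B y| < e / 2 by move/cvgrPdist_lt: cB; apply.
have nV : \forall y \near x, V y by exact: open_nbhs_nbhs.
have [s s0 H] := nbhs_parallelogram va vb (filterI nV (filterI nA nB)).
have [|p [q [ps qs E1]]] := second_difference s0 sg (_ : forall p q : R, `|p| <= s ->
  `|q| <= s -> V (x + p *: va + q *: vb)).
  by move=> p q ps qs; have [] := H p q ps qs.
have [|p' [q' [ps' qs' E2]]] := second_difference s0 sg (_ : forall p q : R, `|p| <= s ->
  `|q| <= s -> V (x + p *: vb + q *: va)).
  by move=> p' q' ps' qs'; have [] := H q' p' qs' ps'; rewrite addrAC.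
have EE : A (x + p *: va + q *: vb) = B (x + q' *: va + p' *: vb).
  apply: (@mulfI _ (s * s)); first by rewrite mulf_neq0 // gt_eqF.
  rewrite [x + q' *: va + _]addrAC.
  transitivity (g (x + s *: va + s *: vb) - g (x + s *: va) - g (x + s *: vb) + g x).
    by symmetry; exact: E1.
  rewrite [x + s *: va + _]addrAC -[g _ - _ - _]addrA [- g _ - _]addrC addrA; exact: E2.
have [_ [H1 _]] := H p q ps qs.
have [_ [_ H2]] := H q' p' qs' ps'.
clearbody A B; rewrite EE in H1.
move: (B _) (A x) (B x) H1 H2 => w a' b' H1 H2.
rewrite -(subrKA w) (le_trans (ler_normD _ _)) // (distrC w) (splitr e).
by rewrite lerD // ltW.
Qed.

End MVT.

(** * Differentiability and the chain rule *)

Section Chain.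
Context {R : realType} {d : nat}.
Implicit Types (U V : set 'rV[R]_d) (f g : 'rV[R]_d -> R) (x y v : 'rV[R]_d).

Lemma norm_coord v (b : 'I_d) : `|v 0 b| <= `|v|.
Proof. by rewrite [leRHS]/Num.Def.normr /= mx_normrE; exact: (le_bigmax _ _ (0, b)). Qed.

Lemma norm_rV_le v (e : R) : 0 <= e -> (forall b, `|v 0 b| <= e) -> `|v| <= e.
Proof.
move=> e0 H; rewrite [leLHS]/Num.Def.normr /= mx_normrE.
by apply: bigmax_le => // -[i j] _; rewrite ord1.
Qed.

(** The first k coordinates of v, in order to telescope g (x + v) - g x. *)
Definition trunc k v : 'rV[R]_d := \row_(b < d) (if (b < k)%N then v 0 b else 0).

(** Moving along the coordinate axes one after the other, the mean value theorem
    bounds the error by the variation of the partial derivatives near x. *)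
Lemma smooth_differentiable V g x : open V -> smooth V g -> V x -> differentiable g x.
Proof.
move=> oV sg Vx.
pose L v := \sum_(b < d) v 0 b * 'D_(delta_mx 0 b) g x.
have linL : linear L.
  move=> c v w; rewrite /L scaler_sumr -big_split /=; apply: eq_bigr => b _.
  by rewrite !mxE mulrDl -mulrA.
pose mL := GRing.isLinear.Build _ _ _ _ _ linL.
pose lL : {linear 'rV[R]_d -> R} := HB.pack L mL.
have cL : continuous lL.
  apply: continuous_big => [|b _ v]; first exact: add_continuous.
  apply: (@continuousM _ _ (fun v => v 0 b)); first exact: coord_continuous.
  exact: cst_continuous.
have EL : g \o shift x = cst (g x) + lL +o_ (0 : 'rV[R]_d) id.
  apply/eqaddoP => _/posnumP[e].
  pose e' := e%:num / d.+1%:R.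
  have e'0 : 0 < e' by rewrite divr_gt0.
  have nW : \forall y \near x, V y /\ forall b : 'I_d,
      `|'D_(delta_mx 0 b) g x - 'D_(delta_mx 0 b) g y| < e'.
    apply: filterI; first exact: open_nbhs_nbhs.
    apply: (filter_forall (nbhs_filter x)) => b.
    have cb : {for x, continuous (fun y => 'D_(delta_mx 0 b) g y)}.
      exact: smooth_cont (smooth_D b sg) _ Vx.
    by move/cvgrPdist_lt: cb; apply.
  move/nbhs_ballP: nW => [r /= r0 rW].
  apply/nbhs_ballP; exists r => //= v; rewrite -ball_normE /ball_ /= sub0r normrN => vr.
  have W y : (forall b, `|y 0 b| <= `|v|) -> V (x + y) /\ forall b : 'I_d,
      `|'D_(delta_mx 0 b) g x - 'D_(delta_mx 0 b) g (x + y)| < e'.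
    move=> yv; apply: rW; rewrite -ball_normE /ball_ /= opprD addNKr normrN.
    by apply: le_lt_trans vr; exact: norm_rV_le.
  suff : `|g (x + v) - (g x + L v)| <= e%:num * `|v| by rewrite [x + v]addrC.
  have T0 : trunc 0 v = 0 by apply/rowP => b; rewrite !mxE.
  have Td : trunc d v = v by apply/rowP => b; rewrite !mxE ltn_ord.
  have TS (b : 'I_d) : trunc b.+1 v = trunc b v + v 0 b *: delta_mx 0 b.
    apply/rowP => c; rewrite !mxE eqxx /= ltnS leq_eqVlt -val_eqE /=.
    by have [E|] := eqVneq (c : nat) b; rewrite ?E ?ltnn ?mulr1 ?add0r ?mulr0 ?addr0 //;
      congr (v 0 _); exact: val_inj.
  have tele : g (x + v) - g x = \sum_(b < d) (g (x + trunc b.+1 v) - g (x + trunc b v)).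
    rewrite -(big_mkord predT (fun b => g (x + trunc b.+1 v) - g (x + trunc b v))).
    by rewrite telescope_sumr // Td T0 addr0.
  rewrite opprD addrA tele /L -sumrB (le_trans (ler_norm_sum _ _ _)) //.
  have step (b : 'I_d) : `|g (x + trunc b.+1 v) - g (x + trunc b v)
        - v 0 b * 'D_(delta_mx 0 b) g x| <= e' * `|v|.
    have B t : `|t| <= `|v 0 b| -> forall c, `|(trunc b v + t *: delta_mx 0 b) 0 c| <= `|v|.
      move=> tv c; rewrite !mxE eqxx /=; case: ltnP => [cb|bc].
        have -> : (c == b) = false by apply/eqP => E; rewrite E ltnn in cb.
        by rewrite mulr0 addr0 norm_coord.
      rewrite add0r normrM; case: (c == b); rewrite ?normr1 ?mulr1 ?normr0 ?mulr0 //.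
      by rewrite (le_trans tv) // norm_coord.
    have [t tv|t tv E] := @mean_value_line _ _ g (x + trunc b v) (delta_mx 0 b) (v 0 b).
      apply: (smooth_derivable sg); rewrite -addrA; exact: (W _ (B _ tv)).1.
    rewrite TS addrA E -mulrBr normrM mulrC ler_pM //; last exact: norm_coord.
    by rewrite distrC ltW // -addrA (W _ (B _ tv)).2.
  rewrite (le_trans (ler_sum _ (fun b _ => step b))) // sumr_const card_ord.
  rewrite -mulrnAl ler_wpM2r // /e' -mulrnAr -[leRHS]mulr1 ler_wpM2l //.
  by rewrite -(mulr_natl _ d) ler_pdivrMr // mul1r ler_nat.
have Ed := diff_unique cL EL.
by apply/diff_locallyP; rewrite Ed.
Qed.

Lemma derive_sum_coord V g x v : open V -> smooth V g -> V x ->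
  'D_v g x = \sum_(b < d) v 0 b * 'D_(delta_mx 0 b) g x.
Proof.
move=> oV sg Vx; have dg := smooth_differentiable oV sg Vx.
rewrite deriveE // [in LHS](row_sum_delta v) linear_sum; apply: eq_bigr => b _.
by rewrite linearZ deriveE.
Qed.

Lemma chain_rule (n : nat) V g (phi : 'rV[R]_n -> 'rV[R]_d) (z : 'rV[R]_n) (a : 'I_n) :
  open V -> smooth V g -> V (phi z) ->
  (forall b, derivable (fun y : 'rV[R]_n => phi y 0 b) z (delta_mx 0 a)) ->
  is_derive z (delta_mx 0 a) (fun y : 'rV[R]_n => g (phi y))
    (\sum_(b < d) 'D_(delta_mx 0 a) (fun y : 'rV[R]_n => phi y 0 b) z
      * 'D_(delta_mx 0 b) g (phi z)).
Proof.
move=> oV sg Vz dphi; set e := delta_mx 0 a in dphi *.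
pose c (t : R) := phi (z + t *: e).
have z0 : z = z + 0 *: e by rewrite scale0r addr0.
have dc b : is_derive (0 : R) 1 (fun t => c t 0 b) ('D_e (fun y : 'rV[R]_n => phi y 0 b) z).
  rewrite [X in 'D__ _ X]z0.
  apply: (@line_derivable _ _ (fun y : 'rV[R]_n => phi y 0 b)); rewrite -z0; exact: dphi.
have Dc : derivable c 0 1.
  by apply/derivable_mxP => i b; rewrite ord1; have [] := dc b.
have dfc : differentiable c 0 by apply/derivable1_diffP.
have c0 : c 0 = phi z by rewrite /c -z0.
have dg : differentiable g (c 0) by rewrite c0; exact: smooth_differentiable Vz.
have dgc : differentiable (g \o c) 0 by exact: differentiable_comp.
have dgc' : derivable (g \o c) 0 1 by apply/derivable1_diffP.
have EE : (fun h : R => h^-1 *: (((fun y : 'rV[R]_n => g (phi y)) \o shift z) (h *: e) - g (phi z)))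
    = (fun h : R => h^-1 *: (((g \o c) \o shift 0) (h *: (1 : R)) - (g \o c) 0)).
  apply/funext => h /=; rewrite /c -z0 addr0 [h *: (1 : R)]mulr1.
  by rewrite [z + _]addrC.
apply: DeriveDef; first by rewrite /derivable EE.
rewrite /derive EE -/(derive (g \o c) 0 1).
rewrite deriveE //.
rewrite diff_comp //= -(deriveE _ dfc) -(deriveE _ dg) c0.
rewrite (derive_sum_coord _ oV sg Vz); apply: eq_bigr => b _.
by rewrite derive_mx // mxE; have [_ ->] := dc b.
Qed.

End Chain.

(** * Division by powers of a coordinate *)

Section Hadamard.
Context {R : realType} {d : nat}.
Implicit Types (U V : set 'rV[R]_d) (f g : 'rV[R]_d -> R) (x y z v : 'rV[R]_d).

Lemma smooth_add V f g : open V -> smooth V f -> smooth V g -> smooth V (fun x => f x + g x).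
Proof. by move=> oV sf sg k; exact: Ck_add. Qed.

Lemma smooth_mul V f g : open V -> smooth V f -> smooth V g -> smooth V (fun x => f x * g x).
Proof. by move=> oV sf sg k; exact: Ck_mul. Qed.

Lemma smooth_cst V (c : R) : smooth V (cst c).
Proof. by move=> k; exact: Ck_cst. Qed.

Lemma cont_near_lt (T : topologicalType) (g : T -> R) (x : T) (e : R) :
  {for x, continuous g} -> 0 < e -> \forall y \near x, `|g x - g y| < e.
Proof. by move=> /cvgrPdist_lt; apply. Qed.

Lemma near_lt_cont (T : topologicalType) (g : T -> R) (x : T) :
  (forall e, 0 < e -> \forall y \near x, `|g x - g y| < e) -> {for x, continuous g}.
Proof. by move=> H; apply/cvgrPdist_lt. Qed.

Lemma derivable_scale_line g x v (s t : R) :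
  derivable g (x + (s * t) *: v) v ->
  is_derive t 1 (fun t : R => g (x + (s * t) *: v)) (s * 'D_v g (x + (s * t) *: v)).
Proof.
move=> dg; have D1 := line_derivable dg.
have D2 : is_derive t 1 (fun t : R => s * t) s.
  have := @is_deriveM R R (cst s) id t 1 0 1 (is_derive_cst _ _ _) (is_derive_id _ _).
  by rewrite scaler0 addr0 [_ *: _]mulr1.
by have := @is_derive1_comp _ (fun t => g (x + t *: v)) (fun t => s * t) t _ _ D1 D2; rewrite mulrC.
Qed.

(** By the mean value theorem, the difference quotients of g at y are values of g'
    at points close to y. *)
Lemma is_derive_limit g g' y v :
  (\forall t \near (0 : R), t != 0 -> is_derive (y + t *: v) v g (g' (y + t *: v))) ->
  {for y, continuous g} -> {for y, continuous g'} -> is_derive y v g (g' y).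
Proof.
move=> Dg cg cg'.
suff H : (fun h : R => h^-1 *: ((g \o shift y) (h *: v) - g y)) @ 0^' --> g' y.
  by apply: DeriveDef; [apply/cvg_ex; exists (g' y)|apply: cvg_lim].
apply/cvgrPdist_le => e e0.
move/cvgrPdist_le: cg' => /(_ e e0) ng'.
have [s s0 Hs] := nbhs_line v ng'.
move/nbhs_ballP: Dg => [r /= r0 Hr].
apply/nbhs_ballP; exists (Num.min r s) => /=; first by rewrite lt_min r0.
move=> h; rewrite /ball /= sub0r normrN lt_min => /andP[hr hs] h0.
have [c cs E] : exists2 c : R, `|c| <= `|h| &
    (h^-1 *: ((g \o shift y) (h *: v) - g y)) = g' (y + c *: v).
  pose phi (t : R) := g (y + (h * t) *: v).
  have dphi (t : R) : 0 < t -> t <= 1 -> is_derive t 1 phi (h * g' (y + (h * t) *: v)).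
    move=> t0 t1.
    have D : is_derive (y + (h * t) *: v) v g (g' (y + (h * t) *: v)).
      apply: Hr; last by rewrite mulf_neq0 // gt_eqF.
      rewrite /ball /= sub0r normrN normrM (gtr0_norm t0) (le_lt_trans _ hr) //.
      by rewrite ler_piMr.
    case: D => D1 <-; exact: derivable_scale_line.
  have c0 : {for 0, continuous phi}.
    apply: (@continuous_comp _ _ _ (fun t : R => y + (h * t) *: v) g).
      apply: continuousD; first exact: cst_continuous.
      rewrite (_ : (fun t : R => _) = (fun t : R => t *: (h *: v))).
        exact: scalel_continuous.
      by apply/funext => t; rewrite scalerA mulrC.
    by rewrite mulr0 scale0r addr0.
  have [||c] := @MVT R phi (fun t => h * g' (y + (h * t) *: v)) 0 1 ltr01.
  - by move=> t /itvP t01; apply: dphi; rewrite ?t01 // ltW // t01.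
  - apply: continuous_in_subspaceT => t; rewrite inE /= => /itvP t01.
    have [->//|t0] := eqVneq t 0.
    apply/differentiable_continuous/derivable1_diffP.
    by have [] := dphi t; rewrite ?lt_def ?t0 ?t01.
  - move=> /itvP c01 E; exists (h * c).
      by rewrite normrM ler_piMr // ger0_norm ?c01 // ltW ?c01.
    move: E; rewrite /phi /= mulr1 mulr0 scale0r addr0 subr0 mulr1.
    by rewrite [h *: v + y]addrC => ->; rewrite [_ *: _]mulKf.
rewrite E; apply: Hs; exact: le_trans cs (ltW hs).
Qed.

Variables (a0 : 'I_d) (V : set 'rV[R]_d).
Local Notation e0 := (delta_mx 0 a0 : 'rV[R]_d).
Local Notation D0 := (fun (g : 'rV[R]_d -> R) (x : 'rV[R]_d) => 'D_e0 g x).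
Local Notation D0n j := (iter j D0).

(** The coordinate a0 of y is replaced by s. *)
Definition setx0 y (s : R) : 'rV[R]_d := y + (s - y 0 a0) *: e0.

Lemma setx0_id y : setx0 y (y 0 a0) = y.
Proof. by rewrite /setx0 subrr scale0r addr0. Qed.

Lemma setx0_0 y s : setx0 y s 0 a0 = s.
Proof. by rewrite !mxE !eqxx mulr1 addrC subrK. Qed.

Lemma ball_setx0 y z r s : ball y r z -> y 0 a0 = 0 -> `|s| <= `|z 0 a0| -> ball y r (setx0 z s).
Proof.
move=> yz y0 sz; have [r0 H] : 0 < r /\ forall b, `|y 0 b - z 0 b| < r.
  have yz' : `|y - z| < r by move: yz; rewrite -ball_normE.
  split; first exact: le_lt_trans yz'.
  by move=> b; apply: le_lt_trans yz'; have := norm_coord (y - z) b; rewrite !mxE.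
rewrite -ball_normE /ball_ /=; have {}yz : `|y - z| < r by move: yz; rewrite -ball_normE.
apply: le_lt_trans yz; apply: norm_rV_le => // b.
have := norm_coord (y - z) b.
rewrite /setx0 !mxE; have [->|b0] := eqVneq b a0; last by rewrite andbF mulr0 addr0.
rewrite eqxx mulr1 addrCA subrr addr0 y0 !sub0r !normrN; exact: le_trans.
Qed.

Hypothesis oV : open V.
Hypothesis cylV : forall y s, V y -> `|s| <= `|y 0 a0| -> V (setx0 y s).

(** Vanishing to order m along the hyperplane where the coordinate a0 is zero. *)
Definition flat m g := smooth V g /\
  forall j y, (j < m)%N -> V y -> y 0 a0 = 0 -> D0n j g y = 0.

(** The quotient of g by the m-th power of the coordinate a0. The value on the
    hyperplane is the Taylor coefficient, so that the quotient is continuous when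
    g is [flat] of order m. *)
Definition hquot m g y : R :=
  if y 0 a0 == 0 then D0n m g y / m`!%:R else g y / y 0 a0 ^+ m.

Lemma smooth_D0n j g : smooth V g -> smooth V (D0n j g).
Proof. by move=> sg; elim: j => //= j; exact: smooth_D. Qed.

Lemma D_ext g g' a : (forall x, V x -> g x = g' x) -> forall x, V x ->
  'D_(delta_mx 0 a) g x = 'D_(delta_mx 0 a) g' x.
Proof.
move=> E x Vx; apply: near_eq_derive; near=> y; apply: E; near: y.
exact: open_nbhs_nbhs.
Unshelve. all: by end_near. Qed.

Lemma D0n_comm j g a x : smooth V g -> V x ->
  D0n j (fun y => 'D_(delta_mx 0 a) g y) x = 'D_(delta_mx 0 a) (D0n j g) x.
Proof.
move=> sg; elim: j x => //= j IH x Vx.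
apply: (etrans (@D_ext _ _ a0 IH x Vx)).
exact: (Schwarz a a0 oV (smooth_D0n j sg) Vx).
Qed.

Lemma flat_D0 m g : flat m.+1 g -> flat m (D0 g).
Proof.
move=> [sg H]; split; first exact: smooth_D.
by move=> j y jm Vy y0; rewrite -iterSr; exact: H.
Qed.

Lemma derive_along0 g y a : a != a0 -> V y -> y 0 a0 = 0 ->
  (forall z, V z -> z 0 a0 = 0 -> g z = 0) -> 'D_(delta_mx 0 a) g y = 0.
Proof.
move=> aa0 Vy y0 H; apply: cvg_lim => //.
apply: (@cvg_near_cst _ _ _ _ (dnbhs 0)).
have nV : \forall t \near (0:R), V (t *: delta_mx 0 a + y).
  have [s s0 Hs] := nbhs_line (delta_mx 0 a) (open_nbhs_nbhs (conj oV Vy)).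
  apply/nbhs_ballP; exists s => //= t; rewrite /ball /= sub0r normrN => ts.
  by rewrite addrC; apply: Hs; exact: ltW.
rewrite near_withinE; near=> t => _ /=.
rewrite (H y) // H ?subrr ?scaler0 //; first by near: t.
by rewrite !mxE [a0 == a]eq_sym (negPf aa0) andbF mulr0 add0r.
Unshelve. all: by end_near. Qed.

Lemma flat_D m g a : a != a0 -> flat m g -> flat m (fun y => 'D_(delta_mx 0 a) g y).
Proof.
move=> aa0 [sg H]; split; first exact: smooth_D.
by move=> j y jm Vy y0; rewrite D0n_comm // derive_along0 // => z Vz z0; exact: H.
Qed.

(** The derivative of g / t^m is (t g' - m g) / t^(m+1). *)
Definition euler_op m g y : R := y 0 a0 * D0 g y + (- m%:R) * g y.

Lemma smooth_euler_op m g : smooth V g -> smooth V (euler_op m g).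
Proof.
move=> sg; apply: smooth_add => //; apply: smooth_mul => //.
- exact: smooth_coord.
- exact: smooth_D.
- exact: smooth_cst.
Qed.

Lemma D0n_euler_op m g j y : smooth V g -> V y ->
  D0n j (euler_op m g) y = y 0 a0 * D0n j.+1 g y + (j%:R - m%:R) * D0n j g y.
Proof.
move=> sg; elim: j y => [|j IH] y Vy; first by rewrite sub0r.
rewrite iterS; apply: (etrans (@D_ext _ _ a0 IH y Vy)).
have D1 := derivableP (smooth_derivable (a:=a0) (smooth_D0n j sg) Vy).
have D2 := derivableP (smooth_derivable (a:=a0) (smooth_D0n j.+1 sg) Vy).
have D3 := is_deriveM (derive_coord y a0 a0) D2.
have D4 := is_deriveM (is_derive_cst (j%:R - m%:R : R) y e0) D1.
have D5 := is_deriveD D3 D4; apply: (etrans (@derive_val _ _ _ _ _ _ _ D5)).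
set A := 'D_e0 (D0n j.+1 g) y; set B := D0n j.+1 g y; set C := D0n j g y.
change (y 0 a0 * A + B * (a0 == a0)%:R + ((j%:R - m%:R) * B + C * 0)
  = y 0 a0 * A + (j.+1%:R - m%:R) * B).
clearbody A B C; rewrite eqxx mulr1 -[j.+1%:R]natr1; ring.
Qed.

(** On the hyperplane, the operator multiplies the normal derivative of order j by
    j - m: those with j < m vanish already, and the one with j = m is killed. *)
Lemma flat_euler_op m g : flat m g -> flat m.+1 (euler_op m g).
Proof.
move=> [sg H]; split; first exact: smooth_euler_op.
move=> j y; rewrite ltnS => jm Vy y0; rewrite D0n_euler_op // y0 mul0r add0r.
move: jm; rewrite leq_eqVlt => /predU1P[->|jm]; first by rewrite subrr mul0r.
by rewrite H // mulr0.
Qed.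

(** Cauchy's mean value theorem for g and t^(m+1), between the hyperplane and z.
    It makes the continuity of the quotients an induction on m. *)
Lemma hquot_step m g z : flat m.+1 g -> V z -> exists2 s, `|s| <= `|z 0 a0| &
  hquot m.+1 g z = hquot m (D0 g) (setx0 z s) / m.+1%:R.
Proof.
move=> [sg H] Vz; have [z0|z0] := eqVneq (z 0 a0) 0.
  exists 0; first by rewrite normr0.
  rewrite -z0 setx0_id /hquot z0 eqxx -iterSr factS natrM invfM mulrA.
  by rewrite mulrAC.
set s := z 0 a0; set w := setx0 z 0.
have Ew t : w + t *: e0 = setx0 z t.
  by rewrite /w /setx0 -addrA -scalerDl; congr (_ + _ *: _); ring.
have Vw t : `|t| <= `|s| -> V (w + t *: e0) by move=> ts; rewrite Ew; apply: cylV.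
(* Rolle's theorem applies to psi, which vanishes at 0 (w is on the hyperplane) and at 1. *)
pose psi (t : R) := g (w + (s * t) *: e0) - g z * t ^+ m.+1.
have [t /andP[t0 t1]|c /andP[c0 c1] E] := @mean_value_pos R psi
   (fun t => s * D0 g (w + (s * t) *: e0) - g z * (m.+1%:R * t ^+ m)) 1 ltr01.
  apply: is_deriveB.
    apply: derivable_scale_line; apply: smooth_derivable sg _ _.
    by apply: Vw; rewrite normrM ler_piMr // ger0_norm.
  have D1 : is_derive t 1 (fun t : R => t ^+ m.+1) (m.+1%:R * t ^+ m).
    apply: DeriveDef; first exact: exprn_derivable.
    by rewrite exp_derive [_ *: (1 : R)]mulr1.
  have D2 := is_deriveM (is_derive_cst (g z) t (1 : R)) D1.
  by apply: is_derive_eq D2 _; rewrite scaler0 addr0.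
have w0 : g w = 0.
  by apply: (H 0%N w) => //; [rewrite -[w]addr0 -(scale0r e0); apply: Vw;
    rewrite normr0|rewrite setx0_0].
have p1 : psi 1 = 0 by rewrite /psi mulr1 expr1n mulr1 Ew setx0_id subrr.
have p0 : psi 0 = 0 by rewrite /psi mulr0 scale0r addr0 w0 expr0n mulr0 subrr.
move: E; rewrite p1 p0 subrr mulr1 => /esym/eqP; rewrite subr_eq0 => /eqP E.
exists (s * c); first by rewrite normrM ler_piMr // gtr0_norm // ltW.
have s0 : s * c != 0 by rewrite mulf_neq0 // gt_eqF.
rewrite /hquot setx0_0 (negPf z0) (negPf s0) -/s -Ew.
have cm : c ^+ m != 0 by rewrite expf_neq0 // gt_eqF.
have sm : s ^+ m != 0 by rewrite expf_neq0.
have m0 : m.+1%:R != 0 :> R by rewrite pnatr_eq0.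
rewrite exprMn exprS; move: E z0; rewrite -/s.
move: (D0 g _) (g z) (s ^+ m) (c ^+ m) (m.+1%:R : R) cm sm m0 => D G sm cm m1 cm0 sm0 m0 E z0.
have -> : D = G * (m1 * cm) / s by rewrite -E mulrC mulKf.
by field; rewrite sm0 cm0 m0 z0.
Qed.

Lemma near_coord_neq0 y : y 0 a0 != 0 -> \forall z \near y, (z : 'rV[R]_d) 0 a0 != 0.
Proof.
move=> y0; have cc : {for y, continuous (fun z : 'rV[R]_d => z 0 a0)}.
  exact: coord_continuous.
have yp : 0 < `|y 0 a0| by rewrite normr_gt0.
apply: filterS (cont_near_lt cc yp) => z.
by apply: contraTneq => ->; rewrite subr0 ltxx.
Qed.

Lemma hquot_cont m g y : flat m g -> V y -> {for y, continuous (hquot m g)}.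
Proof.
elim: m g => [|m IH] g fg Vy.
  have -> : hquot 0 g = g.
    by apply/funext => z; rewrite /hquot; case: ifP => _; rewrite ?fact0 ?expr0 divr1.
  exact: smooth_cont fg.1 _ Vy.
have [y0|y0] := eqVneq (y 0 a0) 0.
  have cq := IH _ (flat_D0 fg) Vy.
  have Ey : hquot m.+1 g y = hquot m (D0 g) y / m.+1%:R.
    have [s] := hquot_step fg Vy; rewrite y0 normr0 normr_le0 => /eqP -> ->.
    by rewrite -y0 setx0_id.
  apply: near_lt_cont => e egt0.
  have nq := cont_near_lt cq egt0.
  have nV : \forall z \near y, V z by exact: open_nbhs_nbhs.
  have nVq : \forall z \near y, V z /\ `|hquot m (D0 g) y - hquot m (D0 g) z| < e.
    exact: filterI.
  move/nbhs_ballP: nVq => [r /= rgt0 Hr].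
  apply: filterS (nbhsx_ballx y r rgt0) => z /[dup] /Hr[Vz _] yz.
  have [s sz ->] := hquot_step fg Vz.
  have [_] := Hr _ (ball_setx0 yz y0 sz).
  rewrite Ey -mulrBl normrM; apply: le_lt_trans.
  rewrite ler_piMr // ger0_norm ?invr_ge0 // invf_le1 ?ler1n ?ltr0n //.
have nq : \forall z \near y, g z * ((z : 'rV[R]_d) 0 a0 ^+ m.+1)^-1 = hquot m.+1 g z.
  by apply: filterS (near_coord_neq0 y0) => z z0; rewrite /hquot (negPf z0).
apply: continuous_near_eq nq _.
apply: continuousM; first exact: smooth_cont fg.1 _ Vy.
apply: continuousV; first by rewrite expf_neq0.
apply: (@continuous_comp _ _ _ (fun z : 'rV[R]_d => z 0 a0) (fun t : R => t ^+ m.+1)).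
  exact: coord_continuous.
exact: exprn_continuous.
Qed.

Lemma hquot_derive_off m g y a : smooth V g -> V y -> y 0 a0 != 0 ->
  is_derive y (delta_mx 0 a) (hquot m g)
    (hquot (m + (a == a0)) (if a == a0 then euler_op m g else (fun y => 'D_(delta_mx 0 a) g y)) y).
Proof.
move=> sg Vy y0.
have nq : \forall z \near y, g z * ((z : 'rV[R]_d) 0 a0 ^+ m)^-1 = hquot m g z.
  by apply: filterS (near_coord_neq0 y0) => z z0; rewrite /hquot (negPf z0).
apply: near_eq_is_derive nq _.
have D1 := derivableP (smooth_derivable (a:=a) sg Vy).
have D2 := is_deriveX m (derive_coord y a a0).
have ym : ((fun x : 'rV[R]_d => x 0 a0) ^+ m) y != 0 by rewrite exprfctE expf_neq0.
have D3 := DeriveDef (derivableV ym (@ex_derive _ _ _ _ _ _ _ D2))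
  (deriveV ym (@ex_derive _ _ _ _ _ _ _ D2)).
rewrite (@derive_val _ _ _ _ _ _ _ D2) in D3.
have D4 := is_deriveM D1 D3.
have -> : (fun z => g z * (z 0 a0 ^+ m)^-1)
  = g * (fun y => (((fun x : 'rV[R]_d => x 0 a0) ^+ m) y)^-1).
  by apply/funext => z /=; rewrite exprfctE.
apply: is_derive_eq D4 _.
rewrite /hquot (negPf y0) !exprfctE /euler_op.
have [->|_] := eqVneq a a0; last first.
  rewrite /= addn0 !scaler0 add0r; exact: mulrC.
set D := 'D_e0 g y; set t := y 0 a0 in y0 *.
change (g y * (- (t ^+ m) ^- 2 * ((m%:R * t ^+ m.-1) * 1)) + (t ^+ m)^-1 * D
  = (t * D + - m%:R * g y) / t ^+ (m + 1)).
clearbody D t; rewrite addn1; case: (m) => [|k].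
  by rewrite !expr0; field.
have tm : t ^+ k != 0 by rewrite expf_neq0.
rewrite /= !exprS; move: (t ^+ k) tm (k.+1%:R : R) => u u0 w; field.
by rewrite y0 u0.
Qed.

(** On the hyperplane, the quotient is a multiple of the m-th normal derivative of
    g, which gives its tangential derivatives; its normal derivative is the limit
    of those computed off the hyperplane. *)
Lemma hquot_derive m g y a : flat m g -> V y ->
  is_derive y (delta_mx 0 a) (hquot m g)
    (hquot (m + (a == a0)) (if a == a0 then euler_op m g else (fun y => 'D_(delta_mx 0 a) g y)) y).
Proof.
move=> fg Vy; have sg := fg.1.
have [y0|] := eqVneq (y 0 a0) 0; last exact: hquot_derive_off.
have [aa0|aa0] := eqVneq a a0.
  apply: (@is_derive_limit _ (hquot (m + true) (euler_op m g))).
  - have [s s0 Hs] := nbhs_line e0 (open_nbhs_nbhs (conj oV Vy)).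
    apply/nbhs_ballP; exists s => //= t; rewrite /ball /= sub0r normrN => ts tn0.
    have := @hquot_derive_off m g (y + t *: delta_mx 0 a) a sg.
    rewrite aa0 eqxx; apply; first by apply: Hs; exact: ltW.
    by rewrite !mxE !eqxx mulr1 y0 add0r.
  - exact: hquot_cont.
  - by rewrite addn1; apply: hquot_cont => //; exact: flat_euler_op.
rewrite /= addn0.
have D1 := derivableP (smooth_derivable (a:=a) (smooth_D0n m sg) Vy).
have EE : (fun h : R => h^-1 *: ((hquot m g \o shift y) (h *: delta_mx 0 a) - hquot m g y))
   = (fun h : R => h^-1 *: (((m`!%:R^-1 \*o D0n m g) \o shift y) (h *: delta_mx 0 a)
        - (m`!%:R^-1 \*o D0n m g) y)).
  apply/funext => h /=; rewrite /hquot y0 eqxx !mxE [a0 == a]eq_sym (negPf aa0) andbF mulr0 y0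
    addr0 eqxx.
  by congr (_ *: (_ - _)); rewrite mulrC.
have D2 : is_derive y (delta_mx 0 a) (m`!%:R^-1 \*o D0n m g)
    (m`!%:R^-1 * 'D_(delta_mx 0 a) (D0n m g) y).
  have := is_deriveM (is_derive_cst (m`!%:R^-1 : R) y (delta_mx 0 a)) D1.
  by rewrite scaler0 addr0.
case: D2 => D2 D3.
apply: DeriveDef; first by rewrite /derivable EE.
rewrite /derive EE -/(derive _ _ _) D3 /hquot y0 eqxx D0n_comm //.
exact: mulrC.
Qed.

(** Hadamard's lemma. Arbitrary orders m are needed even if one is interested in
    m = 1 only: the family of all the quotients is stable under partial
    derivatives, while differentiating in the direction of a0 raises m. *)
Lemma smooth_hquot m g : flat m g -> smooth V (hquot m g).
Proof.
move=> fg.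
apply: (@Ck_coind _ _ V (fun q => exists m g, flat m g /\ q = hquot m g) oV); last by exists m, g.
move=> _ [{fg}m [{}g [fg ->]]]; split; first by move=> x Vx; exact: hquot_cont.
move=> a; split; first by move=> x Vx; have [] := hquot_derive a fg Vx.
eexists; last by move=> x Vx; have [_ ->] := hquot_derive a fg Vx.
do 2 eexists; split; last reflexivity.
have [_|aa0] := eqVneq a a0; first by rewrite addn1; exact: flat_euler_op.
by rewrite addn0; exact: flat_D.
Qed.

End Hadamard.

(** * Smoothness at a point of the half-space *)

Section Germs.
Context {R : realType} {d : nat}.
Implicit Types (U V : set 'rV[R]_d) (f g h G : 'rV[R]_d -> R) (x y z v : 'rV[R]_d).

(** The pointwise form of [smooth_on], for subsets that are open in the
    half-space. *)
Definition smooth_germ G x := exists V h,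
  [/\ open V, V x, smooth V h & forall y, V y -> halfspace y -> h y = G y].

Lemma smooth_sub U V g : U `<=` V -> smooth V g -> smooth U g.
Proof. by move=> UV sg k; apply: Ck_sub (sg k). Qed.

Lemma near_open (T : topologicalType) (x : T) (P : T -> Prop) :
  (\forall y \near x, P y) -> exists W, [/\ open W, W x & forall p, W p -> P p].
Proof.
move=> H; have : nbhs x P by exact: H.
by rewrite nbhsE => -[W [oW Wx] WP]; exists W.
Qed.

Lemma germ_ext G G' x : (\forall y \near x, halfspace y -> G y = G' y) ->
  smooth_germ G x -> smooth_germ G' x.
Proof.
move=> E [V [h [oV Vx sh H]]].
have nW : \forall y \near x, V y /\ (halfspace y -> G y = G' y).
  by apply: filterI => //; exact: open_nbhs_nbhs.
have [W [oW Wx WW]] := near_open nW.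
exists W, h; split=> //.
- by apply: smooth_sub sh => y /WW[].
- by move=> y /WW[Vy Ey] hy; rewrite H // Ey.
Qed.

Lemma germ_cst (c : R) x : smooth_germ (cst c) x.
Proof. by exists setT, (cst c); split=> //; [exact: openT|exact: smooth_cst]. Qed.

Lemma germ_coord (b : 'I_d) x : smooth_germ (fun x => x 0 b) x.
Proof.
by exists setT, (fun x => x 0 b); split=> //; [exact: openT|apply: smooth_coord; exact: openT].
Qed.

Lemma germ_op (op : R -> R -> R) G G' x :
  (forall V f g, open V -> smooth V f -> smooth V g -> smooth V (fun x => op (f x) (g x))) ->
  smooth_germ G x -> smooth_germ G' x -> smooth_germ (fun x => op (G x) (G' x)) x.
Proof.
move=> H [V [h [oV Vx sh E]]] [V' [h' [oV' Vx' sh' E']]].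
exists (V `&` V'), (fun x => op (h x) (h' x)); split=> //; first exact: openI.
- apply: H; first exact: openI.
    by apply: smooth_sub sh => y [].
  by apply: smooth_sub sh' => y [].
- by move=> y [Vy V'y] hy; rewrite E // E'.
Qed.

Lemma germ_add G G' x : smooth_germ G x -> smooth_germ G' x -> smooth_germ (fun x => G x + G' x) x.
Proof. by apply: (germ_op (op := +%R)) => V f g; exact: smooth_add. Qed.

Lemma germ_mul G G' x : smooth_germ G x -> smooth_germ G' x -> smooth_germ (fun x => G x * G' x) x.
Proof. by apply: (germ_op (op := *%R)) => V f g; exact: smooth_mul. Qed.

(** The extension of G is restricted to a neighbourhood on which its values are
    in D. *)
Lemma germ_comp1 (D : set R) (S : (R -> R) -> Prop) G x (s : R -> R) : open D ->
  (forall s, S s -> exists2 s', S s' & forall t, D t -> is_derive t 1 s (s' t)) ->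
  S s -> halfspace x -> D (G x) -> smooth_germ G x -> smooth_germ (fun x => s (G x)) x.
Proof.
move=> oD HS Ss hx Dx [V [h [oV Vx sh E]]].
have nW : \forall y \near x, V y /\ D (h y).
  apply: filterI; first exact: open_nbhs_nbhs.
  have ch := smooth_cont sh Vx.
  by apply: ch; apply: open_nbhs_nbhs; split=> //; rewrite E.
have [W [oW Wx WW]] := near_open nW.
exists W, (fun x => s (h x)); split=> //; last by move=> y /WW[Vy _] hy; rewrite E.
move=> k; apply: (Ck_comp1 oW HS Ss); first by move=> y /WW[].
by apply: Ck_sub (sh k) => y /WW[].
Qed.

Lemma halfspace_add x t (a : 'I_d) : halfspace x -> 0 <= t -> halfspace (x + t *: delta_mx 0 a).
Proof.
by move=> hx t0 b b0; rewrite !mxE addr_ge0 ?hx // mulr_ge0 // ler0n.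
Qed.

Let increments (a : 'I_d) x := within [set t : R | halfspace (x + t *: delta_mx 0 a)] 0^'.

(** Positive increments never leave the half-space. *)
Lemma within_halfspace_proper a x : halfspace x -> ProperFilter (increments a x).
Proof.
move=> hx; rewrite /increments; apply: Build_ProperFilter_ex => [P].
rewrite /within /= => nP.
have : \forall t \near (0 : R)^'+, P t.
  have nP' : \forall t \near (0:R), t != 0 -> halfspace (x + t *: delta_mx 0 a) -> P t.
    by move: nP; rewrite near_withinE.
  rewrite /at_right near_withinE; apply: filterS nP' => t Pt t0.
  by apply: Pt; [rewrite gt_eqF|apply: halfspace_add => //; exact: ltW].
by move=> nP'; have [t Pt] := @filter_ex _ (0 : R)^'+ _ P nP'; exists t.
Qed.

(** The increments allowed in [pderiv] see the half-space only, where g and G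
    agree; there are enough of them to determine the limit. *)
Lemma pderiv_derivable V g G x (a : 'I_d) : open V -> V x ->
  derivable g x (delta_mx 0 a) -> halfspace x ->
  (forall y, V y -> halfspace y -> g y = G y) -> pderiv a G x = 'D_(delta_mx 0 a) g x.
Proof.
move=> oV Vx dg hx E; rewrite /pderiv -/(increments a x).
have PF := within_halfspace_proper a hx.
apply: cvg_lim => //.
have C : (fun t : R => t^-1 *: ((g \o shift x) (t *: delta_mx 0 a) - g x)) @ increments a x
    --> 'D_(delta_mx 0 a) g x.
  have C0 : (fun t : R => t^-1 *: ((g \o shift x) (t *: delta_mx 0 a) - g x)) @ 0^'
    --> 'D_(delta_mx 0 a) g x by exact: dg.
  by apply: cvg_trans C0; apply: cvg_app; exact: cvg_within.
apply: cvg_trans C; apply: near_eq_cvg.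
have nV : \forall t \near (0:R), V (x + t *: delta_mx 0 a).
  have [s s0 Hs] := nbhs_line (delta_mx 0 a) (open_nbhs_nbhs (conj oV Vx)).
  apply: filterS (nbhsx_ballx (0:R) s s0) => t; rewrite /ball /= sub0r normrN => ts.
  by apply: Hs; exact: ltW.
rewrite /increments !near_withinE; apply: filterS nV => t Vt _ /= ht.
by rewrite [t *: _ + x]addrC E // E.
Qed.

Lemma pderivE V g G x (a : 'I_d) : open V -> smooth V g -> V x -> halfspace x ->
  (forall y, V y -> halfspace y -> g y = G y) -> pderiv a G x = 'D_(delta_mx 0 a) g x.
Proof.
move=> oV sg Vx hx E; apply: pderiv_derivable E => //.
exact: smooth_derivable sg _ Vx.
Qed.

Lemma germ_pderiv G x (a : 'I_d) : smooth_germ G x -> smooth_germ (pderiv a G) x.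
Proof.
move=> [V [h [oV Vx sh E]]]; exists V, (fun y => 'D_(delta_mx 0 a) h y); split=> //.
  exact: smooth_D.
by move=> y Vy hy; rewrite (pderivE _ oV sh).
Qed.

Lemma pderiv_ext G G' x (a : 'I_d) : halfspace x -> smooth_germ G x ->
  (\forall y \near x, halfspace y -> G y = G' y) -> pderiv a G x = pderiv a G' x.
Proof.
move=> hx [V [h [oV Vx sh H]]] E.
have nW : \forall y \near x, V y /\ (halfspace y -> G y = G' y).
  by apply: filterI => //; exact: open_nbhs_nbhs.
have [W [oW Wx WW]] := near_open nW.
have sW : smooth W h by apply: smooth_sub sh => y /WW[].
rewrite (pderivE a oV sh Vx hx H) (pderivE a oW sW Wx hx _) //.
by move=> y /WW[Vy Ey] hy; rewrite H // Ey.
Qed.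

Lemma pderiv_cst (c : R) x (a : 'I_d) : halfspace x -> pderiv a (cst c) x = 0.
Proof.
move=> hx; rewrite (@pderivE setT (cst c)) //; last exact: smooth_cst.
  by rewrite derive_cst.
exact: openT.
Qed.

Lemma pderiv_add G G' x (a : 'I_d) : halfspace x -> smooth_germ G x -> smooth_germ G' x ->
  pderiv a (fun y => G y + G' y) x = pderiv a G x + pderiv a G' x.
Proof.
move=> hx [V [h [oV Vx sh E]]] [V' [h' [oV' Vx' sh' E']]].
have oW := openI oV oV'.
have sW : smooth (V `&` V') h by apply: smooth_sub sh => y [].
have sW' : smooth (V `&` V') h' by apply: smooth_sub sh' => y [].
rewrite (pderivE a oW (smooth_add oW sW sW')) //.
  rewrite (pderivE a oV sh Vx hx E) (pderivE a oV' sh' Vx' hx E').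
  by rewrite deriveD //; [exact: smooth_derivable sh _ Vx|exact: smooth_derivable sh' _ Vx'].
by move=> y [Vy V'y] hy; rewrite E // E'.
Qed.

Lemma pderiv_mul G G' x (a : 'I_d) : halfspace x -> smooth_germ G x -> smooth_germ G' x ->
  pderiv a (fun y => G y * G' y) x = G x * pderiv a G' x + G' x * pderiv a G x.
Proof.
move=> hx [V [h [oV Vx sh E]]] [V' [h' [oV' Vx' sh' E']]].
have oW := openI oV oV'.
have sW : smooth (V `&` V') h by apply: smooth_sub sh => y [].
have sW' : smooth (V `&` V') h' by apply: smooth_sub sh' => y [].
rewrite (pderivE a oW (smooth_mul oW sW sW')) //.
  rewrite (pderivE a oV sh Vx hx E) (pderivE a oV' sh' Vx' hx E') -E // -E' //.
  by rewrite deriveM //; [exact: smooth_derivable sh _ Vx|exact: smooth_derivable sh' _ Vx'].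
by move=> y [Vy V'y] hy; rewrite E // E'.
Qed.

Lemma pderiv_comm G x (a b : 'I_d) : halfspace x -> smooth_germ G x ->
  pderiv a (pderiv b G) x = pderiv b (pderiv a G) x.
Proof.
move=> hx [V [h [oV Vx sh E]]].
have EG c y : V y -> halfspace y -> 'D_(delta_mx 0 c) h y = pderiv c G y.
  by move=> Vy hy; rewrite (pderivE c oV sh Vy hy E).
rewrite (pderivE a oV (smooth_D b sh) Vx hx (EG b)).
rewrite (pderivE b oV (smooth_D a sh) Vx hx (EG a)).
exact: (Schwarz _ _ oV sh Vx).
Qed.

Lemma germ_near_lt G x (e : R) : halfspace x -> smooth_germ G x -> 0 < e ->
  \forall y \near x, halfspace y -> `|G x - G y| < e.
Proof.
move=> hx [V [h [oV Vx sh E]]] e0.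
have nV : \forall y \near x, V y by exact: open_nbhs_nbhs.
have nh := cont_near_lt (smooth_cont sh Vx) e0.
near=> y => hy; rewrite -E // -E //; near: y => //.
Unshelve. all: by end_near. Qed.

Lemma pderiv_comp1 G x (s : R -> R) (c : R) (a : 'I_d) : halfspace x ->
  smooth_germ G x -> is_derive (G x) 1 s c ->
  pderiv a (fun x => s (G x)) x = c * pderiv a G x.
Proof.
move=> hx [V [h [oV Vx sh E]]] ds; rewrite (pderivE a oV sh Vx hx E).
have dh := smooth_derivable (a := a) sh Vx.
rewrite -(E x Vx hx) in ds; have [d1 d2] := is_derive_comp1 dh ds.
by rewrite -d2; apply: (pderiv_derivable oV) => // y Vy hy; rewrite E.
Qed.

(** Positivity of the coordinate of index 0 says that x is not on the boundary
    hyperplane, so that both signs of the increment are available. *)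
Lemma pderiv_min G x (a : 'I_d) : halfspace x -> smooth_germ G x ->
  (forall b : 'I_d, b = 0%N :> nat -> 0 < x 0 b) ->
  (\forall y \near x, halfspace y -> G x <= G y) -> pderiv a G x = 0.
Proof.
move=> hx [V [h [oV Vx sh E]]] xp mn; rewrite (pderivE a oV sh) //.
have nH : \forall y \near x, halfspace y.
  have nb : \forall y \near x, forall b : 'I_d, b = 0%N :> nat -> 0 <= (y : 'rV[R]_d) 0 b.
    apply: (filter_forall (nbhs_filter x)) => b.
    have [b0|b0] := eqVneq (b : nat) 0%N; last by apply: nearW => y /eqP; rewrite (negPf b0).
    have cc : {for x, continuous (fun z : 'rV[R]_d => z 0 b)} by exact: coord_continuous.
    apply: filterS (cont_near_lt cc (xp b b0)) => y xy _.
    move: xy; rewrite ltr_norml => /andP[_]; lra.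
  exact: nb.
have nW : \forall y \near x, [/\ V y, halfspace y & G x <= G y].
  near=> y; have hy : halfspace y by near: y.
  have Vy : V y by near: y; exact: open_nbhs_nbhs.
  split=> //; move: (hy); near: y; exact: mn.
have [s s0 Hs] := nbhs_line (delta_mx 0 a) nW.
have Dl : is_derive (0 : R) 1 (fun t => h (x + t *: delta_mx 0 a)) ('D_(delta_mx 0 a) h x).
  have := @line_derivable _ _ h x (delta_mx 0 a) 0.
  by rewrite scale0r addr0; apply; exact: smooth_derivable sh _ Vx.
have ts t : t \in `]- s, s[%R -> `|t| <= s.
  by rewrite in_itv /= => /andP[t1 t2]; rewrite ler_norml !ltW.
have M : is_derive (0 : R) 1 (fun t => h (x + t *: delta_mx 0 a)) 0.
  apply: (@derive1_at_min _ _ (- s) s); first lra.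
  - move=> t /ts tss; have [Vt _ _] := Hs _ tss.
    by have [] := line_derivable (smooth_derivable (a := a) sh Vt).
  - by rewrite in_itv /= s0 oppr_lt0 s0.
  - move=> t /ts tss; have [Vt ht Gt] := Hs _ tss.
    by rewrite scale0r addr0 !E.
by case: Dl => _ <-; case: M.
Unshelve. all: by end_near. Qed.

Lemma halfspace_tangent x t (a a0 : 'I_d) : a0 = 0%N :> nat -> a != a0 -> halfspace x ->
  halfspace (x + t *: delta_mx 0 a).
Proof.
move=> a00 aa0 hx b b0; have -> : b = a0 by apply: val_inj; rewrite /= b0 a00.
by rewrite !mxE [a0 == a]eq_sym (negPf aa0) andbF mulr0 addr0 hx.
Qed.

Lemma pderiv_tangent G x (a a0 : 'I_d) : a0 = 0%N :> nat -> a != a0 -> halfspace x ->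
  smooth_germ G x -> x 0 a0 = 0 ->
  (\forall y \near x, halfspace y -> y 0 a0 = 0 -> G y = G x) -> pderiv a G x = 0.
Proof.
move=> a00 aa0 hx [V [h [oV Vx sh E]]] x0 H; rewrite (pderivE a oV sh) //.
apply: cvg_lim => //.
apply: (@cvg_near_cst _ _ _ _ (dnbhs 0)).
have nW : \forall y \near x, V y /\ (halfspace y -> (y : 'rV[R]_d) 0 a0 = 0 -> G y = G x).
  by apply: filterI => //; exact: open_nbhs_nbhs.
have [s s0 Hs] := nbhs_line (delta_mx 0 a) nW.
rewrite near_withinE; apply: filterS (nbhsx_ballx (0:R) s s0) => t.
rewrite /ball /= sub0r normrN => /ltW/Hs[Vt Ht] _ /=.
have ht := halfspace_tangent t a00 aa0 hx.
rewrite [t *: _ + x]addrC !E // Ht // ?subrr ?scaler0 //.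
by rewrite !mxE [a0 == a]eq_sym (negPf aa0) andbF mulr0 addr0.
Qed.

(** The quotient of G by the coordinate a0, for G vanishing on the boundary
    hyperplane. *)
Definition hdiv (a0 : 'I_d) G y : R :=
  if y 0 a0 == 0 then pderiv a0 G y else G y / y 0 a0.

Lemma is_derive_inv1 (t : R) : t != 0 -> is_derive t 1 (fun t : R => t^-1) (- t ^- 2).
Proof.
move=> t0; have := @deriveV R R id t 1 t0 (@derivable_id _ _ _ _); rewrite derive_id => Dv.
by apply: DeriveDef; [exact: derivableV|rewrite Dv [LHS]mulr1].
Qed.

Lemma inv_family (D : set R) : D `<=` [set t | t != 0] ->
  forall s : R -> R, (exists (c : R) n, s = fun t : R => c * (t^-1) ^+ n) ->
  exists2 s' : R -> R, (exists (c : R) n, s' = fun t : R => c * (t^-1) ^+ n)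
    & forall t, D t -> is_derive t 1 s (s' t).
Proof.
move=> D0 _ [c [n ->]]; exists (fun t : R => (- (n%:R * c)) * (t^-1) ^+ n.+1).
  by do 2 eexists.
move=> t /D0 /= t0.
have D1 := DeriveDef (@exprn_derivable R n t^-1 1) (@exp_derive R n t^-1 1).
have D3 := @is_derive1_comp _ _ (fun t : R => t^-1) t _ _ D1 (is_derive_inv1 t0).
have D4 := is_deriveM (is_derive_cst c t (1 : R)) D3.
apply: is_derive_eq D4 _; rewrite scaler0 addr0 /=.
change (c * (n%:R * t^-1 ^+ n.-1 * 1 * (- t ^- 2)) = - (n%:R * c) * t^-1 ^+ n.+1).
case: n {D1 D3} => [|n]; first by rewrite mul0r !mul0r mulr0 oppr0 mul0r.
by rewrite -exprVn !exprS expr0 /=; ring.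
Qed.

Lemma germ_inv G x : halfspace x -> G x != 0 -> smooth_germ G x ->
  smooth_germ (fun x => (G x)^-1) x.
Proof.
move=> hx Gx; apply: (@germ_comp1 [set t | t != 0]
  (fun s => exists (c : R) n, s = fun t : R => c * (t^-1) ^+ n)) => //.
- exact: inv_family.
- by exists 1, 1%N; apply/funext => t; rewrite mul1r expr1.
Qed.

Lemma germ_hdiv (a0 : 'I_d) G x : a0 = 0%N :> nat -> halfspace x -> smooth_germ G x ->
  (\forall y \near x, halfspace y -> y 0 a0 = 0 -> G y = 0) -> smooth_germ (hdiv a0 G) x.
Proof.
move=> a00 hx sG H; have [x0|x0] := eqVneq (x 0 a0) 0; last first.
  apply: (@germ_ext (fun y => G y * (y 0 a0)^-1)).
    by apply: filterS (near_coord_neq0 x0) => y y0 _; rewrite /hdiv (negPf y0).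
  by apply: germ_mul => //; apply: germ_inv => //; exact: germ_coord.
case: sG => V [h [oV Vx sh E]].
have nW : \forall y \near x, V y /\ (halfspace y -> (y : 'rV[R]_d) 0 a0 = 0 -> G y = 0).
  by apply: filterI => //; exact: open_nbhs_nbhs.
move/nbhs_ballP: nW => [r /= r0 Hr].
(* The norm is the sup norm, so that a ball centred on the hyperplane is stable
   under decreasing the absolute value of the coordinate a0. *)
pose W := ball x r.
have WV : W `<=` V by move=> y /Hr[].
have oW : open W by exact: ball_open.
have cW y s : W y -> `|s| <= `|y 0 a0| -> W (setx0 a0 y s) by move=> Wy; exact: ball_setx0.
have sW : smooth W h by exact: smooth_sub sh.
have fl : flat a0 W 1 h.
  split=> // -[|//] y _ Wy y0; have [Vy Gy] := Hr y Wy.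
  have hy : halfspace y.
    move=> b b0; have -> : b = a0 by apply: val_inj; rewrite /= b0 a00.
    by rewrite y0.
  by rewrite /= E // Gy.
exists W, (hquot a0 1 h); split=> //; first exact: ballxx.
  exact: smooth_hquot.
move=> y Wy hy; rewrite /hquot /hdiv; case: ifP => _.
  by rewrite /= (_ : 1`! = 1%N) // divr1 (pderivE a0 oV sh (WV _ Wy) hy E).
by rewrite expr1 E //; exact: WV.
Qed.

Lemma hdivK (a0 : 'I_d) G y : (y 0 a0 = 0 -> G y = 0) -> G y = y 0 a0 * hdiv a0 G y.
Proof.
rewrite /hdiv; case: eqP => [-> /(_ erefl) ->|/eqP y0 _]; first by rewrite mul0r.
by rewrite mulrC divfK.
Qed.

End Germs.

(** * Changes of variables, logarithms and bump functions *)

Section Chain.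
Context {R : realType} {n d : nat}.

(** The extensions of the components of phi may leave the half-space, but at points
    outside of the half-space only, which do not matter. *)
Lemma pderiv_chain (G : 'rV[R]_d -> R) (phi : 'rV[R]_n -> 'rV[R]_d) (x : 'rV[R]_n) (a : 'I_n) :
  halfspace x -> halfspace (phi x) -> smooth_germ G (phi x) ->
  (forall b, smooth_germ (fun y => phi y 0 b) x) ->
  (\forall y \near x, halfspace y -> halfspace (phi y)) ->
  pderiv a (fun y => G (phi y)) x
  = \sum_(b < d) pderiv a (fun y => phi y 0 b) x * pderiv b G (phi x).
Proof.
move=> hx hpx [V [h [oV Vpx sh E]]] sphi Hphi.
have [W Wp] := choice sphi; have [g Hg] := choice Wp.
pose psi y : 'rV[R]_d := \row_b g b y.
have psix : psi x = phi x.
  by apply/rowP => b; rewrite mxE; have [_ Wx _ ->] := Hg b.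
have dpsi b : derivable (fun y => psi y 0 b) x (delta_mx 0 a).
  have -> : (fun y => psi y 0 b) = g b by apply/funext => y; rewrite mxE.
  by have [_ Wx sg _] := Hg b; exact: smooth_derivable sg _ Wx.
have cpsi : {for x, continuous psi}.
  have dpsi' : differentiable psi x.
    have -> : psi = \sum_b (fun y => g b y *: (delta_mx 0 b : 'rV[R]_d)).
      by apply/funext => y; rewrite fct_sumE [LHS]row_sum_delta; apply: eq_bigr => b _; rewrite mxE.
    apply: differentiable_sum => b; apply: differentiableZl.
    by have [oW Wx sg _] := Hg b; exact: (smooth_differentiable oW sg Wx).
  exact: differentiable_continuous.
have D := chain_rule oV sh (_ : V (psi x)) dpsi.
have {D}[|D1 D2] := D; first by rewrite psix.
have nU : \forall y \near x, [/\ V (psi y), forall b, W b y & halfspace y -> halfspace (phi y)].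
  have n1 : \forall y \near x, V (psi y).
    by apply: cpsi; apply: open_nbhs_nbhs; rewrite psix.
  have n2 : \forall y \near x, forall b, W b y.
    apply: (filter_forall (nbhs_filter x)) => b; have [oW Wx _ _] := Hg b.
    exact: open_nbhs_nbhs.
  by near=> y; split; near: y.
have [U [oU Ux HU]] := near_open nU.
rewrite (pderiv_derivable oU Ux D1 hx).
  rewrite D2; apply: eq_bigr => b _; rewrite psix; congr (_ * _); last first.
    by rewrite (pderivE b oV sh Vpx hpx E).
  have [oW Wx sg Eg] := Hg b.
  rewrite (pderivE a oW sg Wx hx Eg); congr ('D_ _ _ _).
  by apply/funext => y; rewrite mxE.
move=> y Uy hy; have [Vy Wy hpy] := HU y Uy.
have Ey : psi y = phi y by apply/rowP => b; rewrite mxE; have [_ _ _ ->] := Hg b.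
by rewrite Ey in Vy *; rewrite E //; exact: hpy.
Unshelve. all: by end_near. Qed.

End Chain.

Section Germs2.
Context {R : realType} {d : nat}.
Implicit Types (U V : set 'rV[R]_d) (f g h G : 'rV[R]_d -> R) (x y z v : 'rV[R]_d).

(** The segment from x to y stays in the hyperplane, where the derivative of G
    along it vanishes. *)
Lemma locally_constant_hyperplane G x (a0 : 'I_d) : a0 = 0%N :> nat -> halfspace x -> x 0 a0 = 0 ->
  smooth_germ G x ->
  (forall a, a != a0 -> \forall y \near x, halfspace y -> y 0 a0 = 0 -> pderiv a G y = 0) ->
  \forall y \near x, halfspace y -> y 0 a0 = 0 -> G y = G x.
Proof.
move=> a00 hx x0 [V [h [oV Vx sh E]]] H.
have nW : \forall y \near x, V y /\ (forall a, a != a0 -> halfspace y ->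
  (y : 'rV[R]_d) 0 a0 = 0 -> pderiv a G y = 0).
  apply: filterI; first exact: open_nbhs_nbhs.
  apply: (filter_forall (nbhs_filter x)) => a.
  have [->|aa0] := eqVneq a a0; first by apply: nearW => y /eqP.
  by apply: filterS (H a aa0) => y Hy _.
move/nbhs_ballP: nW => [r /= r0 Hr].
apply: filterS (nbhsx_ballx x r r0) => y yr hy y0.
have B t : `|t| <= 1 -> ball x r (x + t *: (y - x)).
  move=> t1; move: yr; rewrite -!ball_normE /ball_ /= => yr.
  rewrite opprD addNKr normrN normrZ distrC in yr *; apply: le_lt_trans yr.
  by rewrite -[leRHS]mul1r ler_wpM2r.
have hB t : halfspace (x + t *: (y - x)) /\ (x + t *: (y - x)) 0 a0 = 0.
  have E0 : (x + t *: (y - x)) 0 a0 = 0 by rewrite !mxE x0 y0 subr0 mulr0 addr0.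
  split=> // b b0; have -> : b = a0 by apply: val_inj; rewrite /= b0 a00.
  by rewrite E0.
have [t|t] := @mean_value_line _ _ h x (y - x) 1.
  rewrite normr1 => /B/Hr[Vt _].
  by apply: diff_derivable; exact: (smooth_differentiable oV sh Vt).
rewrite normr1 scale1r addrCA subrr addr0 => /B Bt; rewrite mul1r.
have [Vt Pt] := Hr _ Bt; have [ht t0] := hB t.
rewrite (derive_sum_coord _ oV sh Vt) big1 => [|b _].
  have [Vy _] := Hr _ yr.
  by rewrite !E // => /eqP; rewrite subr_eq0 => /eqP.
have [->|ba0] := eqVneq b a0; first by rewrite !mxE x0 y0 subrr mul0r.
by rewrite -(pderivE b oV sh Vt ht E) Pt // mulr0.
Qed.

Lemma germ_ln G x : halfspace x -> 0 < G x -> smooth_germ G x -> smooth_germ (fun x => ln (G x)) x.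
Proof.
move=> hx Gx; apply: (@germ_comp1 _ _ [set t | 0 < t]
  (fun s => s = @ln R \/ exists (c : R) n, s = fun t : R => c * (t^-1) ^+ n)) => //.
- move=> s0 [->|Ss0].
    exists (fun t : R => 1 * t^-1 ^+ 1); first by right; do 2 eexists.
    by move=> t t0; rewrite mul1r expr1; exact: is_derive1_ln.
  have [|s' Ss' Ds] := inv_family (_ : [set t : R | 0 < t] `<=` [set t | t != 0]) Ss0.
    by move=> t /= t0; rewrite gt_eqF.
  by exists s' => //; right.
- by left.
Qed.

Lemma pderiv_ln G x (a : 'I_d) : halfspace x -> 0 < G x -> smooth_germ G x ->
  pderiv a (fun x => ln (G x)) x = pderiv a G x / G x.
Proof.
move=> hx Gx sG; rewrite (pderiv_comp1 a hx sG (is_derive1_ln Gx)).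
exact: mulrC.
Qed.

(** The functions p(1/t) exp(-1/t), extended by 0: a set of functions that is
    stable under differentiation and contains a smooth function which is zero on
    one side of the origin and positive on the other. *)
Definition flat_exp (p : {poly R}) (t : R) : R :=
  if 0 < t then p.[t^-1] * expR (- t^-1) else 0.

(** The exponential of 1/t dominates t^-(n+1) / (n+1)!, hence each monomial of p
    costs at most a multiple of t. This gives the derivative at the origin. *)
Lemma flat_exp_bound p : exists C : R, forall t, `|flat_exp p t| <= C * `|t|.
Proof.
exists (\sum_(i < size p) `|p`_i| * i.+1`!%:R) => t; rewrite /flat_exp.
case: ifP => t0; last first.
  by rewrite normr0 mulr_ge0 // sumr_ge0 // => i _; rewrite mulr_ge0.
rewrite (gtr0_norm t0) normrM (gtr0_norm (expR_gt0 _)) horner_coef.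
rewrite (le_trans (ler_wpM2r (ltW (expR_gt0 _)) (ler_norm_sum _ _ _))) //.
rewrite mulr_suml mulr_suml; apply: ler_sum => i _.
rewrite normrM -!mulrA ler_wpM2l //.
have ti : 0 < t^-1 by rewrite invr_gt0.
rewrite (ger0_norm (exprn_ge0 _ (ltW ti))) expRN ler_pdivrMr ?expR_gt0 //.
have B := @expR_ge1Dxn R t^-1 i (ltW ti).
have f0 : 0 < i.+1`!%:R :> R by rewrite ltr0n fact_gt0.
have B1 : t^-1 ^+ i.+1 / i.+1`!%:R <= expR t^-1 by apply: le_trans B; rewrite lerDr.
move: B1; rewrite ler_pdivrMr // => B1.
have -> : t^-1 ^+ i = t * t^-1 ^+ i.+1 by rewrite exprS mulVKf // gt_eqF.
rewrite [leRHS](_ : _ = t * (expR t^-1 * i.+1`!%:R)); last by ring.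
by rewrite ler_wpM2l // ltW.
Qed.

Lemma flat_exp_derive (p : {poly R}) (t : R) : is_derive t 1 (flat_exp p) (flat_exp ('X^2
  * (p - p^`())) t).
Proof.
have [t0|t0|->] := ltrgt0P t.
- have D2 := is_derive_inv1 (lt0r_neq0 t0).
  have D1 : is_derive t^-1 1 (horner p) (p^`()).[t^-1].
    by apply: DeriveDef; [exact: derivable_horner|rewrite -derive1E -derivE].
  have D3 := @is_derive1_comp _ _ (fun t : R => t^-1) t _ _ D1 D2.
  have D4 : is_derive t 1 (fun t : R => - t^-1) (t ^- 2).
    by have := is_deriveN D2; rewrite opprK.
  have D5 := @is_derive1_comp _ _ (fun t : R => - t^-1) t _ _ (is_derive_expR _) D4.
  have D6 := is_deriveM D3 D5.
  have nE : \forall s \near t, p.[s^-1] * expR (- s^-1) = flat_exp p s.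
    have : \forall s \near t, 0 < s by apply: open_nbhs_nbhs; split=> //; exact: open_gt.
    by apply: filterS => s s0; rewrite /flat_exp s0.
  apply: near_eq_is_derive nE _; apply: is_derive_eq D6 _.
  rewrite /flat_exp t0 !hornerE /= exprVn.
  change (p.[t^-1] * (expR (- t^-1) * t ^- 2) + expR (- t^-1) * (p^`().[t^-1] * (- t ^- 2))
    = t ^- 2 * (p.[t^-1] - p^`().[t^-1]) * expR (- t^-1)).
  ring.
- have nE : \forall s \near t, cst 0 s = flat_exp p s.
    have : \forall s \near t, s < 0 by apply: open_nbhs_nbhs; split=> //; exact: open_lt.
    by apply: filterS => s s0; rewrite /flat_exp ltNge ltW.
  apply: near_eq_is_derive nE _; rewrite /flat_exp ltNge ltW //=.
  exact: is_derive_cst.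
- have [C HC] := flat_exp_bound ('X * p).
  have E0 q : flat_exp q 0 = 0 by rewrite /flat_exp ltxx.
  rewrite E0.
  suff H : (fun h : R => h^-1 *: ((flat_exp p \o shift 0) (h *: (1 : R))
    - flat_exp p 0)) @ 0^' --> (0 : R).
    by apply: DeriveDef; [apply/cvg_ex; exists 0|apply: cvg_lim].
  have H1 (h : R) : `|h^-1 *: ((flat_exp p \o shift 0) (h *: (1 : R)) - flat_exp p 0)| <= C * `|h|.
    apply: le_trans (HC h); rewrite E0 subr0 /= addr0 [h *: _]mulr1 /flat_exp.
    case: ifP => _; last by rewrite scaler0.
    by rewrite hornerM hornerX -mulrA.
  apply/cvgrPdist_le => e e0.
  have C0 : 0 <= C by have := HC 1; rewrite normr1 mulr1; apply: le_trans.
  have e1 : 0 < e / (1 + C) by rewrite divr_gt0 // ltr_wpDr.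
  apply: cvg_within; apply: filterS (nbhsx_ballx (0:R) _ e1) => h.
  rewrite /ball /= !sub0r !normrN => he; apply: le_trans (H1 h) _.
  have C1 : 0 < 1 + C by rewrite ltr_wpDr.
  have : `|h| * (1 + C) < e by rewrite -ltr_pdivlMr.
  have := normr_ge0 h; nra.
Qed.

Lemma germ_flat_exp G x : halfspace x -> smooth_germ G x ->
  smooth_germ (fun x => flat_exp 1 (G x)) x.
Proof.
move=> hx; apply: (@germ_comp1 _ _ setT (fun s => exists p, s = flat_exp p)) => //.
- exact: openT.
- move=> _ [p ->]; exists (flat_exp ('X^2 * (p - p^`()))); first by eexists.
  by move=> t _; exact: flat_exp_derive.
- by exists 1.
Qed.

Lemma flat_exp1_gt0 (t : R) : 0 < t -> 0 < flat_exp 1 t.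
Proof. by move=> t0; rewrite /flat_exp t0 hornerC mul1r expR_gt0. Qed.

Lemma flat_exp1_ge0 (t : R) : 0 <= flat_exp 1 t.
Proof. by rewrite /flat_exp; case: ifP => // _; rewrite hornerC mul1r expR_ge0. Qed.

Lemma flat_exp_le0 (p : {poly R}) t : t <= 0 -> flat_exp p t = 0.
Proof. by move=> t0; rewrite /flat_exp ltNge t0. Qed.

(** Equal to 1 for y <= r and to 0 for y >= 2 r. *)
Definition smooth_bump (r y : R) : R :=
  flat_exp 1 (2 * r - y) / (flat_exp 1 (2 * r - y) + flat_exp 1 (y - r)).

Lemma bump_den_gt0 (r y : R) : 0 < r -> 0 < flat_exp 1 (2 * r - y) + flat_exp 1 (y - r).
Proof.
move=> r0; have [yr|yr] := ltP y (2 * r).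
  by rewrite ltr_pwDl ?flat_exp1_ge0 // flat_exp1_gt0 // subr_gt0.
by rewrite ltr_wpDl ?flat_exp1_ge0 // flat_exp1_gt0 //; lra.
Qed.

Lemma bump1 (r y : R) : 0 < r -> y <= r -> smooth_bump r y = 1.
Proof.
move=> r0 yr; rewrite /smooth_bump [flat_exp 1 (y - r)]flat_exp_le0 ?subr_le0 // addr0 divff //.
by rewrite gt_eqF // flat_exp1_gt0 //; lra.
Qed.

Lemma bump0 (r y : R) : 2 * r <= y -> smooth_bump r y = 0.
Proof. by move=> yr; rewrite /smooth_bump flat_exp_le0 ?mul0r // subr_le0. Qed.

Lemma germ_sub G G' x : smooth_germ G x -> smooth_germ G' x -> smooth_germ (fun x => G x - G' x) x.
Proof.
move=> sG sG'; apply: (@germ_ext _ _ (fun x => G x + (-1) * G' x)).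
  by near=> y => _; rewrite mulN1r.
apply: germ_add => //; apply: germ_mul => //; exact: germ_cst.
Unshelve. all: by end_near. Qed.

Lemma germ_bump (r : R) G x : halfspace x -> 0 < r -> smooth_germ G x ->
  smooth_germ (fun x => smooth_bump r (G x)) x.
Proof.
move=> hx r0 sG; have s1 : smooth_germ (fun x => flat_exp 1 (2 * r - G x)) x.
  by apply: germ_flat_exp => //; apply: germ_sub => //; exact: germ_cst.
have s2 : smooth_germ (fun x => flat_exp 1 (G x - r)) x.
  by apply: germ_flat_exp => //; apply: germ_sub => //; exact: germ_cst.
apply: germ_mul => //; apply: germ_inv => //; last exact: germ_add.
by rewrite gt_eqF // bump_den_gt0.
Qed.

End Germs2.

(** * Smoothness at a point of a domain *)

Section Manifold.
Context {R : realType} {d : nat} (F : domain R d).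
Implicit Types (i j : chart F) (p q : F) (g h : F -> R) (a b : 'I_d) (A : set F).

(** Smoothness at a point is easier to combine than smoothness on a set: each
    ingredient of a construction may be smooth on a neighbourhood of its own. *)
Definition smooth_near i p g := smooth_germ (g \o chart_inv i) (chart_map i p).

Lemma halfspace_chart i p : chart_dom i p -> halfspace (chart_map i p).
Proof.
move=> ip; have [U oU E] := chart_img_open i.
have : (chart_map i @` chart_dom i) (chart_map i p) by exists p.
by rewrite E => -[].
Qed.

(** With [near_chart_map], the neighbourhoods of p correspond to those of its
    coordinates in the half-space. *)
Lemma near_chart i p (P : F -> Prop) : chart_dom i p -> (\forall q \near p, P q) ->
  \forall y \near chart_map i p, halfspace y ->
    [/\ chart_dom i (chart_inv i y), chart_map i (chart_inv i y) = y & P (chart_inv i y)].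
Proof.
move=> ip nP; have [U oU E] := chart_img_open i.
have Ix : (chart_map i @` chart_dom i) (chart_map i p) by exists p.
have Ux : U (chart_map i p) by move: Ix; rewrite E => -[].
have C : chart_inv i @ within (chart_map i @` chart_dom i) (nbhs (chart_map i p)) --> p.
  rewrite -[X in _ --> X](chart_mapK ip).
  by move/subspace_continuousP: (@chart_inv_continuous _ _ F i); apply.
have nO : \forall y \near chart_map i p, U y by exact: open_nbhs_nbhs.
have nQ : \forall y \near chart_map i p, (chart_map i @` chart_dom i) y -> P (chart_inv i y).
  exact: (C _ nP).
near=> y => hy.
have Iy : (chart_map i @` chart_dom i) y by rewrite E; split=> //; near: y.
case: (Iy) => q iq qy; rewrite -qy chart_mapK //; split=> //.
by rewrite -(chart_mapK iq) qy; move: Iy; near: y.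
Unshelve. all: by end_near. Qed.

Lemma near_chart_map i p (Q : 'rV[R]_d -> Prop) : chart_dom i p ->
  (\forall y \near chart_map i p, halfspace y -> Q y) ->
  \forall q \near p, chart_dom i q /\ Q (chart_map i q).
Proof.
move=> ip nQ.
have nD : \forall q \near p, chart_dom i q.
  by apply: open_nbhs_nbhs; split=> //; exact: chart_dom_open.
have C : chart_map i @ within (chart_dom i) (nbhs p) --> chart_map i p.
  by move/subspace_continuousP: (@chart_map_continuous _ _ F i); apply.
have nQ' : \forall q \near p, chart_dom i q -> halfspace (chart_map i q) -> Q (chart_map i q).
  exact: (C _ nQ).
near=> q; have iq : chart_dom i q by near: q.
split=> //; have := halfspace_chart iq; move: iq; near: q; exact: nQ'.
Unshelve. all: by end_near. Qed.

Lemma smooth_in_chartP i A g : open A ->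
  smooth_in_chart i A g <-> (forall p, chart_dom i p -> A p -> smooth_near i p g).
Proof.
move=> oA; split=> [H p ip Ap|H x [p [ip Ap] <-]].
  have [|V [h [oV Vx sh E]]] := H (chart_map i p); first by exists p.
  have nA : \forall q \near p, A q by exact: open_nbhs_nbhs.
  have nW : \forall y \near chart_map i p, V y /\ (halfspace y ->
    [/\ chart_dom i (chart_inv i y), chart_map i (chart_inv i y) = y & A (chart_inv i y)]).
    by apply: filterI; [exact: open_nbhs_nbhs|exact: near_chart].
  have [W [oW Wx WH]] := near_open nW.
  exists W, h; split=> //; first by apply: smooth_sub sh => y /WH[].
  move=> y /WH[Vy H'] /H'[iy Ey Ay]; apply: E => //.
  by exists (chart_inv i y).
have [V [h [oV Vx sh E]]] := H p ip Ap.
exists V, h; split=> // y Vy [q [iq _] qy]; apply: E => //.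
by rewrite -qy; exact: halfspace_chart.
Qed.

Lemma smooth_near_ext i p g h : chart_dom i p -> (\forall q \near p, g q = h q) ->
  smooth_near i p g -> smooth_near i p h.
Proof.
move=> ip E; apply: germ_ext; have := near_chart ip E.
by apply: filterS => y Hy /Hy[].
Qed.

Lemma smooth_near_cst i p (c : R) : smooth_near i p (cst c).
Proof. exact: germ_cst. Qed.

Lemma smooth_near_add i p g h : smooth_near i p g -> smooth_near i p h ->
  smooth_near i p (fun q => g q + h q).
Proof. exact: germ_add. Qed.

Lemma smooth_near_sub i p g h : smooth_near i p g -> smooth_near i p h ->
  smooth_near i p (fun q => g q - h q).
Proof. exact: germ_sub. Qed.

Lemma smooth_near_mul i p g h : smooth_near i p g -> smooth_near i p h ->
  smooth_near i p (fun q => g q * h q).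
Proof. exact: germ_mul. Qed.

Lemma smooth_near_opp i p g : smooth_near i p g -> smooth_near i p (fun q => - g q).
Proof.
move=> sg; have -> : (fun q => - g q) = (fun q => cst 0 q - g q).
  by apply/funext => q; rewrite sub0r.
by apply: smooth_near_sub => //; exact: smooth_near_cst.
Qed.

Lemma smooth_near_sum i p (I : Type) (r : seq I) (P : pred I) (g : I -> F -> R) :
  (forall k, P k -> smooth_near i p (g k)) -> smooth_near i p (fun q => \sum_(k <- r | P k) g k q).
Proof.
move=> H; elim: r => [|k r IH].
  rewrite (_ : (fun _ => _) = cst 0); first exact: smooth_near_cst.
  by apply/funext => q; rewrite big_nil.
rewrite (_ : (fun _ => _) = fun q => (if P k then g k q else 0) + \sum_(k <- r | P k) g k q).
  by apply: smooth_near_add IH; case Pk: (P k); [exact: H|exact: smooth_near_cst].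
by apply/funext => q; rewrite big_cons; case: ifP => // _; rewrite add0r.
Qed.

Lemma smooth_near_prod i p (I : Type) (r : seq I) (P : pred I) (g : I -> F -> R) :
  (forall k, P k -> smooth_near i p (g k)) -> smooth_near i p (fun q => \prod_(k <- r | P k) g k q).
Proof.
move=> H; elim: r => [|k r IH].
  rewrite (_ : (fun _ => _) = cst 1); first exact: smooth_near_cst.
  by apply/funext => q; rewrite big_nil.
rewrite (_ : (fun _ => _) = fun q => (if P k then g k q else 1) * \prod_(k <- r | P k) g k q).
  by apply: smooth_near_mul IH; case Pk: (P k); [exact: H|exact: smooth_near_cst].
by apply/funext => q; rewrite big_cons; case: ifP => // _; rewrite mul1r.
Qed.

Lemma smooth_near_inv i p g : chart_dom i p -> g p != 0 -> smooth_near i p g ->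
  smooth_near i p (fun q => (g q)^-1).
Proof.
move=> ip gp; apply: germ_inv; first exact: halfspace_chart.
by rewrite /= chart_mapK.
Qed.

Lemma smooth_near_ln i p g : chart_dom i p -> 0 < g p -> smooth_near i p g ->
  smooth_near i p (fun q => ln (g q)).
Proof.
move=> ip gp; apply: germ_ln; first exact: halfspace_chart.
by rewrite /= chart_mapK.
Qed.

Lemma smooth_near_bump i p (r : R) g : chart_dom i p -> 0 < r -> smooth_near i p g ->
  smooth_near i p (fun q => smooth_bump r (g q)).
Proof. by move=> ip r0; apply: germ_bump => //; exact: halfspace_chart. Qed.

Lemma smooth_near_det i p n (M : F -> 'M[R]_n) : (forall k l, smooth_near i p (fun q => M q k l)) ->
  smooth_near i p (fun q => \det (M q)).
Proof.
move=> sM; apply: smooth_near_sum => s _; apply: smooth_near_mul; first exact: smooth_near_cst.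
by apply: smooth_near_prod => k _; exact: sM.
Qed.

Lemma smooth_near_mulmx i p m n k (M : F -> 'M[R]_(m, n)) (N : F -> 'M[R]_(n, k)) :
  (forall s t, smooth_near i p (fun q => M q s t)) ->
    (forall s t, smooth_near i p (fun q => N q s t)) ->
  forall s t, smooth_near i p (fun q => (M q *m N q) s t).
Proof.
move=> sM sN s t.
rewrite (_ : (fun _ => _) = fun q => \sum_l M q s l * N q l t).
  by apply: smooth_near_sum => l _; apply: smooth_near_mul.
by apply/funext => q; rewrite mxE.
Qed.

(** Cramer's formula for the inverse matrix. *)
Lemma smooth_near_invmx i p n (M : F -> 'M[R]_n) : chart_dom i p ->
  (forall k l, smooth_near i p (fun q => M q k l)) ->
  \det (M p) != 0 -> (forall k l, smooth_near i p (fun q => ((\det (M q))^-1 *: \adj (M q)) k l)).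
Proof.
move=> ip sM dM k l.
rewrite (_ : (fun _ => _) = fun q => (\det (M q))^-1 * ((-1) ^+ (l
  + k) * \det (row' l (col' k (M q))))).
  apply: smooth_near_mul; first by apply: smooth_near_inv => //; exact: smooth_near_det.
  apply: smooth_near_mul; first exact: smooth_near_cst.
  apply: smooth_near_det => k' l'; rewrite (_ : (fun _ => _)
    = fun q => M q (lift l k') (lift k l')) //.
  by apply/funext => q; rewrite !mxE.
by apply/funext => q; rewrite !mxE.
Qed.

Lemma smooth_near_continuous i p g : chart_dom i p -> smooth_near i p g -> {for p, continuous g}.
Proof.
move=> ip sg; apply: near_lt_cont => e e0.
have nQ : \forall y \near chart_map i p, halfspace y -> `|g p - (g \o chart_inv i) y| < e.
  by have := germ_near_lt (halfspace_chart ip) sg e0; rewrite /= chart_mapK.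
apply: filterS (near_chart_map ip nQ) => q [iq].
by rewrite /= chart_mapK.
Qed.

Lemma smooth_near_partial i a p g : chart_dom i p -> smooth_near i p g ->
  smooth_near i p (partial i a g).
Proof.
move=> ip /(germ_pderiv a); apply: germ_ext.
have nT : \forall q \near p, True by exact: nearW.
apply: filterS (near_chart ip nT) => y Hy /Hy[iy Ey _].
by rewrite /= /partial Ey.
Qed.

Lemma partial_ext i a p g h : chart_dom i p -> smooth_near i p g ->
  (\forall q \near p, g q = h q) ->
  partial i a g p = partial i a h p.
Proof.
move=> ip sg E; apply: pderiv_ext => //; first exact: halfspace_chart.
by apply: filterS (near_chart ip E) => y Hy /Hy[].
Qed.

Lemma partial_add i a p g h : chart_dom i p -> smooth_near i p g -> smooth_near i p h ->
  partial i a (fun q => g q + h q) p = partial i a g p + partial i a h p.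
Proof. by move=> ip sg sh; apply: pderiv_add => //; exact: halfspace_chart. Qed.

Lemma partial_cst i a p (c : R) : chart_dom i p -> partial i a (cst c) p = 0.
Proof. by move=> ip; apply: pderiv_cst; exact: halfspace_chart. Qed.

Lemma partial_mul i a p g h : chart_dom i p -> smooth_near i p g -> smooth_near i p h ->
  partial i a (fun q => g q * h q) p = g p * partial i a h p + h p * partial i a g p.
Proof.
move=> ip sg sh; rewrite /partial.
have := pderiv_mul a (halfspace_chart ip) sg sh.
by rewrite /= chart_mapK.
Qed.

Lemma partial_ln i a p g : chart_dom i p -> smooth_near i p g -> 0 < g p ->
  partial i a (fun q => ln (g q)) p = partial i a g p / g p.
Proof.
move=> ip sg gp; have := pderiv_ln a (halfspace_chart ip) _ sg.
by rewrite /= chart_mapK // => /(_ gp).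
Qed.

Lemma partial_comm i a b p g : chart_dom i p -> smooth_near i p g ->
  partial i a (partial i b g) p = partial i b (partial i a g) p.
Proof.
move=> ip sg.
have H c c' : partial i c (partial i c' g) p
    = pderiv c (pderiv c' (g \o chart_inv i)) (chart_map i p).
  apply/esym/pderiv_ext; [exact: halfspace_chart|exact: germ_pderiv|].
  have nT : \forall q \near p, True by exact: nearW.
  apply: filterS (near_chart ip nT) => y Hy /Hy[iy Ey _].
  by rewrite /= /partial Ey.
by rewrite !H; apply: pderiv_comm => //; exact: halfspace_chart.
Qed.

Lemma smooth_near_coord i j p a : chart_dom i p -> chart_dom j p ->
  smooth_near i p (fun q => chart_map j q 0 a).
Proof.
move=> ip jp; have := @chart_smooth _ _ F i j a.
by move/(smooth_in_chartP i (fun q => chart_map j q 0 a) (chart_dom_open j)); apply.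
Qed.

(** The chain rule, for the change of coordinates from chart i to chart j. *)
Lemma d0_law i j p g : chart_dom i p -> chart_dom j p -> smooth_near i p g -> smooth_near j p g ->
  d0 g i p = d0 g j p *m (Defs.jacobian i j p)^T.
Proof.
move=> ip jp sgi sgj; apply/rowP => a; rewrite !mxE.
have Ep : chart_inv i (chart_map i p) = p by rewrite chart_mapK.
have nj : \forall q \near p, chart_dom j q.
  by apply: open_nbhs_nbhs; split=> //; exact: chart_dom_open.
have nc := near_chart ip nj.
have := @pderiv_chain R d d (g \o chart_inv j) (chart_map j \o chart_inv i) (chart_map i p) a.
rewrite /= Ep => H.
rewrite /partial.
transitivity (pderiv a (fun y => g (chart_inv j (chart_map j (chart_inv i y)))) (chart_map i p)).
  apply: pderiv_ext; [exact: halfspace_chart|exact: sgi|].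
  by apply: filterS nc => y Hy /Hy[_ _ jy] /=; rewrite chart_mapK.
rewrite H //.
- by apply: eq_bigr => b _; rewrite !mxE /partial mulrC.
- exact: halfspace_chart.
- exact: halfspace_chart.
- by move=> b; exact: smooth_near_coord.
- by apply: filterS nc => y Hy /Hy[_ _ jy] /=; exact: halfspace_chart.
Qed.

End Manifold.

(** * The boundary and its defining functions *)

Section Boundary.
Context {R : realType} {d : nat} (F : domain R d).
Implicit Types (i j : chart F) (p q : F) (g h u : F -> R) (a b : 'I_d) (A : set F).

Lemma smooth_fun_near g i p : smooth_fun g -> chart_dom i p -> smooth_near i p g.
Proof. by move=> /(_ i) /(smooth_in_chartP i g openT) H ip; apply: H. Qed.

Lemma smooth_fun_continuous g p : smooth_fun g -> {for p, continuous g}.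
Proof.
by move=> sg; have [i ip] := chart_cover p; apply: (smooth_near_continuous ip);
  exact: smooth_fun_near.
Qed.

Lemma Int_gt0 u p : boundary_defining u -> Int p <-> 0 < u p.
Proof.
move=> [_ u0 ub _]; split=> [Ip|up bp].
  by rewrite lt_def u0 andbT; apply/eqP => /ub.
by move: up; rewrite (ub p).2 // ltxx.
Qed.

Lemma near_Int u p : boundary_defining u -> Int p -> \forall q \near p, Int q.
Proof.
move=> hu Ip; have up := (Int_gt0 p hu).1 Ip.
have [su _ _ _] := hu.
apply: filterS (cont_near_lt (smooth_fun_continuous (p := p) su) up) => q uq.
apply/(Int_gt0 q hu); move: uq; rewrite ltr_norml => /andP[_]; lra.
Qed.

Lemma open_Int u : boundary_defining u -> open (@Int R d F).
Proof.
by move=> hu; rewrite openE => p Ip; exact: near_Int hu Ip.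
Qed.

(** A point of the boundary lies on the boundary hyperplane in some chart, and it
    has to be shown that it does so in chart i. Otherwise it would be an interior
    minimum of u in chart i, and d0 u would vanish there. *)
Lemma boundary_coord u i p : boundary_defining u -> boundary p -> chart_dom i p ->
  exists2 a0 : 'I_d, a0 = 0%N :> nat & chart_map i p 0 a0 = 0.
Proof.
move=> hu bp ip; have [su u0 ub du] := hu.
apply: contrapT => H; have /eqP[] := du i p bp ip.
apply/rowP => a; rewrite !mxE; apply: pderiv_min.
- exact: halfspace_chart.
- exact: smooth_fun_near.
- move=> b b0; rewrite lt_def (halfspace_chart ip) // andbT.
  by apply/eqP => E; apply: H; exists b.
- near=> y => _; rewrite /= chart_mapK // (ub p).2 //; exact: u0.
Unshelve. all: by end_near. Qed.

Lemma coord_boundary i p (a0 : 'I_d) : chart_dom i p -> a0 = 0%N :> nat ->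
  chart_map i p 0 a0 = 0 -> boundary p.
Proof. by move=> ip a00 x0; exists i, a0. Qed.

Lemma ord0_unique (a b : 'I_d) : a = 0%N :> nat -> b = 0%N :> nat -> a = b.
Proof. by move=> a0 b0; apply: val_inj; rewrite /= a0 b0. Qed.

Lemma partial_tangent g i p a : chart_dom i p -> smooth_near i p g -> boundary p ->
  (exists2 a0 : 'I_d, a0 = 0%N :> nat & chart_map i p 0 a0 = 0) ->
  a <> 0%N :> nat -> (\forall q \near p, boundary q -> g q = g p) -> partial i a g p = 0.
Proof.
move=> ip sg bp [a0 a00 x0] an0 H.
apply: (@pderiv_tangent _ _ _ _ a a0) => //.
- by apply/eqP => E; apply: an0; rewrite E.
- exact: halfspace_chart.
- apply: filterS (near_chart ip H) => y Hy /[dup] hy /Hy[iy Ey Py] y0.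
  rewrite /= chart_mapK //; apply: Py.
  by apply: (@coord_boundary i _ a0) => //; rewrite Ey.
Qed.

Lemma partial_u_tangent u i p a : boundary_defining u -> chart_dom i p -> boundary p ->
  a <> 0%N :> nat -> partial i a u p = 0.
Proof.
move=> hu ip bp an0; have [su u0 ub du] := hu.
apply: partial_tangent => //; first exact: smooth_fun_near.
  exact: boundary_coord hu _ _.
by apply: nearW => q bq; rewrite (ub q).2 // (ub p).2.
Qed.

Lemma partial_u_normal u i p (a0 : 'I_d) : boundary_defining u -> chart_dom i p -> boundary p ->
  a0 = 0%N :> nat -> partial i a0 u p != 0.
Proof.
move=> hu ip bp a00; have [su u0 ub du] := hu.
apply/eqP => E; have /eqP[] := du i p bp ip.
apply/rowP => a; rewrite !mxE.
have [a0'|/eqP a0'] := eqVneq (a : nat) 0%N.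
  by rewrite (ord0_unique a0' a00).
exact: partial_u_tangent.
Qed.

Lemma smooth_near_of_germ i p (H : 'rV[R]_d -> R) : chart_dom i p ->
  smooth_germ H (chart_map i p) -> smooth_near i p (fun q => H (chart_map i q)).
Proof.
move=> ip; apply: germ_ext.
have nT : \forall q \near p, True by exact: nearW.
by apply: filterS (near_chart ip nT) => y Hy /Hy[iy Ey _] /=; rewrite Ey.
Qed.

(** In chart i, both g and u vanish on the hyperplane x_0 = 0 and are divisible by
    x_0. The quotient u / x_0 has no zero: on the hyperplane it is the normal
    derivative of u, which is nonzero because d0 u is, the tangential derivatives
    being zero. *)
Lemma divide_by_u u i g : boundary_defining u ->
  (forall p, chart_dom i p -> smooth_near i p g) ->
  (forall p, chart_dom i p -> boundary p -> g p = 0) ->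
  exists q : F -> R, (forall p, chart_dom i p -> smooth_near i p q) /\
    (forall p, chart_dom i p -> g p = u p * q p).
Proof.
move=> hu sg g0; have [su u0 ub du] := hu.
have [[a0 a00]|nex] := pselect (exists a0 : 'I_d, a0 = 0%N :> nat); last first.
  have nb p : Int p by move=> [j [a [_ a0 _]]]; apply: nex; exists a.
  have up p : u p != 0 by rewrite gt_eqF //; apply/(Int_gt0 p hu).
  exists (fun p => g p * (u p)^-1); split=> p ip.
    by apply: smooth_near_mul; [exact: sg|apply: smooth_near_inv => //; exact: smooth_fun_near].
  by rewrite mulrC mulfVK.
have B p : chart_dom i p -> chart_map i p 0 a0 = 0 <-> boundary p.
  move=> ip; split=> [|bp]; first exact: coord_boundary.
  by have [a1 a10 x0] := boundary_coord hu bp ip; rewrite (ord0_unique a00 a10).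
have van h : (forall p, chart_dom i p -> boundary p -> h p = 0) -> forall p, chart_dom i p ->
    \forall y \near chart_map i p, halfspace y -> y 0 a0 = 0 -> (h \o chart_inv i) y = 0.
  move=> h0 p ip; have nT : \forall q \near p, True by exact: nearW.
  apply: filterS (near_chart ip nT) => y Hy /Hy[iy Ey _] y0 /=.
  by apply: h0 => //; apply/B => //; rewrite Ey.
have u0' p : chart_dom i p -> boundary p -> u p = 0 by move=> _ /ub.
pose hg := hdiv a0 (g \o chart_inv i); pose hU := hdiv a0 (u \o chart_inv i).
have shg p : chart_dom i p -> smooth_near i p (fun q => hg (chart_map i q)).
  move=> ip; apply: smooth_near_of_germ => //; apply: germ_hdiv => //; first exact: halfspace_chart.
    exact: sg.
  exact: van.
have shu p : chart_dom i p -> smooth_near i p (fun q => hU (chart_map i q)).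
  move=> ip; apply: smooth_near_of_germ => //; apply: germ_hdiv => //; first exact: halfspace_chart.
    exact: smooth_fun_near.
  exact: van.
have Eh h p : (forall p, chart_dom i p -> boundary p -> h p = 0) -> chart_dom i p ->
    h p = chart_map i p 0 a0 * hdiv a0 (h \o chart_inv i) (chart_map i p).
  move=> h0 ip; rewrite -hdivK /= chart_mapK // => x0; apply: h0 => //; exact/B.
have hun0 p : chart_dom i p -> hU (chart_map i p) != 0.
  move=> ip; have [bp|Ip] := pselect (boundary p).
    rewrite /hU /hdiv (B p ip).2 // eqxx; exact: partial_u_normal.
  have up : 0 < u p by apply/(Int_gt0 p hu).
  by apply/eqP => E; move: up; rewrite (Eh u p u0' ip) -/hU E mulr0 ltxx.
exists (fun p => hg (chart_map i p) * (hU (chart_map i p))^-1); split=> p ip.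
  by apply: smooth_near_mul; [exact: shg|apply: smooth_near_inv => //; [exact: hun0|exact: shu]].
rewrite (Eh g p g0 ip) (Eh u p u0' ip) -/hg -/hU.
by rewrite -mulrA [hU _ * _]mulrC divfK // hun0.
Qed.

Lemma Int_dense u p (P : F -> Prop) : boundary_defining u -> (\forall q \near p, P q) ->
  exists2 q, Int q & P q.
Proof.
move=> hu nP; have [bp|Ip] := pselect (boundary p); last first.
  by exists p => //; exact: nbhs_singleton nP.
have [i ip] := chart_cover p.
have [a0 a00 x0] := boundary_coord hu bp ip.
have [s s0 Hs] := nbhs_line (delta_mx 0 a0) (near_chart ip nP).
have [||iq Eq Pq] := Hs s.
- by rewrite gtr0_norm.
- by apply: halfspace_add; [exact: halfspace_chart|exact: ltW].
exists (chart_inv i (chart_map i p + s *: delta_mx 0 a0)) => // bq.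
have [a1 a10] := boundary_coord hu bq iq.
rewrite Eq (ord0_unique a10 a00) !mxE !eqxx mulr1 x0 add0r => E.
by rewrite E ltxx in s0.
Qed.

(** This is how identities that hold in the interior reach the boundary. *)
Lemma eq_by_density u p g h : boundary_defining u -> {for p, continuous g} ->
  {for p, continuous h} ->
  (\forall q \near p, Int q -> g q = h q) -> g p = h p.
Proof.
move=> hu cg ch E; apply/eqP; rewrite -subr_eq0 -normr_le0; apply/ler_addgt0Pl => e e0.
have e2 : 0 < e / 2 by rewrite divr_gt0.
have ng := cont_near_lt cg e2; have nh := cont_near_lt ch e2.
have nP : \forall q \near p, [/\ Int q -> g q = h q, `|g p - g q| < e / 2 & `|h p - h q| < e / 2].
  by near=> q; split; near: q.
have [q Iq [Eq Hg Hh]] := Int_dense hu nP.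
rewrite (Eq Iq) in Hg; rewrite addr0 -(subrKA (h q)) (splitr e).
by rewrite (le_trans (ler_normD _ _)) // lerD // ltW // distrC.
Unshelve. all: by end_near. Qed.

Lemma continuous_sum (I : Type) (r : seq I) (g : I -> F -> R) p :
  (forall k, {for p, continuous (g k)}) -> {for p, continuous (fun q => \sum_(k <- r) g k q)}.
Proof.
move=> cg; elim: r => [|k r IH].
  have -> : (fun q => \sum_(k <- [::]) g k q) = cst 0 by apply/funext => q; rewrite big_nil.
  exact: cst_continuous.
have -> : (fun q => \sum_(l <- k :: r) g l q) = (fun q => g k q + \sum_(l <- r) g l q).
  by apply/funext => q; rewrite big_cons.
by apply: continuousD.
Qed.

Lemma smooth_tensor_near m law A (s : tensor F m) i p (a : 'I_m) b : open A ->
  smooth_tensor law A s ->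
  chart_dom i p -> A p -> smooth_near i p (fun q => s i q a b).
Proof. by move=> oA [_ _ /(_ i a b)/(smooth_in_chartP i _ oA)]; apply. Qed.

Definition law_closed m (law : 'M[R]_d -> 'M[R]_(m, d) -> 'M[R]_(m, d) -> Prop) :=
  forall p (J : F -> 'M[R]_d) (x y : F -> 'M[R]_(m, d)),
    (forall a b, {for p, continuous (fun q => J q a b)}) ->
    (forall (a : 'I_m) b, {for p, continuous (fun q => x q a b)}) ->
    (forall (a : 'I_m) b, {for p, continuous (fun q => y q a b)}) ->
    (\forall q \near p, Int q -> law (J q) (x q) (y q)) -> law (J p) (x p) (y p).

Lemma smooth_near_jacobian i j p a b : chart_dom i p -> chart_dom j p ->
  smooth_near i p (fun q => Defs.jacobian i j q a b).
Proof.
move=> ip jp; rewrite (_ : (fun _ => _) = partial i a (fun q => chart_map j q 0 b)).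
  by apply: smooth_near_partial => //; exact: smooth_near_coord.
by apply/funext => q; rewrite mxE.
Qed.

Lemma near_dom i p : chart_dom i p -> \forall q \near p, chart_dom i q.
Proof. by move=> ip; apply: open_nbhs_nbhs; split=> //; exact: chart_dom_open. Qed.

(** A tensor on the interior extends to F as soon as its components extend in each
    chart separately, because compatibility on the boundary follows by density. *)
Lemma extend_tensor u m law (s c : tensor F m) : boundary_defining u -> law_closed law ->
  (forall i j p, Int p -> chart_dom i p -> chart_dom j p ->
     law (Defs.jacobian i j p) (s i p) (s j p)) ->
  (forall i p (a : 'I_m) b, chart_dom i p -> smooth_near i p (fun q => c i q a b)) ->
  (forall i p, chart_dom i p -> Int p -> c i p = s i p) ->
  exists t, [/\ smooth_tensor law [set: F] t, agree_on (@Int R d F) t s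
     & forall i p, chart_dom i p -> t i p = c i p].
Proof.
move=> hu lc ls sc Ec.
pose t : tensor F m := fun i p => if `[< chart_dom i p >] then c i p else 0.
have Et i p : chart_dom i p -> t i p = c i p by move=> ip; rewrite /t asboolT.
have st i p (a : 'I_m) b : chart_dom i p -> smooth_near i p (fun q => t i q a b).
  move=> ip; apply: (@smooth_near_ext _ _ _ _ _ (fun q => c i q a b)) => //; last exact: sc.
  by apply: filterS (near_dom ip) => q iq; rewrite Et.
exists t; split=> //; last by move=> i p Ip ip; rewrite Et // Ec.
split.
- by move=> i p np; rewrite /t asboolF // => ip; apply: np.
- move=> i j p _ ip jp; apply: (@lc p (Defs.jacobian i j) (t i) (t j)).
  + by move=> a b; exact: smooth_near_continuous ip (smooth_near_jacobian _ _ ip jp).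
  + by move=> a b; exact: smooth_near_continuous ip (st _ _ _ _ ip).
  + by move=> a b; exact: smooth_near_continuous jp (st _ _ _ _ jp).
  + near=> q => Iq; have iq : chart_dom i q by near: q; exact: near_dom.
    have jq : chart_dom j q by near: q; exact: near_dom.
    by rewrite !Et // !Ec //; exact: ls.
- by move=> i a b; apply/(smooth_in_chartP i _ openT) => p ip _; exact: st.
Unshelve. all: by end_near. Qed.

Lemma eq_mulmx_by_density u (m n k : nat) (x : F -> 'M[R]_(m, k)) (y : F ->
  'M[R]_(m, n)) (z : F -> 'M[R]_(n, k)) p :
  boundary_defining u ->
  (forall (a : 'I_m) (b : 'I_k), {for p, continuous (fun q => x q a b)}) ->
  (forall (a : 'I_m) (b : 'I_n), {for p, continuous (fun q => y q a b)}) ->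
  (forall (a : 'I_n) (b : 'I_k), {for p, continuous (fun q => z q a b)}) ->
  (\forall q \near p, Int q -> x q = y q *m z q) -> x p = y p *m z p.
Proof.
move=> hu cx cy cz E; apply/matrixP => a b; rewrite mxE.
apply: (@eq_by_density u p (fun q => x q a b) (fun q => \sum_l y q a l * z q l b)) => //.
  by apply: continuous_sum => l; apply: continuousM.
by apply: filterS E => q Eq Iq; rewrite Eq // mxE.
Qed.

Lemma form1_law_closed u : boundary_defining u ->
  law_closed (fun J (x y : 'M[R]_(1, d)) => x = y *m J^T).
Proof.
move=> hu p J x y cJ cx cy E.
apply: (@eq_mulmx_by_density u _ _ _ x y (fun q => (J q)^T)) => // a b.
rewrite (_ : (fun _ => _) = (fun q => J q b a)) //.
by apply/funext => q; rewrite mxE.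
Qed.

Lemma vector_law_closed u : boundary_defining u ->
  law_closed (fun J (x y : 'M[R]_(1, d)) => y = x *m J).
Proof.
by move=> hu p J x y cJ cx cy E; apply: (@eq_mulmx_by_density u _ _ _ y x J).
Qed.

End Boundary.

(** * The bordered matrix of a contact form *)

Section ContactMatrix.
Context {R : fieldType} {d : nat}.
Implicit Types (A om : 'M[R]_d) (be e v w : 'rV[R]_d) (u : R).

(** With A = d(be) and e = du, the entries v, s, c of a row solving
    (v, s, c) *m contact_mx = (mu, 0, f) satisfy
    v *m A = mu + s be - c du, du(v) = u s and be(v) = f + u c. *)
Definition contact_mx u A be e : 'M[R]_(d + (1 + 1)) :=
  block_mx A (row_mx e^T be^T) (col_mx (- be) e) (- u)%:M.

Lemma mul_contact_mx u A be e v (s c : 'M[R]_1) :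
  row_mx v (row_mx s c) *m contact_mx u A be e
  = row_mx (v *m A - s *m be + c *m e)
      (row_mx (v *m e^T - u *: s) (v *m be^T - u *: c)).
Proof.
rewrite /contact_mx mul_row_block mul_row_col mul_mx_row mulmxN addrA.
by congr row_mx; rewrite mul_mx_scalar scale_row_mx add_row_mx !scaleNr.
Qed.

(** The Schur complement of the block - u is A + (be^T e - e^T be) / u = u om. *)
Lemma det_contact_mx u A be e om : u != 0 ->
  u *: A + (be^T *m e - e^T *m be) = u ^+ 2 *: om ->
  \det (contact_mx u A be e) = u ^+ (d + 2) * \det om.
Proof.
move=> u0 H; pose C := col_mx (- be) e.
have E : contact_mx u A be e *m block_mx 1%:M 0 (u^-1 *: C) 1%:M
   = block_mx (u *: om) (row_mx e^T be^T) 0 (- u)%:M.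
  rewrite /contact_mx mulmx_block !mulmx1 !mulmx0 !add0r; congr block_mx.
    rewrite -scalemxAr mul_row_col mulmxN.
    have -> : u *: om = u^-1 *: (u ^+ 2 *: om) by rewrite scalerA expr2 mulKf.
    by rewrite -H [in RHS]scalerDr scalerA mulVf // scale1r [- _ + _]addrC.
  by rewrite mul_scalar_mx scalerA mulNr divff // scaleN1r subrr.
have := congr1 determinant E; rewrite det_mulmx det_lblock !det1 !mulr1 => ->.
by rewrite det_ublock detZ det_scalar -[(1 + 1)%N]/2%N sqrrN exprD mulrAC.
Qed.

(** A linear form is in the row space of a matrix when it kills the cokernel. *)
Lemma span2 be e v :
  (forall w, be *m w^T = 0 -> e *m w^T = 0 -> v *m w^T = 0) ->
  exists s c : 'M[R]_1, v = s *m be + c *m e.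
Proof.
move=> H; have /submxP[D ->] : (v <= col_mx be e)%MS.
  rewrite submxE; apply/eqP/rowP => j; rewrite mxE.
  pose w := (col j (cokermx (col_mx be e)))^T.
  have : col_mx be e *m w^T = 0.
    by rewrite /w trmxK colE mulmxA mulmx_coker mul0mx.
  rewrite mul_col_mx => /eqP; rewrite col_mx_eq0 => /andP[/eqP b0 /eqP e0].
  have := H w b0 e0; rewrite /w trmxK colE mulmxA -colE => /matrixP/(_ 0 0).
  by rewrite !mxE.
exists (lsubmx D), (rsubmx D).
by rewrite -mul_row_col hsubmxK.
Qed.

End ContactMatrix.

Section Forms.
Context {R : realType} {d : nat} (F : domain R d).
Implicit Types (i j : chart F) (p q : F) (g h u : F -> R) (a b : 'I_d) (A : set F).
Implicit Types (s t la be ka et : tensor F 1).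

Definition smooth_near_mx i p m n (M : F ->
  'M[R]_(m, n)) := forall (a : 'I_m) (b : 'I_n), smooth_near i p (fun q => M q a b).

Lemma form_smooth_near_on A s i p : open A -> smooth_form1 A s -> chart_dom i p -> A p ->
  smooth_near_mx i p (s i).
Proof. by move=> oA sA ip Ap a b; exact: (smooth_tensor_near _ _ oA sA ip Ap). Qed.

Lemma form_smooth_near s i p : smooth_form1 [set: F] s -> chart_dom i p -> smooth_near_mx i p (s i).
Proof. by move=> sA ip; apply: (form_smooth_near_on openT sA ip). Qed.

Lemma smooth_near_d0 g i p : chart_dom i p -> smooth_near i p g -> smooth_near_mx i p (d0 g i).
Proof.
move=> ip sg k a; rewrite (_ : (fun _ => _) = partial i a g); first exact: smooth_near_partial.
by apply/funext => q; rewrite mxE.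
Qed.

Lemma smooth_near_d1 s i p : chart_dom i p -> smooth_near_mx i p (s i) ->
  smooth_near_mx i p (d1 s i).
Proof.
move=> ip ss a b.
rewrite (_ : (fun _ => _) = fun q =>
  partial i a (fun q => s i q 0 b) q - partial i b (fun q => s i q 0 a) q).
  by apply: smooth_near_sub; apply: smooth_near_partial.
by apply/funext => q; rewrite mxE.
Qed.

Lemma d1_ext s t i p : chart_dom i p -> smooth_near_mx i p (s i) ->
  (\forall q \near p, s i q = t i q) -> d1 s i p = d1 t i p.
Proof.
move=> ip ss E; apply/matrixP => a b; rewrite !mxE.
by congr (_ - _); apply: partial_ext => //; apply: filterS E => q ->.
Qed.

Lemma d1_add s t i p : chart_dom i p -> smooth_near_mx i p (s i) -> smooth_near_mx i p (t i) ->
  d1 (fun i p => s i p + t i p) i p = d1 s i p + d1 t i p.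
Proof.
move=> ip ss st; apply/matrixP => a b; rewrite !mxE.
rewrite (_ : (fun q => (s i q + t i q) 0 b) = fun q => s i q 0 b + t i q 0 b); last first.
  by apply/funext => q; rewrite mxE.
rewrite (_ : (fun q => (s i q + t i q) 0 a) = fun q => s i q 0 a + t i q 0 a); last first.
  by apply/funext => q; rewrite mxE.
by rewrite !partial_add //; ring.
Qed.

Lemma d1_fscale g s i p : chart_dom i p -> smooth_near i p g -> smooth_near_mx i p (s i) ->
  d1 (fscale g s) i p = g p *: d1 s i p
    + ((d0 g i p)^T *m s i p - (s i p)^T *m d0 g i p).
Proof.
move=> ip sg ss; apply/matrixP => a b; rewrite !mxE !big_ord1 !mxE.
rewrite (_ : (fun q => fscale g s i q 0 b) = fun q => g q * s i q 0 b); last first.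
  by apply/funext => q; rewrite mxE.
rewrite (_ : (fun q => fscale g s i q 0 a) = fun q => g q * s i q 0 a); last first.
  by apply/funext => q; rewrite mxE.
by rewrite !partial_mul //; ring.
Qed.

Lemma d1_d0 g i p : chart_dom i p -> smooth_near i p g -> d1 (d0 g) i p = 0.
Proof.
move=> ip sg; apply/matrixP => a b; rewrite !mxE.
rewrite (_ : (fun q => d0 g i q 0 b) = partial i b g); last by apply/funext => q; rewrite mxE.
rewrite (_ : (fun q => d0 g i q 0 a) = partial i a g); last by apply/funext => q; rewrite mxE.
by rewrite partial_comm // subrr.
Qed.

(** The matrix of u^2 om = u d(be) - du /\ be, where be = u la and d(la) = om
    (see [u2om_Int]). Unlike om, it makes sense on the boundary. *)
Definition u2om u be i p : 'M[R]_d :=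
  u p *: d1 be i p + ((be i p)^T *m d0 u i p - (d0 u i p)^T *m be i p).

Lemma form_fscale_Int u la be i p : boundary_defining u -> form1_extension (fscale u la) be ->
  Int p -> chart_dom i p -> \forall q \near p, be i q = fscale u la i q.
Proof.
move=> hu [_ E] Ip ip; near=> q; apply: E; first by near: q; exact: near_Int hu Ip.
by near: q; exact: near_dom.
Unshelve. all: by end_near. Qed.

Lemma u2om_Int u la be i p : boundary_defining u -> smooth_form1 (@Int R d F) la ->
  form1_extension (fscale u la) be -> Int p -> chart_dom i p ->
  u2om u be i p = (u p) ^+ 2 *: d1 la i p.
Proof.
move=> hu sla bex Ip ip; have [sbe E] := bex.
have oI := open_Int hu.
have [su _ _ _] := hu.
rewrite /u2om (d1_ext ip (form_smooth_near sbe ip) (form_fscale_Int hu bex Ip ip)).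
rewrite d1_fscale //; [|exact: smooth_fun_near|exact: form_smooth_near_on oI sla ip Ip].
rewrite (E i p Ip ip) /fscale; set D := d1 la i p.
clearbody D; apply/matrixP => a b; rewrite !mxE !big_ord1 !mxE; ring.
Qed.

Definition contact_mx_at u be i p := contact_mx (u p) (d1 be i p) (be i p) (d0 u i p).

Lemma smooth_near_block m1 m2 n1 n2 i p (M11 : F -> 'M[R]_(m1, n1)) (M12 : F -> 'M[R]_(m1, n2))
    (M21 : F -> 'M[R]_(m2, n1)) (M22 : F -> 'M[R]_(m2, n2)) :
  smooth_near_mx i p M11 -> smooth_near_mx i p M12 -> smooth_near_mx i p M21 ->
    smooth_near_mx i p M22 ->
  smooth_near_mx i p (fun q => block_mx (M11 q) (M12 q) (M21 q) (M22 q)).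
Proof.
move=> s11 s12 s21 s22 a b.
case: (split_ordP a) => a' ->; case: (split_ordP b) => b' ->.
- rewrite (_ : (fun _ => _) = fun q => M11 q a' b') //; apply/funext => q; exact: block_mxEul.
- rewrite (_ : (fun _ => _) = fun q => M12 q a' b') //; apply/funext => q; exact: block_mxEur.
- rewrite (_ : (fun _ => _) = fun q => M21 q a' b') //; apply/funext => q; exact: block_mxEdl.
- rewrite (_ : (fun _ => _) = fun q => M22 q a' b') //; apply/funext => q; exact: block_mxEdr.
Qed.

Lemma smooth_near_row_mx m n1 n2 i p (M1 : F -> 'M[R]_(m, n1)) (M2 : F -> 'M[R]_(m, n2)) :
  smooth_near_mx i p M1 -> smooth_near_mx i p M2 ->
    smooth_near_mx i p (fun q => row_mx (M1 q) (M2 q)).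
Proof.
move=> s1 s2 a b; case: (split_ordP b) => b' ->.
- rewrite (_ : (fun _ => _) = fun q => M1 q a b') //; apply/funext => q; exact: row_mxEl.
- rewrite (_ : (fun _ => _) = fun q => M2 q a b') //; apply/funext => q; exact: row_mxEr.
Qed.

Lemma smooth_near_col_mx m1 m2 n i p (M1 : F -> 'M[R]_(m1, n)) (M2 : F -> 'M[R]_(m2, n)) :
  smooth_near_mx i p M1 -> smooth_near_mx i p M2 ->
    smooth_near_mx i p (fun q => col_mx (M1 q) (M2 q)).
Proof.
move=> s1 s2 a b; case: (split_ordP a) => a' ->.
- rewrite (_ : (fun _ => _) = fun q => M1 q a' b) //; apply/funext => q; exact: col_mxEu.
- rewrite (_ : (fun _ => _) = fun q => M2 q a' b) //; apply/funext => q; exact: col_mxEd.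
Qed.

Lemma smooth_near_trmx m n i p (M : F -> 'M[R]_(m, n)) : smooth_near_mx i p M ->
  smooth_near_mx i p (fun q => (M q)^T).
Proof.
by move=> sM a b; rewrite (_ : (fun _ => _) = fun q => M q b a) //; apply/funext => q; rewrite mxE.
Qed.

Lemma smooth_near_oppmx m n i p (M : F -> 'M[R]_(m, n)) : smooth_near_mx i p M ->
  smooth_near_mx i p (fun q => - M q).
Proof.
move=> sM a b; rewrite (_ : (fun _ => _) = fun q => - M q a b); first exact: smooth_near_opp.
by apply/funext => q; rewrite mxE.
Qed.

Lemma smooth_near_addmx m n i p (M N : F -> 'M[R]_(m, n)) : smooth_near_mx i p M ->
  smooth_near_mx i p N -> smooth_near_mx i p (fun q => M q + N q).
Proof.
move=> sM sN a b; rewrite (_ : (fun _ => _) = fun q => M q a b + N q a b);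
  first exact: smooth_near_add.
by apply/funext => q; rewrite mxE.
Qed.

Lemma smooth_near_scalemx m n i p g (M : F -> 'M[R]_(m, n)) : smooth_near i p g ->
  smooth_near_mx i p M -> smooth_near_mx i p (fun q => g q *: M q).
Proof.
move=> sg sM a b; rewrite (_ : (fun _ => _) = fun q => g q * M q a b); first exact: smooth_near_mul.
by apply/funext => q; rewrite mxE.
Qed.

Lemma smooth_near_scalar_mx n i p g : smooth_near i p g ->
  smooth_near_mx i p (fun q => (g q)%:M : 'M[R]_n).
Proof.
move=> sg a b; rewrite (_ : (fun _ => _) = fun q => g q * (a == b)%:R).
  by apply: smooth_near_mul => //; exact: smooth_near_cst.
by apply/funext => q; rewrite mxE mulr_natr.
Qed.

Lemma smooth_near_u2om u be i p : chart_dom i p -> smooth_near i p u ->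
  smooth_near_mx i p (be i) -> smooth_near_mx i p (u2om u be i).
Proof.
move=> ip su sb; apply: smooth_near_addmx.
  by apply: smooth_near_scalemx => //; exact: smooth_near_d1.
apply: smooth_near_addmx; first by apply: smooth_near_mulmx;
  [exact: smooth_near_trmx|exact: smooth_near_d0].
by apply: smooth_near_oppmx; apply: smooth_near_mulmx => //; apply: smooth_near_trmx;
  exact: smooth_near_d0.
Qed.

Lemma smooth_near_contact_mx u be i p : chart_dom i p -> smooth_near i p u ->
  smooth_near_mx i p (be i) -> smooth_near_mx i p (contact_mx_at u be i).
Proof.
move=> ip su sb; apply: smooth_near_block.
- exact: smooth_near_d1.
- by apply: smooth_near_row_mx; apply: smooth_near_trmx => //; exact: smooth_near_d0.
- by apply: smooth_near_col_mx; [exact: smooth_near_oppmx|exact: smooth_near_d0].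
- by apply: smooth_near_scalar_mx; exact: smooth_near_opp.
Qed.

Lemma det_contact_mx_Int u la be om i p : boundary_defining u -> smooth_form1 (@Int R d F) la ->
  agree_on (@Int R d F) (d1 la) om -> form1_extension (fscale u la) be ->
  Int p -> chart_dom i p -> \det (contact_mx_at u be i p) = (u p) ^+ (d + 2) * \det (om i p).
Proof.
move=> hu sla dla bex Ip ip; apply: det_contact_mx.
  by rewrite gt_eqF //; apply/(Int_gt0 p hu).
by rewrite -(dla i p Ip ip); exact: (u2om_Int hu sla bex Ip ip).
Qed.

Lemma boundary_tangentP u i p (v : 'rV[R]_d) : boundary_defining u -> boundary p -> chart_dom i p ->
  boundary_tangent v <-> v *m (d0 u i p)^T = 0.
Proof.
move=> hu bp ip; have [a0 a00 x0] := boundary_coord hu bp ip.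
have E : v *m (d0 u i p)^T = (v 0 a0 * partial i a0 u p)%:M.
  apply/rowP => k; rewrite !mxE ord1 eqxx mulr1n (bigD1 a0) //= !mxE big1 ?addr0 // => a aa0.
  rewrite !mxE partial_u_tangent ?mulr0 // => a0'; case/eqP: aa0.
  exact: ord0_unique.
rewrite E; split=> [/(_ a0 a00) ->|/matrixP/(_ 0 0)]; first by rewrite mul0r raddf0.
rewrite !mxE mulr1n => /eqP; rewrite mulf_eq0 (negPf (partial_u_normal hu ip bp a00)) orbF =>
  /eqP v0.
by move=> a a0'; rewrite (ord0_unique a0' a00).
Qed.

Definition contact_at s i p :=
    (exists2 v : 'rV[R]_d, boundary_tangent v & s i p *m v^T != 0) /\
    (forall v : 'rV[R]_d, boundary_tangent v -> s i p *m v^T = 0 ->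
       (forall w : 'rV[R]_d, boundary_tangent w -> s i p *m w^T = 0 ->
          v *m d1 s i p *m w^T = 0) ->
       v = 0).

Lemma mulmx_tr0 (v w : 'rV[R]_d) : v *m w^T = 0 <-> w *m v^T = 0.
Proof.
by split=> E; apply: trmx_inj; rewrite trmx_mul trmxK E trmx0.
Qed.

(** On the boundary u = 0, and (v, s, c) is in the kernel of the matrix when
    du(v) = be(v) = 0 and the contraction of v with d(be) is s be - c du. The
    latter vanishes on the tangent vectors killed by be, so the contact condition
    gives v = 0. Then s be = c du, and s = c = 0 because be does not vanish on
    the tangent vectors. The converse reads the same equivalences backwards, by
    [span2]. *)
Lemma contact_atP u be i p : boundary_defining u -> boundary p -> chart_dom i p ->
  contact_at be i p <-> \det (contact_mx_at u be i p) != 0.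
Proof.
move=> hu bp ip; have tP v := boundary_tangentP v hu bp ip.
have [su u0 ub du] := hu; have up : u p = 0 by exact: (ub p).2.
have e0 : d0 u i p != 0 by exact: du.
rewrite /contact_mx_at up; set e := d0 u i p in tP e0 *; set A := d1 be i p; set b := be i p.
split=> [[[v0 tv0 bv0] H]|/det0P H].
  apply/det0P => -[w w0]; rewrite -[w]hsubmxK -[rsubmx w]hsubmxK.
  set v := lsubmx w; set s := lsubmx _; set c := rsubmx _.
  rewrite mul_contact_mx !scale0r !subr0 => /eqP.
  rewrite !row_mx_eq0 => /andP[/eqP E1 /andP[/eqP E2 /eqP E3]].
  have EA : v *m A = s *m b - c *m e.
    by move/eqP: E1; rewrite -addrA addr_eq0 opprD opprK => /eqP.
  have v00 : v = 0.
    apply: H; [exact/tP|exact/mulmx_tr0|move=> x tx bx].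
    rewrite EA mulmxBl -!mulmxA bx mulmx0.
    by rewrite ((mulmx_tr0 _ _).1 ((tP x).1 tx)) mulmx0 subr0.
  have sc : s *m b = c *m e.
    by move/eqP: EA; rewrite v00 mul0mx eq_sym subr_eq0 => /eqP.
  have s0 : s = 0.
    have : s *m (b *m v0^T) = 0.
      by rewrite mulmxA sc -mulmxA ((mulmx_tr0 _ _).1 ((tP v0).1 tv0)) mulmx0.
    rewrite [b *m v0^T]mx11_scalar mul_mx_scalar => /eqP.
    rewrite scaler_eq0 => /orP[|/eqP //] /eqP E.
    by case/eqP: bv0; rewrite [LHS]mx11_scalar E raddf0.
  have c0 : c = 0.
    have : c *m e = 0 by rewrite -sc s0 mul0mx.
    rewrite [c]mx11_scalar mul_scalar_mx => /eqP.
    rewrite scaler_eq0 (negPf e0) orbF => /eqP ->; exact: raddf0.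
  case/eqP: w0; rewrite -[w]hsubmxK -[rsubmx w]hsubmxK -/v -/s -/c v00 s0 c0.
  by rewrite !row_mx0.
split.
  apply: contrapT => nv.
  have [s [c E]] : exists s c : 'M[R]_1, b = s *m (0 : 'rV[R]_d) + c *m e.
    apply: span2 => w _ /mulmx_tr0/tP tw; apply: contrapT => /eqP bw; apply: nv.
    by exists w.
  (* Otherwise be is a multiple c du of du, and (0, 1, c) is in the kernel. *)
  apply: H; exists (row_mx 0 (row_mx 1%:M c)).
    rewrite row_mx_eq0 negb_and row_mx_eq0 negb_and.
    by rewrite -scalemx1 scale1r oner_eq0 ?orbT.
  rewrite mul_contact_mx !scale0r !mul0mx !subr0 add0r mul1mx E mulmx0 add0r addNr.
  by rewrite !row_mx0.
move=> v tv bv Hv.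
have [s [c E]] : exists s c : 'M[R]_1, v *m A = s *m b + c *m e.
  by apply: span2 => w bw /mulmx_tr0/tP tw; exact: Hv.
apply: contrapT => /eqP v0; apply: H; exists (row_mx v (row_mx s (- c))).
  by rewrite row_mx_eq0 negb_and v0.
rewrite mul_contact_mx !scale0r !subr0 ((tP v).1 tv) ((mulmx_tr0 _ _).1 bv) E.
by rewrite mulNmx [s *m b + _]addrC addrK subrr !row_mx0.
Qed.

End Forms.

(** * The affine space of ideal Liouville forms *)

Section Affine.
Context {R : realType} {d : nat} (F : domain R d).
Implicit Types (i j : chart F) (p q : F) (g h u : F -> R) (a b : 'I_d) (A : set F).
Implicit Types (s t la be ka et : tensor F 1) (om : tensor F d).

(** On the boundary, du = rho du0. *)
Lemma boundary_defining_ratio u0 u i : boundary_defining u0 -> boundary_defining u ->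
  exists rho : F -> R, [/\ forall p, chart_dom i p -> smooth_near i p rho,
    forall p, chart_dom i p -> u p = u0 p * rho p
    & forall p, chart_dom i p -> boundary p -> rho p != 0].
Proof.
move=> hu0 hu; have [su _ ub _] := hu; have [su0 _ u0b _] := hu0.
have [rho [srho E]] : exists rho : F -> R, (forall p, chart_dom i p -> smooth_near i p rho) /\
    (forall p, chart_dom i p -> u p = u0 p * rho p).
  apply: divide_by_u => //; first by move=> p ip; exact: smooth_fun_near.
  by move=> p _ /ub.
exists rho; split=> // p ip bp; apply/eqP => rho0.
have [a0 a00 x0] := boundary_coord hu bp ip.
have := partial_u_normal hu ip bp a00.
rewrite (@partial_ext _ _ _ i a0 p u (fun q => u0 q * rho q) ip).
- rewrite partial_mul //; [|exact: smooth_fun_near|exact: srho].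
  by rewrite rho0 (u0b p).2 // !mul0r addr0 eqxx.
- exact: smooth_fun_near.
- by apply: filterS (near_dom ip) => q iq; exact: E.
Qed.

Lemma fscale_law g s i j p : s i p = s j p *m (Defs.jacobian i j p)^T ->
  fscale g s i p = fscale g s j p *m (Defs.jacobian i j p)^T.
Proof. by move=> E; rewrite /fscale E scalemxAl. Qed.

Lemma form_extends_change u0 u ka : boundary_defining u0 -> boundary_defining u ->
  smooth_form1 (@Int R d F) ka -> form_extends u0 ka -> form_extends u ka.
Proof.
move=> hu0 hu ska [et [set_ Eet]].
have [rho Hrho] := choice (fun i => boundary_defining_ratio i hu0 hu).
have [i j p Ip ip jp|i p a b ip|i p ip Ip|t [st Et _]] := @extend_tensor _ _ F u _ _ (fscale u ka)
   (fun i p => rho i p *: et i p) hu (form1_law_closed hu).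
- by apply: fscale_law; have [_ /(_ i j p Ip ip jp)] := ska.
- have [srho _ _] := Hrho i; apply: smooth_near_scalemx; [exact: srho|exact: form_smooth_near].
- have [_ Er _] := Hrho i; rewrite Eet // /fscale scalerA (Er p ip).
  by congr (_ *: _); rewrite mulrC.
- by exists t; split.
Qed.

(** In the interior the two determinants are u^(d+2) det om and u0^(d+2) det om. *)
Lemma det_contact_mx_transfer u0 u la la' be be0 om i p : boundary_defining u0 ->
  boundary_defining u ->
  smooth_form1 (@Int R d F) la -> agree_on (@Int R d F) (d1 la) om ->
    form1_extension (fscale u la) be ->
  smooth_form1 (@Int R d F) la' -> agree_on (@Int R d F) (d1 la') om ->
  form1_extension (fscale u0 la') be0 -> chart_dom i p -> boundary p ->
  \det (contact_mx_at u0 be0 i p) != 0 -> \det (contact_mx_at u be i p) != 0.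
Proof.
move=> hu0 hu sla dla bex sla' dla' bex0 ip bp.
have [su _ _ _] := hu; have [su0 _ _ _] := hu0.
have [rho [srho Erho rho0]] := boundary_defining_ratio i hu0 hu.
suff -> : \det (contact_mx_at u be i p) = (rho p) ^+ (d + 2) * \det (contact_mx_at u0 be0 i p).
  by move=> D0; rewrite mulf_neq0 // expf_neq0 // rho0.
apply: (@eq_by_density _ _ _ u p (fun q => \det (contact_mx_at u be i q))
  (fun q => (rho q) ^+ (d + 2) * \det (contact_mx_at u0 be0 i q)) hu).
- apply: (smooth_near_continuous ip); apply: smooth_near_det; apply: smooth_near_contact_mx => //.
    exact: smooth_fun_near.
  by apply: form_smooth_near => //; have [] := bex.
- apply: (smooth_near_continuous ip); apply: smooth_near_mul.
    rewrite (_ : (fun _ => _) = fun q => \prod_(k < d + 2) rho q).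
      by apply: smooth_near_prod => k _; exact: srho.
    by apply/funext => q; rewrite prodr_const card_ord.
  apply: smooth_near_det; apply: smooth_near_contact_mx => //; first exact: smooth_fun_near.
  by apply: form_smooth_near => //; have [] := bex0.
- near=> q => Iq; have iq : chart_dom i q by near: q; exact: near_dom.
  rewrite (det_contact_mx_Int hu sla dla bex Iq iq) (det_contact_mx_Int hu0 sla' dla' bex0 Iq iq).
  by rewrite (Erho q iq) exprMn mulrA [_ * u0 q ^+ _]mulrC.
Unshelve. all: by end_near. Qed.

(** Both the choice of the defining function and that of the primitive of om are
    immaterial for the contact condition. *)
Lemma contact_transfer u0 u la la' be be0 om : boundary_defining u0 -> boundary_defining u ->
  smooth_form1 (@Int R d F) la -> agree_on (@Int R d F) (d1 la) om ->
    form1_extension (fscale u la) be ->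
  smooth_form1 (@Int R d F) la' -> agree_on (@Int R d F) (d1 la') om ->
  form1_extension (fscale u0 la') be0 ->
  induces_contact_form be0 -> induces_contact_form be.
Proof.
move=> hu0 hu sla dla bex sla' dla' bex0 C0 i p ip bp.
apply/(contact_atP be hu bp ip).
apply: (det_contact_mx_transfer hu0 hu sla dla bex sla' dla' bex0 ip bp).
by apply/(contact_atP be0 hu0 bp ip); exact: C0.
Qed.

Lemma form1_add A s t : open A -> smooth_form1 A s -> smooth_form1 A t -> smooth_form1 A (s + t).
Proof.
move=> oA ss st; have [s0 sl _] := ss; have [t0 tl _] := st; split.
- by move=> i p np; rewrite !fctE s0 // t0 // addr0.
- by move=> i j p Ap ip jp; rewrite !fctE (sl i j) // (tl i j) // mulmxDl.
- move=> i a b; apply/(smooth_in_chartP i _ oA) => p ip Ap.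
  exact: (smooth_near_addmx (form_smooth_near_on oA ss ip Ap) (form_smooth_near_on oA st ip Ap)).
Qed.

Lemma form1_scale A (c : R) s : open A -> smooth_form1 A s -> smooth_form1 A (c *: s).
Proof.
move=> oA ss; have [s0 sl _] := ss; split.
- by move=> i p np; rewrite !fctE s0 // scaler0.
- by move=> i j p Ap ip jp; rewrite !fctE (sl i j) // scalemxAl.
- move=> i a b; apply/(smooth_in_chartP i _ oA) => p ip Ap.
  by apply: (smooth_near_scalemx (g := cst c));
    [exact: smooth_near_cst|exact: form_smooth_near_on oA ss ip Ap].
Qed.

Lemma form1_0 A : open A -> smooth_form1 A (0 : tensor F 1).
Proof.
move=> oA; split=> //; first by move=> i j p _ _ _;
  change ((0 : 'rV[R]_d) = 0 *m (Defs.jacobian i j p)^T); rewrite mul0mx.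
move=> i a b; apply/(smooth_in_chartP i _ oA) => p ip Ap.
rewrite (_ : (fun _ => _) = cst 0); first exact: smooth_near_cst.
by apply/funext => q; change ((0 : 'rV[R]_d) a b = 0); rewrite mxE.
Qed.

Lemma d1_addE A s t i p : open A -> smooth_form1 A s -> smooth_form1 A t -> A p -> chart_dom i p ->
  d1 (s + t) i p = d1 s i p + d1 t i p.
Proof.
move=> oA ss st Ap ip.
exact: (d1_add ip (form_smooth_near_on oA ss ip Ap) (form_smooth_near_on oA st ip Ap)).
Qed.

Lemma d1_scaleE A (c : R) s i p : open A -> smooth_form1 A s -> A p -> chart_dom i p ->
  d1 (c *: s) i p = c *: d1 s i p.
Proof.
move=> oA ss Ap ip.
have := d1_fscale ip (smooth_near_cst i p c) (form_smooth_near_on oA ss ip Ap).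
have -> : d0 (cst c) i p = 0 by apply/rowP => a; rewrite !mxE partial_cst.
by rewrite trmx0 mul0mx mulmx0 subr0 addr0.
Qed.

Lemma form_extension_add u s t s' t' : form1_extension (fscale u s) s' ->
  form1_extension (fscale u t) t' ->
  form1_extension (fscale u (s + t)) (s' + t').
Proof.
move=> [ss Es] [st Et]; split; first exact: form1_add openT _ _.
by move=> i p Ip ip; rewrite !fctE Es // Et // /fscale scalerDr.
Qed.

Lemma form_extension_scale u (c : R) s s' : form1_extension (fscale u s) s' ->
  form1_extension (fscale u (c *: s)) (c *: s').
Proof.
move=> [ss Es]; split; first exact: form1_scale openT _.
by move=> i p Ip ip; rewrite !fctE Es // /fscale !scalerA mulrC.
Qed.

Definition Liouville_directions u : set (tensor F 1) :=
  [set ka | closed_form1 (@Int R d F) ka /\ form_extends u ka].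

Lemma Liouville_directions_linear u (c : R) s t : boundary_defining u ->
  Liouville_directions u s -> Liouville_directions u t -> Liouville_directions u (c *: s + t).
Proof.
move=> hu [[ss ds] [s' Es]] [[st dt] [t' Et]].
have oI := open_Int hu; have scs := form1_scale c oI ss; split; last first.
  by exists (c *: s' + t'); apply: form_extension_add => //; exact: form_extension_scale.
split; first exact: form1_add.
move=> i p Ip ip; rewrite (d1_addE oI scs st) // (d1_scaleE c oI ss) //.
by rewrite ds // dt // scaler0 addr0.
Qed.

Lemma Liouville_directions0 u : boundary_defining u -> Liouville_directions u 0.
Proof.
move=> hu; have oI := open_Int hu; split; last first.
  exists 0; split; first exact: form1_0 openT.
  by move=> i p Ip ip; change (0 = u p *: (0 : 'rV[R]_d)); rewrite scaler0.
split; first exact: form1_0.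
move=> i p Ip ip; have := d1_scaleE 0 oI (form1_0 oI) Ip ip.
by rewrite !scale0r.
Qed.

Lemma Liouville_extends om u la : boundary_defining u -> ideal_Liouville_form om la ->
  exists be, form1_extension (fscale u la) be /\ induces_contact_form be.
Proof.
move=> hu [sla dla [u0 hu0 [be0 be0x C0]]].
have [be bex] : form_extends u la.
  by apply: (form_extends_change hu0 hu sla); exists be0.
exists be; split=> //.
exact: (contact_transfer hu0 hu sla dla bex sla dla be0x C0).
Qed.

Lemma affine_Liouville om u : ideal_Liouville_domain om -> boundary_defining u ->
  affine_space_over (Liouville_directions u) (ideal_Liouville_form om).
Proof.
move=> [_ ex] hu; have oI := open_Int hu; split=> //.
  split; first by apply/mem_set; exact: Liouville_directions0.
  by move=> c s t /set_mem ss /set_mem st; apply/mem_set; exact: Liouville_directions_linear.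
move=> x y hx; have [sx dx _] := hx; split=> [hy|[[sk dk] [et etx]]].
  have [sy dy _] := hy.
  have [bx [bxx _]] := Liouville_extends hu hx.
  have [bY [byx _]] := Liouville_extends hu hy.
  have -> : y - x = (-1) *: x + y by rewrite scaleN1r addrC.
  have sNx := form1_scale (-1) oI sx; split; last first.
    by exists ((-1) *: bx + bY); apply: form_extension_add => //; exact: form_extension_scale.
  split; first exact: form1_add.
  move=> i p Ip ip; rewrite (d1_addE oI sNx sy) // (d1_scaleE _ oI sx) //.
  by rewrite dx // dy // scaleN1r addNr.
have [bx [bxx Cx]] := Liouville_extends hu hx.
have Ey : y = x + (y - x) by rewrite addrC subrK.
have sy : smooth_form1 (@Int R d F) y by rewrite Ey; exact: form1_add.
have dy : agree_on (@Int R d F) (d1 y) om.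
  by move=> i p Ip ip; rewrite Ey (d1_addE oI sx sk) // dk // addr0 dx.
have byx : form1_extension (fscale u y) (bx + et).
  by rewrite Ey; exact: form_extension_add.
split=> //; exists u => //; exists (bx + et) => //.
exact: (contact_transfer hu hu sy dy byx sx dx bxx Cx).
Qed.

End Affine.

(** * Dual vector fields *)

Section Dual.
Context {R : realType} {d : nat} (F : domain R d).
Implicit Types (i j : chart F) (p q : F) (g h u : F -> R) (a b : 'I_d) (A : set F).
Implicit Types (s t la be ka et X : tensor F 1) (om : tensor F d).

(** The law of 2-forms expresses the invertible matrix of om as a product. *)
Lemma jacobian_unit om i j p : symplectic_form om -> Int p -> chart_dom i p -> chart_dom j p ->
  Defs.jacobian i j p \in unitmx.
Proof.
move=> [[[_ lw _] _] om_unit _] Ip ip jp.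
have := om_unit i p Ip ip; rewrite (lw i j p Ip ip jp) !unitmx_mul.
by case/andP=> /andP[].
Qed.

Lemma dual_law om ka i j p : symplectic_form om -> smooth_form1 (@Int R d F) ka ->
  Int p -> chart_dom i p -> chart_dom j p ->
  dual_vector_field om ka j p = dual_vector_field om ka i p *m Defs.jacobian i j p.
Proof.
move=> hom ska Ip ip jp; have J1 := jacobian_unit hom Ip ip jp.
have [[[_ lw _] _] om_unit _] := hom; have [_ lk _] := ska.
have Ei := dual_vector_fieldP ka hom Ip ip; have Ej := dual_vector_fieldP ka hom Ip jp.
have oj := om_unit j p Ip jp.
apply: (can_inj (mulmxK oj)) => /=; rewrite Ej.
have JT : (Defs.jacobian i j p)^T \in unitmx by rewrite unitmx_tr.
apply: (can_inj (mulmxK JT)) => /=.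
rewrite -(lk i j p Ip ip jp) -Ei (lw i j p Ip ip jp).
by rewrite /= !mulmxA.
Qed.

(** [u2om_Int] for ka, the differential of which is zero. *)
Lemma u2om_closed u ka et i p : boundary_defining u -> closed_form1 (@Int R d F) ka ->
  form1_extension (fscale u ka) et -> chart_dom i p -> u2om u et i p = 0.
Proof.
move=> hu [ska dka] etx ip; have [su _ _ _] := hu.
have sM : smooth_near_mx i p (u2om u et i).
  apply: smooth_near_u2om => //; first exact: smooth_fun_near.
  by apply: form_smooth_near => //; have [] := etx.
apply/matrixP => a b; rewrite [RHS]mxE.
apply: (@eq_by_density _ _ _ u p (fun q => u2om u et i q a b) (cst 0) hu).
- exact: smooth_near_continuous ip (sM a b).
- exact: cst_continuous.
- near=> q => Iq; have iq : chart_dom i q by near: q; exact: near_dom.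
  by rewrite (u2om_Int hu ska etx Iq iq) dka // scaler0 mxE.
Unshelve. all: by end_near. Qed.

Lemma closed_conormal u ka et i p : boundary_defining u -> closed_form1 (@Int R d F) ka ->
  form1_extension (fscale u ka) et -> chart_dom i p -> boundary p ->
  forall a b, et i p 0 a * d0 u i p 0 b = d0 u i p 0 a * et i p 0 b.
Proof.
move=> hu cka etx ip bp a b; have [_ _ ub _] := hu.
have := u2om_closed hu cka etx ip.
rewrite /u2om (ub p).2 // scale0r add0r => /eqP; rewrite subr_eq0 => /eqP/matrixP/(_ a b).
by rewrite !mxE !big_ord1 !mxE.
Qed.

(** The coefficient f such that et = f du on the boundary. The denominator, which
    is |du|^2 there, is positive on the whole chart thanks to the term u. *)
Definition normal_part u et i p : R :=
  (\sum_a et i p 0 a * d0 u i p 0 a) / (\sum_a d0 u i p 0 a ^+ 2 + u p).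

Lemma normal_den_neq0 u i p : boundary_defining u -> chart_dom i p ->
  \sum_a d0 u i p 0 a ^+ 2 + u p != 0.
Proof.
move=> hu ip; have [_ u0 ub du] := hu.
have S0 : 0 <= \sum_a d0 u i p 0 a ^+ 2 by apply: sumr_ge0 => a _; exact: sqr_ge0.
have [bp|Ip] := pselect (boundary p); last first.
  by rewrite gt_eqF // ltr_wpDl //; apply/(Int_gt0 p hu).
rewrite (ub p).2 // addr0; apply/eqP => E; have /eqP[] := du i p bp ip.
apply/rowP => a; rewrite [RHS]mxE; apply/eqP; rewrite -sqrf_eq0.
have := psumr_eq0P (fun a _ => sqr_ge0 (d0 u i p 0 a)) E.
by move=> ->.
Qed.

Lemma normal_partE u ka et i p : boundary_defining u -> closed_form1 (@Int R d F) ka ->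
  form1_extension (fscale u ka) et -> chart_dom i p -> boundary p ->
  et i p = normal_part u et i p *: d0 u i p.
Proof.
move=> hu cka etx ip bp; have [_ _ ub _] := hu.
have D := normal_den_neq0 hu ip; have := D; rewrite /normal_part (ub p).2 // addr0 => D'.
apply/rowP => b; rewrite !mxE -mulrA [X in _ * X]mulrC mulrA; apply: (canRL (mulfK D')).
rewrite mulr_suml mulr_sumr; apply: eq_bigr => a _.
have := closed_conormal hu cka etx ip bp b a; rewrite [d0 u i p 0 b]mxE => E.
by rewrite expr2 mulrA E; ring.
Qed.

Lemma smooth_near_normal_part u et i p : boundary_defining u -> smooth_form1 [set: F] et ->
  chart_dom i p ->
  smooth_near i p (normal_part u et i).
Proof.
move=> hu st ip; have [su _ _ _] := hu.
have s1 := form_smooth_near st ip; have s2 := smooth_near_d0 ip (smooth_fun_near su ip).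
apply: smooth_near_mul.
  by apply: smooth_near_sum => a _; apply: smooth_near_mul.
apply: smooth_near_inv => //; first exact: normal_den_neq0.
apply: smooth_near_add; last exact: smooth_fun_near.
apply: smooth_near_sum => a _.
rewrite (_ : (fun _ => _) = fun q => d0 u i q 0 a * d0 u i q 0 a); first exact: smooth_near_mul.
by apply/funext => q; rewrite expr2.
Qed.

Lemma divide_row u i (s : F -> 'rV[R]_d) : boundary_defining u ->
  (forall p, chart_dom i p -> smooth_near_mx i p s) ->
  (forall p, chart_dom i p -> boundary p -> s p = 0) ->
  exists mu : F -> 'rV[R]_d, (forall p, chart_dom i p -> smooth_near_mx i p mu) /\
    (forall p, chart_dom i p -> s p = u p *: mu p).
Proof.
move=> hu ss s0.
have H a : exists q : F -> R, (forall p, chart_dom i p -> smooth_near i p q) /\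
    (forall p, chart_dom i p -> s p 0 a = u p * q p).
  apply: divide_by_u => //; first by move=> p ip; exact: ss.
  by move=> p ip bp; rewrite s0 // mxE.
have [q Hq] := choice H.
exists (fun p => \row_a q a p); split=> p ip.
  move=> k a; rewrite (_ : (fun _ => _) = q a); first by have [sq _] := Hq a; exact: sq.
  by apply/funext => x; rewrite mxE.
by apply/rowP => a; rewrite !mxE; have [_ E] := Hq a; exact: E.
Qed.

Lemma det_contact_mx_neq0 u la be om i p : boundary_defining u -> symplectic_form om ->
  smooth_form1 (@Int R d F) la -> agree_on (@Int R d F) (d1 la) om ->
  form1_extension (fscale u la) be -> induces_contact_form be -> chart_dom i p ->
  \det (contact_mx_at u be i p) != 0.
Proof.
move=> hu [_ om_unit _] sla dla bex C ip.
have [bp|Ip] := pselect (boundary p).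
  by apply/(contact_atP be hu bp ip); exact: C.
rewrite (det_contact_mx_Int hu sla dla bex Ip ip) mulf_neq0 //.
  by rewrite expf_neq0 // gt_eqF //; apply/(Int_gt0 p hu).
by have := om_unit i p Ip ip; rewrite unitmxE unitfE.
Qed.

(** By division, et = f du + u mu. For the solution (Y, s, c) of the bordered
    system with right-hand side (mu, 0, f), the contraction of Y with u^2 om is
    u (mu + s be - c du) + (f + u c) du - u s be = et. *)
Lemma solve_dual u be et i : boundary_defining u -> smooth_form1 [set: F] be ->
  (forall p, chart_dom i p -> \det (contact_mx_at u be i p) != 0) ->
  (forall p, chart_dom i p -> smooth_near_mx i p (et i)) ->
  (exists f : F -> R, (forall p, chart_dom i p -> smooth_near i p f) /\
     forall p, chart_dom i p -> boundary p -> et i p = f p *: d0 u i p) ->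
  exists Y : F -> 'rV[R]_d, (forall p, chart_dom i p -> smooth_near_mx i p Y) /\
    (forall p, chart_dom i p -> Y p *m u2om u be i p = et i p).
Proof.
move=> hu sbe dP ste [f [sf Ef]]; have [su _ ub _] := hu.
have [mu [smu Emu]] : exists mu : F -> 'rV[R]_d, (forall p, chart_dom i p ->
  smooth_near_mx i p mu) /\
    (forall p, chart_dom i p -> et i p - f p *: d0 u i p = u p *: mu p).
  apply: divide_row => // p ip; last by move=> bp; rewrite Ef // subrr.
  apply: smooth_near_addmx; first exact: ste.
  apply: smooth_near_oppmx; apply: smooth_near_scalemx; first exact: sf.
  by apply: smooth_near_d0 => //; exact: smooth_fun_near.
pose Z p : 'rV[R]_(d + (1 + 1)) := row_mx (mu p) (row_mx 0 (f p)%:M) *m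
   ((\det (contact_mx_at u be i p))^-1 *: \adj (contact_mx_at u be i p)).
exists (fun p => lsubmx (Z p)); split=> p ip.
  have sZ : smooth_near_mx i p Z.
    apply: smooth_near_mulmx.
      apply: smooth_near_row_mx; first exact: smu.
      apply: smooth_near_row_mx; last by apply: smooth_near_scalar_mx; exact: sf.
      by move=> a b; exact: smooth_near_cst.
    apply: smooth_near_invmx => //; last exact: dP.
    apply: smooth_near_contact_mx => //; first exact: smooth_fun_near.
    exact: form_smooth_near.
  move=> a b; rewrite (_ : (fun _ => _) = fun q => Z q a (lshift (1 + 1) b)); first exact: sZ.
  by apply/funext => q; rewrite mxE.
have EZ : Z p *m contact_mx_at u be i p = row_mx (mu p) (row_mx 0 (f p)%:M).
  rewrite /Z -mulmxA -scalemxAl mul_adj_mx scale_scalar_mx mulVf ?mulmx1 //; exact: dP.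
set Y := lsubmx (Z p); set s := lsubmx (rsubmx (Z p)); set c := rsubmx (rsubmx (Z p)).
move: EZ; rewrite -[Z p]hsubmxK -[rsubmx (Z p)]hsubmxK -/Y -/s -/c mul_contact_mx.
move=> /eq_row_mx[E1 /eq_row_mx[E2 E3]].
have {}E1 : Y *m d1 be i p = mu p + s *m be i p - c *m d0 u i p.
  by rewrite -E1 addrAC addrK subrK.
have {}E2 : Y *m (d0 u i p)^T = u p *: s by apply/eqP; rewrite -subr_eq0 E2.
have {}E3 : Y *m (be i p)^T = (f p)%:M + u p *: c by rewrite -E3 subrK.
rewrite /u2om mulmxDr mulmxBr -scalemxAr E1 !mulmxA E2 E3.
rewrite mulmxDl mul_scalar_mx -!scalemxAl !scalerDr scalerN -Emu //.
rewrite addrACA -addrA; set x := et i p; set y := f p *: _; set z := u p *: (s *m _);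
  set w := u p *: _.
by rewrite !addrA; apply/rowP => a; rewrite !mxE; ring.
Qed.

(** In the interior, the solution of [solve_dual] is determined by its contraction
    with om. *)
Lemma form_extends_dual u la be om ka : boundary_defining u -> symplectic_form om ->
  smooth_form1 (@Int R d F) la -> agree_on (@Int R d F) (d1 la) om ->
  form1_extension (fscale u la) be -> induces_contact_form be ->
  closed_form1 (@Int R d F) ka -> form_extends u ka -> dual_extends om u ka.
Proof.
move=> hu hom sla dla bex C cka [et etx]; have [sbe _] := bex; have [ste Ete] := etx.
have [ska dka] := cka; have [_ om_unit _] := hom.
have HY i : exists Y : F -> 'rV[R]_d, (forall p, chart_dom i p -> smooth_near_mx i p Y) /\
    (forall p, chart_dom i p -> Y p *m u2om u be i p = et i p).
  apply: solve_dual => //.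
  - by move=> p ip; exact: (det_contact_mx_neq0 hu hom sla dla bex C ip).
  - by move=> p ip; exact: form_smooth_near.
  - exists (normal_part u et i); split=> p ip; first exact: smooth_near_normal_part.
    exact: (normal_partE hu cka etx).
have [Y Hy] := choice HY.
have [i j p Ip ip jp|i p a b ip|i p ip Ip|X [sX EX _]] :=
  @extend_tensor _ _ F u _ _ (dual_quotient om u ka)
   Y hu (vector_law_closed hu).
- by rewrite /dual_quotient /fscale (dual_law hom ska Ip ip jp) scalemxAl.
- by have [sY _] := Hy i; exact: sY.
- have [_ EY] := Hy i; have up : u p != 0 by rewrite gt_eqF //; apply/(Int_gt0 p hu).
  have := EY p ip; rewrite (u2om_Int hu sla bex Ip ip) (dla i p Ip ip) (Ete i p Ip ip).
  rewrite /dual_quotient /fscale /dual_vector_field -scalemxAr => E.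
  have oi := om_unit i p Ip ip.
  apply: (can_inj (mulmxK oi)) => /=; rewrite -scalemxAl mulmxKV //.
  apply: (scalerI (_ : u p ^+ 2 != 0)); first by rewrite expf_neq0.
  by rewrite E scalerA expr2 mulfK.
- by exists X; split.
Qed.

Lemma dual_form_product u la be om ka X i p : boundary_defining u -> symplectic_form om ->
  smooth_form1 (@Int R d F) la -> agree_on (@Int R d F) (d1 la) om ->
  form1_extension (fscale u la) be -> vector_field_extension (dual_quotient om u ka) X ->
  Int p -> chart_dom i p -> X i p *m u2om u be i p = fscale u ka i p.
Proof.
move=> hu hom sla dla bex [sX EX] Ip ip.
have up : u p != 0 by rewrite gt_eqF //; apply/(Int_gt0 p hu).
rewrite (u2om_Int hu sla bex Ip ip) (dla i p Ip ip) (EX i p Ip ip) /dual_quotient /fscale.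
rewrite -scalemxAr -scalemxAl (dual_vector_fieldP ka hom Ip ip).
by rewrite scalerA expr2 mulfK.
Qed.

Lemma vector_smooth_near X i p : smooth_vector_field [set: F] X -> chart_dom i p ->
  smooth_near_mx i p (X i).
Proof. by move=> sX ip a b; exact: (smooth_tensor_near _ _ openT sX ip). Qed.

Lemma dual_extends_form u la be om ka : boundary_defining u -> symplectic_form om ->
  smooth_form1 (@Int R d F) la -> agree_on (@Int R d F) (d1 la) om ->
  form1_extension (fscale u la) be ->
  closed_form1 (@Int R d F) ka -> dual_extends om u ka -> form_extends u ka.
Proof.
move=> hu hom sla dla bex [ska dka] [X Xx]; have [sbe _] := bex; have [sX EX] := Xx.
have [su _ _ _] := hu.
have [i j p Ip ip jp|i p a b ip|i p ip Ip|t [st Et _]] := @extend_tensor _ _ F u _ _ (fscale u ka)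
   (fun i p => X i p *m u2om u be i p) hu (form1_law_closed hu).
- by apply: fscale_law; have [_ /(_ i j p Ip ip jp)] := ska.
- apply: smooth_near_mulmx; first exact: vector_smooth_near.
  by apply: smooth_near_u2om => //; [exact: smooth_fun_near|exact: form_smooth_near].
- exact: (dual_form_product hu hom sla dla bex Xx).
- by exists t; split.
Qed.

(** For u = 0, the contraction of X with u^2 om is be(X) du - du(X) be. Evaluated at
    a tangent vector v with be(v) != 0, the multiple et of du and the first term
    vanish, whence du(X) = 0. *)
Lemma dual_boundary u la be om ka et X i p : boundary_defining u -> symplectic_form om ->
  smooth_form1 (@Int R d F) la -> agree_on (@Int R d F) (d1 la) om ->
  form1_extension (fscale u la) be -> induces_contact_form be ->
  closed_form1 (@Int R d F) ka -> form1_extension (fscale u ka) et ->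
  vector_field_extension (dual_quotient om u ka) X ->
  boundary p -> chart_dom i p ->
  X i p *m (d0 u i p)^T = 0 /\ et i p = (X i p *m (be i p)^T) *m d0 u i p.
Proof.
move=> hu hom sla dla bex C cka etx Xx bp ip.
have [su _ ub _] := hu; have [sbe _] := bex; have [sX _] := Xx; have [ste Ete] := etx.
have E : et i p = X i p *m u2om u be i p.
  apply: (eq_mulmx_by_density hu).
  - by move=> a b; apply: (smooth_near_continuous ip); exact: form_smooth_near.
  - by move=> a b; apply: (smooth_near_continuous ip); exact: vector_smooth_near.
  - move=> a b; apply: (smooth_near_continuous ip); apply: smooth_near_u2om => //.
      exact: smooth_fun_near.
    exact: form_smooth_near.
  - near=> q => Iq; have iq : chart_dom i q by near: q; exact: near_dom.
    by rewrite (dual_form_product hu hom sla dla bex Xx Iq iq) Ete.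
have E0 : et i p = X i p *m (be i p)^T *m d0 u i p - X i p *m (d0 u i p)^T *m be i p.
  by rewrite E /u2om (ub p).2 // scale0r add0r mulmxBr !mulmxA.
suff T : X i p *m (d0 u i p)^T = 0 by split=> //; rewrite E0 T mul0mx subr0.
have [[v tv bv] _] := C i p ip bp.
have eN := normal_partE hu cka etx ip bp.
have dv : d0 u i p *m v^T = 0 by apply/mulmx_tr0/(boundary_tangentP v hu bp ip).
have := congr1 (fun x => x *m v^T) E0.
rewrite eN -scalemxAl dv scaler0 mulmxBl -!mulmxA dv !mulmx0 sub0r => /esym/eqP.
rewrite oppr_eq0 [be i p *m v^T]mx11_scalar mulmxA mul_mx_scalar scaler_eq0.
case/orP=> /eqP // b0; case/eqP: bv; rewrite [LHS]mx11_scalar b0; exact: raddf0.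
Unshelve. all: by end_near. Qed.

End Dual.

(** * Logarithmic differentials *)

Section Log.
Context {R : realType} {d : nat} (F : domain R d).
Implicit Types (i j : chart F) (p q : F) (f g h u : F -> R) (a b : 'I_d) (A : set F).
Implicit Types (s t la be ka et X : tensor F 1) (om : tensor F d).

Definition locally_constant_boundary f :=
  forall p, boundary p -> \forall q \near p, f q = f p.

Lemma d0_locally_constant f i p : smooth_fun f -> locally_constant_boundary f ->
  boundary p -> chart_dom i p -> \forall q \near p, d0 f i q = 0.
Proof.
move=> sf lf bp ip; have nW : \forall q \near p, f q = f p /\ chart_dom i q.
  by apply: filterI; [exact: lf|exact: near_dom].
have [W [oW Wp HW]] := near_open nW.
apply: filterS (open_nbhs_nbhs (conj oW Wp)) => q Wq; have [_ iq] := HW q Wq.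
apply/rowP => a; rewrite !mxE.
rewrite (@partial_ext _ _ _ i a q f (cst (f p)) iq).
- exact: partial_cst.
- exact: smooth_fun_near.
- by apply: filterS (open_nbhs_nbhs (conj oW Wq)) => x /HW[].
Qed.

(** The logarithm is not even bounded near the boundary, but df is zero there. *)
Lemma smooth_near_ln_d0 u f i p : boundary_defining u -> smooth_fun f ->
  locally_constant_boundary f ->
  chart_dom i p -> smooth_near_mx i p (fun q => ln (u q) *: d0 f i q).
Proof.
move=> hu sf lf ip; have [su _ _ _] := hu.
have [bp|Ip] := pselect (boundary p); last first.
  apply: smooth_near_scalemx; last by apply: smooth_near_d0 => //; exact: smooth_fun_near.
  apply: smooth_near_ln => //; first by apply/(Int_gt0 p hu).
  exact: smooth_fun_near.
move=> k a; apply: (@smooth_near_ext _ _ _ i p (cst 0)) => //; last exact: smooth_near_cst.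
by apply: filterS (d0_locally_constant sf lf bp ip) => q ->; rewrite scaler0 mxE.
Qed.

Lemma d0_f_ln u f i p : boundary_defining u -> smooth_fun f -> Int p -> chart_dom i p ->
  d0 (fun q => f q * ln (u q)) i p = (f p / u p) *: d0 u i p + ln (u p) *: d0 f i p.
Proof.
move=> hu sf Ip ip; have [su _ _ _] := hu; have up := (Int_gt0 p hu).1 Ip.
have s1 := smooth_fun_near sf ip; have s2 := smooth_fun_near su ip.
apply/rowP => a; rewrite !mxE partial_mul //; last exact: smooth_near_ln.
by rewrite partial_ln //; ring.
Qed.

Lemma smooth_near_f_ln u f i p : boundary_defining u -> smooth_fun f -> Int p -> chart_dom i p ->
  smooth_near i p (fun q => f q * ln (u q)).
Proof.
move=> hu sf Ip ip; have [su _ _ _] := hu; have up := (Int_gt0 p hu).1 Ip.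
apply: smooth_near_mul; first exact: smooth_fun_near.
by apply: smooth_near_ln => //; exact: smooth_fun_near.
Qed.

(** The extension of u ka is u t + f du + u log u df. *)
Lemma log_extends_form u ka : boundary_defining u -> smooth_form1 (@Int R d F) ka ->
  log_extends u ka -> form_extends u ka.
Proof.
move=> hu ska [f [sf lf [t [st _] Et]]]; have [su _ _ _] := hu.
have [i j p Ip ip jp|i p a b ip|i p ip Ip|t' [st' Et' _]] :=
  @extend_tensor _ _ F u _ _ (fscale u ka)
   (fun i p => u p *: t i p + (f p *: d0 u i p
     + u p *: (ln (u p) *: d0 f i p))) hu (form1_law_closed hu).
- by apply: fscale_law; have [_ /(_ i j p Ip ip jp)] := ska.
- have s1 := smooth_fun_near sf ip; have s2 := smooth_fun_near su ip.
  apply: smooth_near_addmx; first by apply: smooth_near_scalemx => //; exact: form_smooth_near.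
  apply: smooth_near_addmx; first by apply: smooth_near_scalemx => //; exact: smooth_near_d0.
  by apply: smooth_near_scalemx => //; exact: smooth_near_ln_d0.
- have up : u p != 0 by rewrite gt_eqF //; apply/(Int_gt0 p hu).
  rewrite -(Et i p Ip ip) (d0_f_ln hu sf Ip ip) /fscale.
  by apply/rowP => a; rewrite !mxE; field.
- by exists t'; split.
Qed.

(** The function be(X), computed in an arbitrary chart at p. *)
Definition pairing be X p : R :=
  (X (sval (cid (chart_cover p))) p *m (be (sval (cid (chart_cover p))) p)^T) 0 0.

Lemma pairingE be X i p : smooth_form1 [set: F] be -> smooth_vector_field [set: F] X ->
  chart_dom i p -> pairing be X p = (X i p *m (be i p)^T) 0 0.
Proof.
move=> [_ lb _] [_ lX _] ip; rewrite /pairing; case: (cid _) => j jp /=.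
by rewrite (lX i j p) // (lb i j p) // trmx_mul trmxK mulmxA.
Qed.

Lemma smooth_pairing be X : smooth_form1 [set: F] be -> smooth_vector_field [set: F] X ->
  smooth_fun (pairing be X).
Proof.
move=> sb sX i; apply/(smooth_in_chartP i _ openT) => p ip _.
apply: (@smooth_near_ext _ _ _ i p (fun q => (X i q *m (be i q)^T) 0 0)) => //.
  by apply: filterS (near_dom ip) => q iq; rewrite (pairingE sb sX iq).
by apply: smooth_near_mulmx; [exact: vector_smooth_near|apply: smooth_near_trmx;
  exact: form_smooth_near].
Qed.

(** Write et = g du + u mu. Then u^2 d(ka) = 0 becomes
    u (dg /\ du + u d(mu)) = 0. The expression in parentheses is thus zero in the
    interior, hence also on the boundary, where it says that the tangential
    derivatives of g vanish. *)
Lemma coefficient_locally_constant u ka et g : boundary_defining u ->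
  closed_form1 (@Int R d F) ka ->
  form1_extension (fscale u ka) et -> smooth_fun g ->
  (forall i p, boundary p -> chart_dom i p -> et i p = g p *: d0 u i p) ->
  forall p, boundary p -> \forall q \near p, boundary q -> g q = g p.
Proof.
move=> hu cka etx sg Eg p bp; have [i ip] := chart_cover p.
have [su _ ub _] := hu; have [ste Ete] := etx.
have sgu q : chart_dom i q -> smooth_near i q u by move=> iq; exact: smooth_fun_near.
have sgg q : chart_dom i q -> smooth_near i q g by move=> iq; exact: smooth_fun_near.
have [mu [smu Emu]] : exists mu : F -> 'rV[R]_d, (forall p, chart_dom i p ->
  smooth_near_mx i p mu) /\
    (forall p, chart_dom i p -> et i p - g p *: d0 u i p = u p *: mu p).
  apply: divide_row => // q iq; last by move=> bq; rewrite Eg // subrr.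
  apply: smooth_near_addmx; first exact: form_smooth_near.
  by apply: smooth_near_oppmx; apply: smooth_near_scalemx;
    [exact: sgg|apply: smooth_near_d0 => //; exact: sgu].
pose mut : tensor F 1 := fun _ => mu.
pose W q : 'M[R]_d := (d0 g i q)^T *m d0 u i q - (d0 u i q)^T *m d0 g i q + u q *: d1 mut i q.
(* W is the matrix of dg /\ du + u d(mu). *)
have EW q : chart_dom i q -> u q *: W q = 0.
  move=> iq; rewrite -(u2om_closed hu cka etx iq) /u2om.
  have E1 : d1 et i q = d1 (fun i q => fscale g (d0 u) i q + fscale u mut i q) i q.
    apply: d1_ext => //; first exact: form_smooth_near.
    by apply: filterS (near_dom iq) => x ix; rewrite /fscale -Emu // addrC subrK.
  have sd := smooth_near_d0 iq (sgu q iq).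
  rewrite E1 d1_add //; [|by apply: smooth_near_scalemx;
    [exact: sgg|]|by apply: smooth_near_scalemx; [exact: sgu|exact: smu]].
  rewrite !d1_fscale ?d1_d0 //; [|exact: sgu|exact: sgu|exact: smu|exact: sgg].
  rewrite scaler0 add0r.
  have -> : et i q = g q *: d0 u i q + u q *: mu q by rewrite -Emu // addrC subrK.
  rewrite /W; move: (d1 mut i q) (d0 u i q) (d0 g i q) => D e eg.
  by apply/matrixP => a b; rewrite !mxE !big_ord1 !mxE; ring.
have WI q : Int q -> chart_dom i q -> W q = 0.
  move=> Iq iq; have uq : u q != 0 by rewrite gt_eqF //; apply/(Int_gt0 q hu).
  by apply: (scalerI uq); rewrite EW // scaler0.
have sW q : chart_dom i q -> smooth_near_mx i q W.
  move=> iq; have s1 := smooth_near_d0 iq (sgg q iq); have s2 := smooth_near_d0 iq (sgu q iq).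
  apply: smooth_near_addmx.
    apply: smooth_near_addmx; first by apply: smooth_near_mulmx => //; exact: smooth_near_trmx.
    by apply: smooth_near_oppmx; apply: smooth_near_mulmx => //; exact: smooth_near_trmx.
  by apply: smooth_near_scalemx; [exact: sgu|apply: smooth_near_d1 => //; exact: smu].
have W0 q : chart_dom i q -> W q = 0.
  move=> iq; apply/matrixP => a b; rewrite [RHS]mxE.
  apply: (@eq_by_density _ _ _ u q (fun q => W q a b) (cst 0) hu).
  - exact: smooth_near_continuous iq (sW q iq a b).
  - exact: cst_continuous.
  - by near=> x => Ix; rewrite (WI x Ix) ?mxE //; near: x; exact: near_dom.
have [a0 a00 x0] := boundary_coord hu bp ip.
have tang q a : chart_dom i q -> boundary q -> a != a0 -> partial i a g q = 0.
  move=> iq bq aa0; have := congr1 (fun M : 'M[R]_d => M a a0) (W0 q iq).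
  have ua : partial i a u q = 0.
    apply: (partial_u_tangent hu iq bq) => a0'; case/eqP: aa0; exact: ord0_unique.
  have u0 := partial_u_normal hu iq bq a00.
  rewrite /W (ub q).2 // scale0r addr0 !mxE !big_ord1 !mxE ua mul0r subr0 => /eqP.
  by rewrite mulf_eq0 (negPf u0) orbF => /eqP.
have L := @locally_constant_hyperplane R d (g \o chart_inv i) (chart_map i p) a0 a00
  (halfspace_chart ip) x0 (sgg p ip).
have nT : \forall q \near p, True by exact: nearW.
have {}L : \forall y \near chart_map i p, halfspace y -> y 0 a0 = 0 ->
    (g \o chart_inv i) y = (g \o chart_inv i) (chart_map i p).
  apply: L => a aa0.
  apply: filterS (near_chart ip nT) => y Hy /Hy[iy Ey _] y0.
  rewrite -{1}Ey; apply: tang => //.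
  by apply: (coord_boundary iy a00); rewrite Ey.
apply: filterS (near_chart_map ip L) => q [iq Hq] bq.
move: Hq; rewrite /= !chart_mapK //; apply.
by have [a1 a10] := boundary_coord hu bq iq; rewrite (ord0_unique a10 a00).
Unshelve. all: by end_near. Qed.

(** Compactness, used along the filter of the finite sets of values that contain a
    given one. *)
Lemma finitely_many_values u g : boundary_defining u ->
  (forall p, boundary p -> \forall q \near p, boundary q -> g q = g p) ->
  exists C : seq R, forall p, boundary p -> g p \in C.
Proof.
move=> hu H.
pose G : set_system (seq R) := 
  fun P => exists C : seq R, forall C' : seq R, {subset C <= C'} -> P C'.
have FG : Filter G.
  split.
  - by exists [::].
  - move=> P Q [C HC] [C' HC']; exists (C ++ C') => C'' S; split.
      by apply: HC => x xC; apply: S; rewrite mem_cat xC.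
    by apply: HC' => x xC; apply: S; rewrite mem_cat xC orbT.
  - by move=> P Q PQ [C HC]; exists C => C' /HC/PQ.
have := (compact_near_coveringP _).1 (@domain_compact _ _ F).
move=> /(_ (seq R) G (fun (C : seq R) p => boundary p -> g p \in C) FG)[p _|C HC].
  have nU : \forall q \near p, boundary q -> g q = g p.
    have [bp|Ip] := pselect (boundary p); first exact: H.
    by apply: filterS (near_Int hu Ip) => q Iq /Iq.
  exists ([set q | boundary q -> g q = g p], [set C : seq R | g p \in C]) => /=.
    by split=> //; exists [:: g p] => C' S; apply: S; rewrite inE.
  by move=> [q C] /= [Eq Cq] bq; rewrite Eq.
by exists C => p bp; exact: (HC C).
Qed.

Lemma separation_radius (C : seq R) : exists2 r : R, 0 < r &
  forall c c', c \in C -> c' \in C -> c != c' -> 2 * r < (c - c') ^+ 2.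
Proof.
have H (S : seq R) : exists2 r : R, 0 < r & forall x, x \in S -> 0 < x -> 2 * r < x.
  elim: S => [|x S [r r0 Hr]]; first by exists 1.
  have [x0|x0] := ltP 0 x; last first.
    by exists r => // y; rewrite inE => /predU1P[->|yS]; [rewrite ltNge x0|exact: Hr].
  exists (Num.min r (x / 3)); first by rewrite lt_min r0 divr_gt0.
  have m1 : Num.min r (x / 3) <= r by rewrite ge_min lexx.
  have m2 : Num.min r (x / 3) <= x / 3 by rewrite ge_min lexx orbT.
  move=> y; rewrite inE => /predU1P[-> _|yS y0]; first lra.
  by have := Hr y yS y0; lra.
have [r r0 Hr] := H [seq (c - c') ^+ 2 | c <- C, c' <- C].
exists r => // c c' cC cC' cc'; apply: Hr; first by apply: allpairs_f.
by rewrite exprn_even_gt0 //= subr_eq0.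
Qed.

(** Composition of g with a function of one variable that equals c near each of the
    finitely many boundary values c of g. *)
Lemma flatten_near_boundary u g : boundary_defining u -> smooth_fun g ->
  (forall p, boundary p -> \forall q \near p, boundary q -> g q = g p) ->
  exists f, [/\ smooth_fun f, locally_constant_boundary f & forall p, boundary p -> f p = g p].
Proof.
move=> hu sg lg; have [C0 HC0] := finitely_many_values hu lg.
pose C := undup C0; have HC p : boundary p -> g p \in C by rewrite mem_undup; exact: HC0.
have [r r0 Hr] := separation_radius C.
pose f q := \sum_(c <- C) c * smooth_bump r ((g q - c) ^+ 2).
have nf p : boundary p -> \forall q \near p, f q = g p.
  move=> bp; have cp := HC p bp.
  have ng c : {for p, continuous (fun q => (g q - c) ^+ 2)}.
    apply: (@continuous_comp _ _ _ (fun q => g q - c) (fun x : R => x ^+ 2)).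
      by apply: continuousB; [exact: smooth_fun_continuous|exact: cst_continuous].
    exact: exprn_continuous.
  have n1 : \forall q \near p, (g q - g p) ^+ 2 <= r.
    apply: filterS (cont_near_lt (ng (g p)) r0) => q.
    by rewrite subrr expr0n /= sub0r normrN ger0_norm ?sqr_ge0 // => /ltW.
  have n2 : \forall q \near p, forall c : seq_sub C, val c != g p -> 2 * r <= (g q - val c) ^+ 2.
    apply: (filter_forall (nbhs_filter p)) => c.
    have [->|cg] := eqVneq (val c) (g p); first by exact: nearW.
    have D : 0 < (g p - val c) ^+ 2 - 2 * r.
      by rewrite subr_gt0; apply: Hr => //; [exact: valP|rewrite eq_sym].
    apply: filterS (cont_near_lt (ng (val c)) D) => q; rewrite ltr_norml => /andP[_]; lra.
  near=> q.
  have q1 : (g q - g p) ^+ 2 <= r by near: q.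
  have q2 : forall c : seq_sub C, val c != g p -> 2 * r <= (g q - val c) ^+ 2 by near: q.
  rewrite /f (big_rem (g p)) //= bump1 // mulr1 big_seq big1 ?addr0 // => c.
  rewrite mem_rem_uniq ?undup_uniq // inE => /andP[cg cC].
  by rewrite bump0 ?mulr0 //; exact: (q2 (SeqSub cC)).
have Ef p : boundary p -> f p = g p by move=> bp; exact: nbhs_singleton (nf p bp).
exists f; split=> //.
- move=> i; apply/(smooth_in_chartP i _ openT) => p ip _.
  apply: smooth_near_sum => c _; apply: smooth_near_mul; first exact: smooth_near_cst.
  apply: smooth_near_bump => //.
  rewrite (_ : (fun _ => _) = fun q => (g q - cst c q) * (g q - cst c q)).
    have s1 : smooth_near i p (fun q => g q - cst c q).
      by apply: smooth_near_sub; [exact: smooth_fun_near|exact: smooth_near_cst].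
    exact: smooth_near_mul.
  by apply/funext => q; rewrite expr2.
- by move=> p bp; rewrite Ef //; exact: nf.
Unshelve. all: by end_near. Qed.

(** The boundary values of et are those of f du as well, so that et = f du + u mu,
    and ka - d(f log u) = mu - log u df. *)
Lemma form_extends_log u ka et g : boundary_defining u -> closed_form1 (@Int R d F) ka ->
  form1_extension (fscale u ka) et -> smooth_fun g ->
  (forall i p, boundary p -> chart_dom i p -> et i p = g p *: d0 u i p) ->
  log_extends u ka.
Proof.
move=> hu cka etx sg Eg; have lg := coefficient_locally_constant hu cka etx sg Eg.
have [f [sf lf Ef]] := flatten_near_boundary hu sg lg.
have [su _ ub _] := hu; have [ste Ete] := etx; have [ska dka] := cka.
have oI := open_Int hu.
have Hmu i : exists mu : F -> 'rV[R]_d, (forall p, chart_dom i p -> smooth_near_mx i p mu) /\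
    (forall p, chart_dom i p -> et i p - f p *: d0 u i p = u p *: mu p).
  apply: divide_row => // q iq; last by move=> bq; rewrite Eg // Ef // subrr.
  apply: smooth_near_addmx; first exact: form_smooth_near.
  apply: smooth_near_oppmx; apply: smooth_near_scalemx; first exact: smooth_fun_near.
  by apply: smooth_near_d0 => //; exact: smooth_fun_near.
have [mu Hmu'] := choice Hmu.
pose s : tensor F 1 := fun i p => ka i p - d0 (fun q => f q * ln (u q)) i p.
have [i j p Ip ip jp|i p a b ip|i p ip Ip|t [st Et Ec]] := @extend_tensor _ _ F u _ _ s
   (fun i p => mu i p - ln (u p) *: d0 f i p) hu (form1_law_closed hu).
- have [_ lk _] := ska; rewrite /s (lk i j p Ip ip jp) mulmxBl; congr (_ - _).
  by apply: d0_law => //; exact: smooth_near_f_ln.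
- have [smu _] := Hmu' i; apply: smooth_near_addmx; first exact: smu.
  by apply: smooth_near_oppmx; exact: smooth_near_ln_d0.
- have [_ Emu] := Hmu' i; have up : u p != 0 by rewrite gt_eqF //; apply/(Int_gt0 p hu).
  rewrite /s (d0_f_ln hu sf Ip ip) opprD addrA; congr (_ - _).
  apply: (scalerI up); rewrite -Emu // Ete // scalerBr; congr (_ - _).
  by rewrite scalerA mulrC divfK.
exists f; split=> //; exists t; last by move=> i p Ip ip; rewrite Et.
split=> // i p _ ip.
have sd := smooth_near_d1 ip (form_smooth_near st ip).
apply/matrixP => a b; rewrite [RHS]mxE.
apply: (@eq_by_density _ _ _ u p (fun q => d1 t i q a b) (cst 0) hu).
- exact: smooth_near_continuous ip (sd a b).
- exact: cst_continuous.
- near=> q => Iq; have iq : chart_dom i q by near: q; exact: near_dom.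
  have nI := near_Int hu Iq.
  rewrite (@d1_ext _ _ _ t (fun i p => ka i p
    + fscale (cst (-1)) (d0 (fun q => f q * ln (u q))) i p) i q iq).
  + have sk := form_smooth_near_on oI ska iq Iq.
    have sfl := smooth_near_f_ln hu sf Iq iq; have sdl := smooth_near_d0 iq sfl.
    rewrite d1_add //; last by apply: (smooth_near_scalemx (g := cst (-1))) => //;
      exact: smooth_near_cst.
    rewrite dka // add0r d1_fscale //; last exact: smooth_near_cst.
    have -> : d0 (cst (-1) : F -> R) i q = 0 by apply/rowP => c; rewrite !mxE partial_cst.
    by rewrite d1_d0 // trmx0 mul0mx mulmx0 subr0 addr0 scaler0 mxE.
  + exact: form_smooth_near.
  + near=> x; rewrite Et; first by rewrite /s /fscale scaleN1r.
      by near: x; exact: nI.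
    by near: x; exact: near_dom.
Unshelve. all: by end_near. Qed.

End Log.

Theorem corollary5 (R : realType) (d : nat) (F : domain R d) (om : tensor F d)
    (hF : ideal_Liouville_domain om) :
  (exists V : set (tensor F 1), affine_space_over V (ideal_Liouville_form om)) /\
  (forall u : F -> R, boundary_defining u ->
     [/\ affine_space_over
           [set ka | closed_form1 (@Int R d F) ka /\ form_extends u ka]
           (ideal_Liouville_form om),
         forall ka : tensor F 1, closed_form1 (@Int R d F) ka ->
           [<-> form_extends u ka; dual_extends om u ka; log_extends u ka]
       & forall ka X : tensor F 1, closed_form1 (@Int R d F) ka ->
           vector_field_extension (dual_quotient om u ka) X ->
           tangent_to_boundary X]).
Proof.
have [hom [la hla]] := hF; have [sla dla [u0 hu0 _]] := hla.
split; first by eexists; exact: affine_Liouville hF hu0.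
move=> u hu; have [be [bex C]] := Liouville_extends hu hla; have [sbe _] := bex.
split; first exact: affine_Liouville hF hu.
- move=> ka cka; have ska := cka.1.
  have i_ii := form_extends_dual hu hom sla dla bex C cka.
  have ii_i := dual_extends_form hu hom sla dla bex cka.
  split; [exact: i_ii|split; [|exact: log_extends_form]].
  move=> [X Xx]; have [et etx] : form_extends u ka by apply: ii_i; exists X.
  have sX := Xx.1.
  apply: (form_extends_log hu cka etx (smooth_pairing sbe sX)) => i p bp ip.
  have [_ ->] := dual_boundary hu hom sla dla bex C cka etx Xx bp ip.
  by rewrite (pairingE sbe sX ip) {1}[X i p *m _]mx11_scalar mul_scalar_mx.
- move=> ka X cka Xx i p ip bp.
  have [et etx] : form_extends u ka.
    by apply: (dual_extends_form hu hom sla dla bex cka); exists X.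
  apply/(boundary_tangentP _ hu bp ip).
  by have [] := dual_boundary hu hom sla dla bex C cka etx Xx bp ip.
Qed.
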